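(* Let $2<p<\infty$. Then (a) $B_p\hookrightarrow\left(\sum^{\oplus}\ell^2\right)_{\ell^p}$; (b) $\left(\sum^{\oplus}\ell^2\right)_{\ell^p}\overset{c}{\hookrightarrow}B_p$; (c) $B_p\equiv\left(\sum^{\oplus}\ell^2\right)_{\ell^p}$; (d) $B_p\not\overset{c}{\hookrightarrow}\left(\sum^{\oplus}\ell^2\right)_{\ell^p}$; (e) $X_p\hookrightarrow B_p$; (f) $B_p\not\hookrightarrow X_p$; (g) $X_p\not\overset{c}{\hookrightarrow}B_p$; (h) $L^p\not\hookrightarrow B_p$; (i) statements (b), (d) and (g) also hold for $1<p<2$.
   Context: For Banach spaces $X,Y$: $X\hookrightarrow Y$ means $X$ is isomorphic to a closed subspace of $Y$; $X\overset{c}{\hookrightarrow}Y$ means $X$ is isomorphic to a complemented subspace of $Y$ (the range of a bounded linear projection on $Y$); $X\equiv Y$ means $X\hookrightarrow Y$ and $Y\hookrightarrow X$. A slashed symbol denotes negation. $L^p=L^p(0,1)$. $\left(\sum^{\oplus}X\right)_{\ell^p}$ is the $\ell^p$-sum of countably infinitely many copies of $X$. For $2<p<\infty$ and a sequence $w=\{w_n\}$ of positive scalars, $X_{p,w}$ is the Banach space of all scalar sequences $x=\{x_n\}$ with finite norm $\max\{(\sum|x_n|^p)^{1/p},(\sum|w_nx_n|^2)^{1/2}\}$. The sequence $w$ satisfies condition $( * )$ if for each $\epsilon>0$, $\sum_{w_n<\epsilon}w_n^{2p/(p-2)}=\infty$. For fixed $p$, all $X_{p,w}$ with $w$ satisfying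 $( * )$ are mutually isomorphic; $X_p$ denotes any such $X_{p,w}$. For $2<p<\infty$ and $N\in\mathbb N$, let $v^{(N)}$ be the constant sequence with value $(1/N)^{(p-2)/(2p)}$; then $B_p=\left(X_{p,v^{(1)}}\oplus X_{p,v^{(2)}}\oplus\cdots\right)_{\ell^p}$ (the $\ell^p$-sum). For $1<q<2$ with conjugate index $p$, $X_q$ is the dual of $X_p$ and $B_q$ is the dual of $B_p$. *)

(* Defs.v *)
From HB Require Import structures.
From mathcomp Require Import all_boot all_order all_algebra.
From mathcomp Require Import all_classical all_reals all_analysis.
From mathcomp Require Import measurable_realfun.

Set Implicit Arguments.
Unset Strict Implicit.
Unset Printing Implicit Defensive.

Import Order.TTheory GRing.Theory Num.Theory.
Import numFieldNormedType.Exports.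

Local Open Scope classical_set_scope.
Local Open Scope ring_scope.

(** Scalars are real throughout: [R : realType]. *)

Section Embeddings.
Context {R : realType}.
Implicit Types X Y : normedModType R.

(** [T] is an isomorphism (linear homeomorphism) from [X] onto the subspace
    [A] of [Y]; [S] restricted to [A] is its inverse. *)
Definition iso_onto X Y (T : {linear X -> Y}) (A : set Y) : Prop :=
  [/\ range T = A, continuous T &
      exists2 S : Y -> X, cancel T S & {within A, continuous S}].

Definition embeds X Y : Prop :=
  exists (A : set Y) (T : {linear X -> Y}), closed A /\ iso_onto T A.

Definition bounded_projection Y (P : {linear Y -> Y}) : Prop :=
  continuous P /\ forall y, P (P y) = P y.

Definition cembeds X Y : Prop :=
  exists (P : {linear Y -> Y}) (T : {linear X -> Y}),
    bounded_projection P /\ iso_onto T (range P).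

Definition mutually_embed X Y : Prop := embeds X Y /\ embeds Y X.

End Embeddings.

(** A norm that may take the value [+oo]; [finpart] below is the normed space
    of the vectors where it is finite. *)
Record extnorm (R : realType) (V : lmodType R) := ExtNorm {
  enorm :> V -> \bar R;
  enorm_ge0 : forall x, (0 <= enorm x)%E;
  enormD : forall x y, (enorm (x + y) <= enorm x + enorm y)%E;
  enormZ : forall a x, (enorm (a *: x) = `|a|%:E * enorm x)%E;
  enorm_eq0 : forall x, enorm x = 0%E -> x = 0 }.

Section FinPart.
Context (R : realType) (V : lmodType R) (N : extnorm V).

Definition finpart_pred : {pred V} := [pred x | (N x < +oo)%E].

Lemma finpart_submod_closed : submod_closed finpart_pred.
Proof.
split.
  by rewrite inE -(scale0r 0) enormZ normr0 mul0e.
move=> a x y; rewrite !inE => xf yf.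
rewrite (le_lt_trans (enormD _ _ _))// lte_add_pinfty//.
by rewrite enormZ lte_mul_pinfty.
Qed.

HB.instance Definition _ :=
  GRing.isSubmodClosed.Build R V finpart_pred finpart_submod_closed.

Definition finpart : Type := {x : V | finpart_pred x}.

HB.instance Definition _ := SubType.on finpart.
HB.instance Definition _ := Choice.on finpart.
HB.instance Definition _ := [SubChoice_isSubLmodule of finpart by <:].

Definition finpart_norm (x : finpart) : R := fine (N (val x)).

Lemma finpart_normE x : (finpart_norm x)%:E = N (val x).
Proof. by rewrite fineK// ge0_fin_numE ?enorm_ge0//; exact: (valP x). Qed.

Lemma finpart_normD x y :
  finpart_norm (x + y) <= finpart_norm x + finpart_norm y.
Proof. by rewrite -lee_fin EFinD !finpart_normE raddfD enormD. Qed.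

Lemma finpart_normZ a x : finpart_norm (a *: x) = `|a| * finpart_norm x.
Proof. by apply: EFin_inj; rewrite EFinM !finpart_normE linearZ enormZ. Qed.

Lemma finpart_norm_eq0 x : finpart_norm x = 0 -> x = 0.
Proof.
by move=> x0; apply/val_inj/(@enorm_eq0 _ _ N); rewrite -finpart_normE x0.
Qed.

HB.instance Definition _ := @Lmodule_isNormed.Build R finpart
  finpart_norm finpart_normD finpart_normZ finpart_norm_eq0.

End FinPart.

Section SeqSpace.
Context (R : realType) (E : nat -> normedModType R).

Definition seqspace : Type := forall n, E n.

HB.instance Definition _ := gen_eqMixin seqspace.
HB.instance Definition _ := gen_choiceMixin seqspace.

Lemma seqspace_ext (x y : seqspace) : (forall n, x n = y n) -> x = y.
Proof. exact: functional_extensionality_dep. Qed.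

Definition seqspace_zero : seqspace := fun n => 0.
Definition seqspace_opp (x : seqspace) : seqspace := fun n => - x n.
Definition seqspace_add (x y : seqspace) : seqspace := fun n => x n + y n.
Definition seqspace_scale (a : R) (x : seqspace) : seqspace :=
  fun n => a *: x n.

Lemma seqspace_addA : associative seqspace_add.
Proof. by move=> x y z; apply: seqspace_ext => n; exact: addrA. Qed.

Lemma seqspace_addC : commutative seqspace_add.
Proof. by move=> x y; apply: seqspace_ext => n; exact: addrC. Qed.

Lemma seqspace_add0 : left_id seqspace_zero seqspace_add.
Proof. by move=> x; apply: seqspace_ext => n; exact: add0r. Qed.

Lemma seqspace_addN : left_inverse seqspace_zero seqspace_opp seqspace_add.
Proof. by move=> x; apply: seqspace_ext => n; exact: addNr. Qed.

HB.instance Definition _ := GRing.isZmodule.Build seqspace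
  seqspace_addA seqspace_addC seqspace_add0 seqspace_addN.

Lemma seqspace_scaleA a b x :
  seqspace_scale a (seqspace_scale b x) = seqspace_scale (a * b) x.
Proof. by apply: seqspace_ext => n; exact: scalerA. Qed.

Lemma seqspace_scale1 : left_id 1 seqspace_scale.
Proof. by move=> x; apply: seqspace_ext => n; exact: scale1r. Qed.

Lemma seqspace_scaleDr : right_distributive seqspace_scale +%R.
Proof. by move=> a x y; apply: seqspace_ext => n; exact: scalerDr. Qed.

Lemma seqspace_scaleDl x : {morph seqspace_scale^~ x : a b / a + b}.
Proof. by move=> a b; apply: seqspace_ext => n; exact: scalerDl. Qed.

HB.instance Definition _ := GRing.Zmodule_isLmodule.Build R seqspace
  seqspace_scaleA seqspace_scale1 seqspace_scaleDr seqspace_scaleDl.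

End SeqSpace.

Lemma ge0_ler_poweR (R : realType) (r : R) (a b : \bar R) :
  0 <= r -> (0 <= a)%E -> (a <= b)%E -> (a `^ r <= b `^ r)%E.
Proof.
move=> r0 a0 ab; apply: gt0_ler_poweR => //; rewrite in_itv/= leey andbT//.
exact: le_trans ab.
Qed.

Section LpNorm.
Context (R : realType) (E : nat -> normedModType R).
Implicit Types (p : R) (x y : seqspace E).
Local Open Scope ereal_scope.

(** By [Lnorm_counting], this is [(\sum_(n <oo) `|x n| `^ p) `^ p^-1]. *)
Definition lp_enorm p x : \bar R := 'N[counting]_p%:E [(fun n => (`|x n|%R)%:E)].

Lemma lp_enorm_ge0 p x : 0 <= lp_enorm p x.
Proof. exact: Lnorm_ge0. Qed.

Lemma lp_enormD p x y : (1 <= p)%R ->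
  lp_enorm p (x + y)%R <= lp_enorm p x + lp_enorm p y.
Proof.
move=> p1; have p0 : (0 < p)%R by exact: lt_le_trans p1.
apply: (@le_trans _ _ ('N[counting]_p%:E [EFin \o
    ((fun n => `|x n|%R) \+ (fun n => `|y n|%R))%R])).
  rewrite /lp_enorm !Lnorm_counting//.
  apply: ge0_ler_poweR; rewrite ?invr_ge0 ?(ltW p0)//.
    by apply: nneseries_ge0 => n _ _; exact: poweR_ge0.
  apply: lee_nneseries => [n _ _|n _]; first exact: poweR_ge0.
  apply: ge0_ler_poweR; rewrite ?(ltW p0) ?abse_ge0//.
  by rewrite lee_fin !ger0_norm ?addr_ge0 ?ler_normD.
exact: minkowski_EFin.
Qed.

Lemma lp_enormZ p a x : (1 <= p)%R ->
  lp_enorm p (a *: x)%R = `|a|%:E * lp_enorm p x.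
Proof.
move=> p1; have p0 : (0 < p)%R by exact: lt_le_trans p1.
rewrite /lp_enorm !Lnorm_counting//.
under eq_eseriesr => n _.
  rewrite normrZ EFinM abseM poweRM ?abse_ge0//.
  rewrite [X in X * _](_ : _ = (`|a| `^ p)%:E); last by rewrite /= normr_id.
  over.
rewrite nneseriesZl; last by move=> n _; exact: poweR_ge0.
rewrite poweRM ?lee_fin ?powR_ge0//; last first.
  by apply: nneseries_ge0 => n _ _; exact: poweR_ge0.
by rewrite poweR_EFin -powRrM mulfV ?gt_eqF// powRr1.
Qed.

Lemma lp_enorm_eq0 p x : (1 <= p)%R -> lp_enorm p x = 0 -> x = 0%R.
Proof.
move=> p1; have p0 : (0 < p)%R by exact: lt_le_trans p1.
rewrite /lp_enorm !Lnorm_counting//.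
move/poweR_eq0_eq0 => H; apply: seqspace_ext => n.
have {}H : \sum_(k <oo) `|(`|x k|%R)%:E| `^ p = 0.
  by apply: H; apply: nneseries_ge0 => k _ _; exact: poweR_ge0.
have /eqP : `|(`|x n|%R)%:E| `^ p = 0.
  apply/eqP; rewrite eq_le poweR_ge0 andbT -H.
  rewrite (nneseriesD1 (n := n) (P := xpredT))//; last first.
    by move=> k _; exact: poweR_ge0.
  by rewrite leeDl//; apply: nneseries_ge0 => k _ _; exact: poweR_ge0.
rewrite poweR_eq0 ?abse_ge0// => /andP[+ _].
by rewrite abse_eq0 eqe normr_eq0 => /eqP.
Qed.

Definition lp_extnorm p (p1 : (1 <= p)%R) : extnorm (seqspace E) :=
  @ExtNorm R (seqspace E) (lp_enorm p) (lp_enorm_ge0 p)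
    (fun x y => @lp_enormD p x y p1) (fun a x => @lp_enormZ p a x p1)
    (fun x => @lp_enorm_eq0 p x p1).

End LpNorm.

Section LpSum.
Context (R : realType).

Definition lpsum (p : R) (p1 : 1 <= p) (E : nat -> normedModType R) :
  normedModType R := finpart (lp_extnorm E p1).

Definition ell2 : normedModType R := lpsum (ler1n R 2) (fun=> R).

Definition lpsum_ell2 (p : R) (p1 : 1 <= p) : normedModType R :=
  lpsum p1 (fun=> ell2).

End LpSum.

Section XpSpace.
Context (R : realType) (w : nat -> R).
Let V : lmodType R := seqspace (fun=> R).

Definition wmul (x : V) : V := fun n => w n * x n.

Lemma wmulD x y : wmul (x + y) = wmul x + wmul y.
Proof. by apply: seqspace_ext => n; exact: mulrDr. Qed.

Lemma wmulZ a x : wmul (a *: x) = a *: wmul x.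
Proof. by apply: seqspace_ext => n; exact: mulrCA. Qed.

Local Open Scope ereal_scope.

Definition Xp_enorm (p : R) (x : V) : \bar R :=
  maxe (lp_enorm p x) (lp_enorm 2 (wmul x)).

Lemma Xp_enorm_ge0 p x : 0 <= Xp_enorm p x.
Proof. by rewrite le_max lp_enorm_ge0. Qed.

Lemma Xp_enormD p x y : (1 <= p)%R ->
  Xp_enorm p (x + y)%R <= Xp_enorm p x + Xp_enorm p y.
Proof.
move=> p1; rewrite ge_max wmulD; apply/andP; split.
- apply: le_trans (lp_enormD _ _ p1) _.
  by apply: leeD; rewrite le_max lexx.
- apply: le_trans (lp_enormD _ _ (ler1n R 2)) _.
  by apply: leeD; rewrite le_max lexx orbT.
Qed.

Lemma Xp_enormZ p a x : (1 <= p)%R ->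
  Xp_enorm p (a *: x)%R = `|a|%:E * Xp_enorm p x.
Proof.
move=> p1; rewrite /Xp_enorm wmulZ lp_enormZ// lp_enormZ ?ler1n//.
by rewrite maxeMr// lee_fin.
Qed.

Lemma Xp_enorm_eq0 p x : (1 <= p)%R -> Xp_enorm p x = 0 -> x = 0%R.
Proof.
move=> p1 x0; apply: (lp_enorm_eq0 p1); apply/eqP.
by rewrite eq_le lp_enorm_ge0 andbT -x0 le_max lexx.
Qed.

Definition Xp_extnorm p (p1 : (1 <= p)%R) : extnorm V :=
  @ExtNorm R V (Xp_enorm p) (Xp_enorm_ge0 p)
    (fun x y => @Xp_enormD p x y p1) (fun a x => @Xp_enormZ p a x p1)
    (fun x => @Xp_enorm_eq0 p x p1).

End XpSpace.

Lemma ge1_gt2 (R : realType) (p : R) : 2 < p -> 1 <= p.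
Proof. by move=> p2; apply/ltW/(le_lt_trans _ p2); rewrite ler1n. Qed.

Section Xp.
Context (R : realType) (p : R) (p2 : 2 < p).

Definition Xp (w : nat -> R) : normedModType R :=
  finpart (Xp_extnorm w (ge1_gt2 p2)).

Definition condition_star (w : nat -> R) : Prop :=
  forall e : R, 0 < e ->
    (\sum_(n <oo | (w n < e)%R) (w n `^ (2 * p / (p - 2)))%:E = +oo)%E.

Definition vseq (N : nat) : nat -> R :=
  fun=> (N%:R^-1) `^ ((p - 2) / (2 * p)).

(** The summands are indexed from 1: the term of index [N] is for [N.+1]. *)
Definition Bp : normedModType R :=
  lpsum (ge1_gt2 p2) (fun N => Xp (vseq N.+1)).

End Xp.

Section Dual.
Context (R : realType) (X : normedModType R).

Definition dual_pred : {pred X -> R} :=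
  [pred f : X -> R | `[< linear (f : X -> R^o) /\ continuous f >]].

Lemma dual_submod_closed : submod_closed dual_pred.
Proof.
split.
  apply/asboolP; split; last exact: cst_continuous.
  by move=> a x y; rewrite /= scaler0 addr0.
move=> a f g /asboolP[lf cf] /asboolP[lg cg].
apply/asboolP; split.
  move=> b x y; rewrite !fctE lf lg !scalerDr addrACA.
  by rewrite !scalerA mulrC.
move=> x; apply: cvgD; last exact: cg.
by apply: cvgZr; exact: cf.
Qed.

HB.instance Definition _ :=
  GRing.isSubmodClosed.Build R (X -> R) dual_pred dual_submod_closed.

Definition dual_type : Type := {f : X -> R | dual_pred f}.

HB.instance Definition _ := SubType.on dual_type.
HB.instance Definition _ := Choice.on dual_type.
HB.instance Definition _ := [SubChoice_isSubLmodule of dual_type by <:].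

Definition dual_norm (f : dual_type) : R :=
  sup [set `|val f x| | x in [set x : X | `|x| <= 1]].

Let dual_linear (f : dual_type) : linear (val f : X -> R^o).
Proof. by case: f => f /= /asboolP[]. Qed.

Let dual_lin (f : dual_type) : {linear X -> R^o} :=
  HB.pack (val f : X -> R^o) (GRing.isLinear.Build _ _ _ _ _ (dual_linear f)).

Lemma dual_has_sup (f : dual_type) :
  has_sup [set `|val f x| | x in [set x : X | `|x| <= 1]].
Proof.
split; first by exists `|val f 0|, 0; rewrite //= normr0 ler01.
have /bounded_funP/(_ 1)[M Mf] : bounded_near (dual_lin f) (nbhs (0 : X)).
  apply: continuous_linear_bounded.
  by case: f => f /= /asboolP[_ cf]; exact: cf.
by exists M => _ [x /= x1 <-]; exact: Mf.
Qed.

Lemma dual_norm_ub (f : dual_type) x : `|x| <= 1 -> `|val f x| <= dual_norm f.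
Proof. by move=> x1; apply: (ub_le_sup (dual_has_sup f).2); exists x. Qed.

Lemma dual_valD (f g : dual_type) x : val (f + g) x = val f x + val g x.
Proof. by have -> : val (f + g) = val f + val g by rewrite raddfD. Qed.

Lemma dual_valZ a (f : dual_type) x : val (a *: f) x = a * val f x.
Proof. by have -> : val (a *: f) = a *: val f by rewrite linearZ. Qed.

Lemma dual_normD (f g : dual_type) : dual_norm (f + g) <= dual_norm f + dual_norm g.
Proof.
apply: ge_sup; first by have [] := dual_has_sup (f + g).
move=> _ [x x1 <-]; rewrite dual_valD (le_trans (ler_normD _ _))//.
by rewrite lerD// dual_norm_ub.
Qed.

Let dual_normZ_le a (f : dual_type) : dual_norm (a *: f) <= `|a| * dual_norm f.
Proof.
apply: ge_sup; first by have [] := dual_has_sup (a *: f).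
move=> _ [x x1 <-]; rewrite dual_valZ normrM.
by rewrite ler_wpM2l// dual_norm_ub.
Qed.

Lemma dual_normZ a (f : dual_type) : dual_norm (a *: f) = `|a| * dual_norm f.
Proof.
apply/eqP; rewrite eq_le dual_normZ_le/=.
have [->|a0] := eqVneq a 0.
  rewrite normr0 mul0r scale0r (le_trans _ (@dual_norm_ub 0 0 _))//.
  by rewrite normr0.
rewrite -ler_pdivlMl ?normr_gt0// -normfV.
by rewrite -{1}[f](scalerK a0) (le_trans (dual_normZ_le _ _)).
Qed.

Lemma dual_norm_eq0 (f : dual_type) : dual_norm f = 0 -> f = 0.
Proof.
move=> f0; apply/val_inj/funext => x; rewrite raddf0/=.
have [->|x0] := eqVneq x 0; first exact: (linear0 (dual_lin f)).
have nx0 : `|x| != 0 by rewrite normr_eq0.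
have : `|val f (`|x|^-1 *: x)| <= 0.
  by rewrite -f0 dual_norm_ub// normrZ normfV normr_id mulVf.
have -> : val f (`|x|^-1 *: x) = `|x|^-1 * val f x.
  exact: (linearZ_LR (dual_lin f)).
by rewrite normr_le0 mulf_eq0 invr_eq0 (negPf nx0) => /eqP.
Qed.

HB.instance Definition _ := @Lmodule_isNormed.Build R dual_type
  dual_norm dual_normD dual_normZ dual_norm_eq0.

Definition dual : normedModType R := dual_type.

End Dual.

Lemma le1_EFin (R : realType) (p : R) : 1 <= p -> (1 <= p%:E)%E.
Proof. by rewrite lee_fin. Qed.

(** [LfunType] is the space of p-integrable functions, seminormed by [Lnorm];
    [Lp] is its quotient by the functions that vanish almost everywhere. *)
Section Lebesgue.
Context d (T : measurableType d) (R : realType).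
Context (mu : {measure set T -> \bar R}) (p : R) (p1 : 1 <= p).
Let F : lmodType R := LfunType mu (le1_EFin p1).

Lemma Lfun_valB (f g : F) x : (f - g) x = f x - g x.
Proof. by []. Qed.

Lemma Lfun_valZ a (f : F) x : (a *: f) x = a * f x.
Proof. by []. Qed.

Definition Lnull : {pred F} := [pred f : F | `[< f = cst 0 %[ae mu] >]].

Lemma Lnull_zmod_closed : zmod_closed Lnull.
Proof.
split; first by apply/asboolP; exact: aeW.
move=> f g /asboolP f0 /asboolP g0; apply/asboolP.
by apply: filterS2 f0 g0 => x fx gx xD; rewrite Lfun_valB fx// gx// subr0.
Qed.

HB.instance Definition _ := GRing.isZmodClosed.Build F Lnull Lnull_zmod_closed.

Definition Lp_type : Type := {ideal_quot Lnull}.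

HB.instance Definition _ := GRing.Zmodule.on Lp_type.
HB.instance Definition _ := EqQuotient.on Lp_type.

Local Open Scope quotient_scope.

Lemma Lp_eqP (f g : F) : reflect (f = g %[ae mu]) (f == g %[mod Lp_type]).
Proof.
rewrite -[_ == _]Quotient.idealrBE; apply: (iffP (asboolP _)).
  apply: filterS => x fg xD; apply/eqP.
  by rewrite -subr_eq0 -Lfun_valB fg.
by apply: filterS => x fg xD; rewrite Lfun_valB fg// subrr.
Qed.

Definition Lp_scale (a : R) (x : Lp_type) : Lp_type :=
  \pi_Lp_type (a *: repr x).

Lemma pi_Lp_scale a (f : F) :
  Lp_scale a (\pi_Lp_type f) = \pi_Lp_type (a *: f).
Proof.
apply/eqP/Lp_eqP; have /eqP/Lp_eqP : repr (\pi_Lp_type f) = f %[mod Lp_type].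
  by rewrite reprK.
by apply: filterS => x fx xD; rewrite !Lfun_valZ fx.
Qed.

Lemma Lp_piD (f g : F) : \pi_Lp_type f + \pi_Lp_type g = \pi_Lp_type (f + g).
Proof. by rewrite piE. Qed.

Lemma Lp_scaleA a b x : Lp_scale a (Lp_scale b x) = Lp_scale (a * b) x.
Proof.
by rewrite -[x]reprK !pi_Lp_scale scalerA !reprK.
Qed.

Lemma Lp_scale1 : left_id 1 Lp_scale.
Proof. by move=> x; rewrite -[x]reprK pi_Lp_scale scale1r. Qed.

Lemma Lp_scaleDr : right_distributive Lp_scale +%R.
Proof.
move=> a x y; rewrite -[x]reprK -[y]reprK.
by rewrite Lp_piD !pi_Lp_scale Lp_piD scalerDr.
Qed.

Lemma Lp_scaleDl x : {morph Lp_scale^~ x : a b / a + b}.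
Proof.
by move=> a b; rewrite -[x]reprK !pi_Lp_scale Lp_piD scalerDl.
Qed.

HB.instance Definition _ := GRing.Zmodule_isLmodule.Build R Lp_type
  Lp_scaleA Lp_scale1 Lp_scaleDr Lp_scaleDl.

Definition Lp_norm (x : Lp_type) : R :=
  fine ('N[mu]_p%:E [EFin \o (repr x : F)]).

Lemma Lfun_powR_measurable (f : F) :
  measurable_fun [set: T] (fun x => `|(EFin \o f) x| `^ p)%E.
Proof.
apply/measurable_EFinP.
apply: (@measurableT_comp _ _ _ _ _ _ (@powR R ^~ p)) => //.
exact: measurableT_comp.
Qed.

Lemma Lp_norm_pi (f : F) :
  Lp_norm (\pi_Lp_type f) = fine ('N[mu]_p%:E [EFin \o f]).
Proof.
rewrite /Lp_norm; set g : F := repr _.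
have /eqP/Lp_eqP gf : g = f %[mod Lp_type] by rewrite reprK.
congr fine; rewrite unlock; congr (_ `^ _)%E.
apply: ge0_ae_eq_integral => //.
- exact: Lfun_powR_measurable.
- exact: Lfun_powR_measurable.
- by move=> x _; exact: poweR_ge0.
- by move=> x _; exact: poweR_ge0.
- by apply: filterS gf => x gf xD; rewrite /= gf.
Qed.

Lemma Lp_normD x y : Lp_norm (x + y) <= Lp_norm x + Lp_norm y.
Proof.
by rewrite -[x]reprK -[y]reprK Lp_piD !Lp_norm_pi; exact: ler_LnormD.
Qed.

Lemma Lp_normZ a x : Lp_norm (a *: x) = `|a| * Lp_norm x.
Proof.
rewrite -[x]reprK [a *: _]pi_Lp_scale !Lp_norm_pi; apply: EFin_inj.
by rewrite EFinM !finite_norm_fine; exact: LnormZ.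
Qed.

Lemma Lp_norm_eq0 x : Lp_norm x = 0 -> x = 0.
Proof.
rewrite -[x]reprK Lp_norm_pi => /fine_Lnormr_eq0 f0.
have -> : 0 = \pi_Lp_type 0 :> Lp_type by rewrite piE.
exact/eqP/Lp_eqP.
Qed.

HB.instance Definition _ := @Lmodule_isNormed.Build R Lp_type
  Lp_norm Lp_normD Lp_normZ Lp_norm_eq0.

Definition Lp : normedModType R := Lp_type.

End Lebesgue.

(** Integrating over [R] against the restriction of Lebesgue measure to the
    interval identifies functions that agree almost everywhere on it. *)
Definition Lp01 (R : realType) (p : R) (p1 : 1 <= p) : normedModType R :=
  Lp (mrestr lebesgue_measure (measurable_itv `]0 : R, 1[)) p1.

Lemma ge1_lt2 (R : realType) (q : R) : 1 < q < 2 -> 1 <= q.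
Proof. by move=> /andP[/ltW]. Qed.

Definition conj_exp (R : realType) (q : R) : R := q / (q - 1).

Lemma conj_expP (R : realType) (q : R) : 1 < q -> q^-1 + (conj_exp q)^-1 = 1.
Proof.
move=> q1; have q0 : q != 0 by rewrite gt_eqF// (lt_trans ltr01).
by rewrite /conj_exp invf_div -[X in X + _]mul1r -mulrDl addrC subrK divff.
Qed.

Lemma conj_exp_gt2 (R : realType) (q : R) : 1 < q < 2 -> 2 < conj_exp q.
Proof.
move=> /andP[q1 q2]; rewrite /conj_exp ltr_pdivlMr ?subr_gt0//.
by rewrite mulrBr mulr1 ltrBlDr mulr_natl mulr2n ltrD2l.
Qed.

Section DualSpaces.
Context (R : realType) (q : R) (q12 : 1 < q < 2).

Definition Xq (w : nat -> R) : normedModType R :=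
  dual (Xp (conj_exp_gt2 q12) w).

Definition Bq : normedModType R := dual (Bp (conj_exp_gt2 q12)).

End DualSpaces.

(* Main.v *)
From HB Require Import structures.
Require Import Defs.
From mathcomp Require Import all_boot all_order all_algebra.
From mathcomp Require Import all_classical all_reals all_analysis.
From mathcomp Require Import measurable_realfun.
From mathcomp Require Import ring lra.

Set Implicit Arguments.
Unset Strict Implicit.
Unset Printing Implicit Defensive.

Import Order.TTheory GRing.Theory Num.Theory.
Import numFieldNormedType.Exports.

Local Open Scope classical_set_scope.
Local Open Scope ring_scope.

(** Let [Z] be the [l^p]-sum of copies of [l^2], [p > 2]. A point of [X_{p,w}]
    together with its weighted [l^2]-part embeds [X_{p,w}] into [Z], and in
    [X_{p,v^(N)}] the normalized indicators of disjoint blocks of length [N]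
    span a complemented copy of [l^2]; this gives (a), (b), (c) and (e).

    For (d) and (g), suppose that a retraction through an [l^p]-sum exists. The
    images of suitable unit vectors, truncated to successive blocks of rows,
    have signed sums growing like [n^(1/p)], while the coordinate functionals
    they are paired with grow like [n^(1/2)]; by averaging over signs the
    pairings then add up to at most [n^(1/2+1/p)], instead of [n].

    For (f), an embedding of [B_p] into [X_p] would send normalized vectors
    [x_N] of distinct summands to vectors with arbitrarily small [l^p]-part,
    whose signed sums therefore grow like [n^(1/2)] and not like [n^(1/p)].

    For (h), let [T] embed [L^p] into [Z] and let [nu_M(i, I)] be the sum of
    [|T h(i)|^2] over the Haar functions [h] of level [M] supported in the
    dyadic interval [I]. It is additive in [I], and sign averages give
    [\sum_i nu_M(i, I)^(p/2) <= C |I|]; the same averages, applied to a long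
    average [nu] of the [nu_M], bound [\sum_i nu(i, I)^(p/2)] below by [c |I|].
    Such averages can be taken close in [l^{p/2}] to a fixed sequence, so that
    [\sum_I \sum_i nu(i, I)^(p/2)] is small for small [|I|]: a contradiction.

    For (i), the [l^q]-sum of copies of [l^2] is the dual of [Z], and [Z] and
    its closed subspaces are reflexive, so that retractions can be dualized in
    both directions. *)

(** The spaces are bare normed spaces, so a lower bound on a map does not give a closed range:
    ranges are exhibited as intersections of kernels or of preimages of closed sets. Complemented
    embeddings are handled as factorizations of the identity ([retract]), which compose, pass to
    [l^p]-sums and dualize.

    No probability space carries the sign averages: signs are fixed one at a time so that a
    potential does not increase. Of the geometry of [l^2] this uses the parallelogram law only.

    The exponent of [v^(N)] is the one for which the normalized indicator of a block of length [N]
    has both parts of the norm equal to 1. Hence [N] unit vectors of [X_{p,v^(N)}] still add up like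
    [l^p], which infinitely many cannot do: this clash drives (d). In (g) the obstruction is that
    any finite number of summands of [B_p] is Hilbertian, while the weights in a block of [X_p] may
    be as small as desired.

    In (h) the exponent [p/2 > 1] matters: sums of [n] almost disjoint bounded vectors of [l^{p/2}]
    grow like [n^(2/p)], so averages of a coordinatewise null sequence can be made small in norm. *)

Section PowerBounds.
Context (R : realType).
Implicit Types a b r : R.

Lemma powR_le r a b : 0 <= r -> 0 <= a -> a <= b -> a `^ r <= b `^ r.
Proof.
move=> r0 a0 ab; apply: ge0_ler_powR => //; rewrite nnegrE//.
exact: le_trans ab.
Qed.

Lemma powR_lt r a b : 0 < r -> 0 <= a -> a < b -> a `^ r < b `^ r.
Proof.
move=> r0 a0 ab; apply: gt0_ltr_powR => //; rewrite nnegrE//.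
exact: le_trans (ltW ab).
Qed.

Lemma powR_le_inv r a b : 0 < r -> 0 <= b -> a `^ r <= b `^ r -> a <= b.
Proof.
move=> r0 b0 h; rewrite leNgt; apply/negP => ba.
by have := powR_lt r0 b0 ba; rewrite ltNge h.
Qed.

Lemma powRK r a : r != 0 -> 0 <= a -> (a `^ r) `^ r^-1 = a.
Proof. by move=> r0 a0; rewrite -powRrM mulfV// powRr1. Qed.

Lemma powRVK r a : r != 0 -> 0 <= a -> (a `^ r^-1) `^ r = a.
Proof. by move=> r0 a0; rewrite -powRrM mulVf// powRr1. Qed.

Lemma powR_pred r a : r != 0 -> 0 <= a -> a `^ (r - 1) * a = a `^ r.
Proof.
move=> r0 a0; have [->|an0] := eqVneq a 0; first by rewrite mulr0 powR0.
by rewrite -{2}(powRr1 a0) -powRD ?an0 ?implybT// subrK.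
Qed.

End PowerBounds.

(** * Coordinates and truncations in [l^p]-sums *)

Section LpEnorm.
Context (R : realType) (E : nat -> normedModType R) (p : R) (p1 : 1 <= p).
Implicit Types x : seqspace E.

Let p0 : 0 < p. Proof. exact: lt_le_trans p1. Qed.

(** Trades the extended-valued series for finite real sums, the form in which norms are mostly
    estimated below. *)
Lemma lp_enorm_le x (M : R) : 0 <= M ->
  (lp_enorm p x <= M%:E)%E <-> forall K, \sum_(i < K) `|x i| `^ p <= M `^ p.
Proof.
move=> M0; rewrite /lp_enorm Lnorm_counting//.
set S := (\sum_(k <oo) _)%E.
have S0 : (0 <= S)%E by apply: nneseries_ge0 => n _ _; exact: poweR_ge0.
have SE K : (\sum_(0 <= k < K) `|(`|x k|)%:E| `^ p)%E =
    (\sum_(i < K) `|x i| `^ p)%:E.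
  rewrite big_mkord -sumEFin; apply: eq_bigr => i _.
  by rewrite abse_EFin normr_id poweR_EFin.
have H : (S <= (M `^ p)%:E)%E <-> forall K, \sum_(i < K) `|x i| `^ p <= M `^ p.
  split => [H K|H].
    rewrite -lee_fin -SE; apply: le_trans H.
    by apply: nneseries_lim_ge => n _ _; exact: poweR_ge0.
  apply: lime_le; first by apply: is_cvg_nneseries => n _ _; exact: poweR_ge0.
  by apply: nearW => K; rewrite SE lee_fin.
rewrite -H; split => h.
  have := ge0_ler_poweR (ltW p0) (poweR_ge0 _ _) h.
  rewrite -poweRrM mulVf ?gt_eqF// poweRe1//.
have pV : 0 <= p^-1 by rewrite invr_ge0 ltW.
have := ge0_ler_poweR pV S0 h.
by rewrite poweR_EFin -powRrM mulfV ?gt_eqF// powRr1.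
Qed.

End LpEnorm.

Section LpSumTheory.
Context (R : realType) (p : R) (p1 : 1 <= p) (E : nat -> normedModType R).
Local Notation Y := (lpsum p1 E).
Let p0 : 0 < p. Proof. exact: lt_le_trans p1. Qed.
Let pn0 : p != 0. Proof. by rewrite gt_eqF. Qed.

Definition coord (i : nat) (x : Y) : E i :=
  (\val (x : finpart (lp_extnorm E p1)) : seqspace E) i.

Lemma coord_linear i : linear (coord i).
Proof. by []. Qed.

HB.instance Definition _ i := GRing.isLinear.Build R Y (E i) *:%R (coord i) (coord_linear i).

Lemma coordP (x y : Y) : (forall i, coord i x = coord i y) -> x = y.
Proof. by move=> xy; apply/val_inj/seqspace_ext. Qed.

Lemma lpsum_normE (x : Y) : (`|x|)%:E = lp_enorm p (fun i => coord i x).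
Proof. exact: finpart_normE. Qed.

Lemma lpsum_normP (x : Y) M : 0 <= M ->
  `|x| <= M <-> forall K, \sum_(i < K) `|coord i x| `^ p <= M `^ p.
Proof. by move=> M0; rewrite -lee_fin lpsum_normE lp_enorm_le. Qed.

Lemma lpsum_psum_le (x : Y) K : \sum_(i < K) `|coord i x| `^ p <= `|x| `^ p.
Proof. exact: (lpsum_normP x (normr_ge0 x)).1. Qed.

Lemma lpsum_exists (y : forall i, E i) M : 0 <= M ->
  (forall K, \sum_(i < K) `|y i| `^ p <= M `^ p) ->
  exists x : Y, (forall i, coord i x = y i) /\ `|x| <= M.
Proof.
move=> M0 yM; have yfin : finpart_pred (lp_extnorm E p1) (y : seqspace E).
  by apply: (le_lt_trans ((@lp_enorm_le R E p p1 y M M0).2 yM)); rewrite ltry.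
exists (exist _ (y : seqspace E) yfin : finpart (lp_extnorm E p1)); split => //.
exact/lpsum_normP.
Qed.

Lemma coord_le (x : Y) i : `|coord i x| <= `|x|.
Proof.
have := lpsum_psum_le x i.+1; rewrite big_ord_recr/= => h.
have {}h : `|coord i x| `^ p <= `|x| `^ p.
  by apply: le_trans h; rewrite lerDr sumr_ge0// => j _; exact: powR_ge0.
exact: powR_le_inv h.
Qed.

Lemma lpsum_psum_approx (x : Y) e : 0 < e ->
  exists K, `|x| `^ p < \sum_(i < K) `|coord i x| `^ p + e.
Proof.
move=> e0; apply/not_existsP => H.
have xe : 0 <= `|x| `^ p - e.
  by have /negP := H 0; rewrite -leNgt big_ord0 add0r subr_ge0.
have : `|x| <= (`|x| `^ p - e) `^ p^-1.
  apply/lpsum_normP; first exact: powR_ge0.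
  move=> K; rewrite powRVK ?gt_eqF// lerBrDr leNgt.
  exact/negP/H.
move/(powR_le (ltW p0) (normr_ge0 _)).
by rewrite powRVK ?gt_eqF// lerBrDr gerDl leNgt e0.
Qed.

Lemma psum_monotone (f : nat -> R) (K L : nat) : (forall i, 0 <= f i) ->
  (K <= L)%N -> \sum_(i < K) f i <= \sum_(i < L) f i.
Proof.
move=> f0 KL; rewrite -(big_mkord xpredT f) -(big_mkord xpredT f).
by rewrite (big_cat_nat (leq0n _) KL)//= lerDl sumr_ge0.
Qed.

Lemma lpsum_normD (x y : Y) : (forall i, coord i x = 0 \/ coord i y = 0) ->
  `|x + y| `^ p = `|x| `^ p + `|y| `^ p.
Proof.
move=> xy.
have E1 K : \sum_(i < K) `|coord i (x + y)| `^ p =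
    \sum_(i < K) `|coord i x| `^ p + \sum_(i < K) `|coord i y| `^ p.
  rewrite -big_split/=; apply: eq_bigr => i _; rewrite linearD/=.
  by case: (xy i) => ->; rewrite ?addr0 ?add0r normr0 powR0 ?gt_eqF// ?addr0 ?add0r.
apply/eqP; rewrite eq_le; apply/andP; split.
  apply/ler_addgt0Pr => e e0; have [K /ltW/le_trans->//] := lpsum_psum_approx (x + y) e0.
  by rewrite lerD2r E1 lerD// lpsum_psum_le.
apply/ler_addgt0Pr => e e0; have e20 : 0 < e / 2 by rewrite divr_gt0.
have [K hK] := lpsum_psum_approx x e20; have [L hL] := lpsum_psum_approx y e20.
have := lpsum_psum_le (x + y) (maxn K L); rewrite E1.
have := @psum_monotone (fun i => `|coord i x| `^ p) _ _ (fun=> powR_ge0 _ _) (leq_maxl K L).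
have := @psum_monotone (fun i => `|coord i y| `^ p) _ _ (fun=> powR_ge0 _ _) (leq_maxr K L).
lra.
Qed.

Lemma lpsum_le_coord (x y : Y) : (forall i, `|coord i x| <= `|coord i y|) ->
  `|x| <= `|y|.
Proof.
move=> xy; apply/lpsum_normP => // K; apply: le_trans (lpsum_psum_le y K).
by apply: ler_sum => i _; exact: powR_le (ltW p0) _ _.
Qed.

Lemma trunc_exists (P : pred nat) (x : Y) : exists y : Y,
  forall i, coord i y = if P i then coord i x else 0.
Proof.
have [|y [yE _]] := @lpsum_exists (fun i => if P i then coord i x else 0) `|x| (normr_ge0 _).
  move=> K; apply: le_trans (lpsum_psum_le x K); apply: ler_sum => i _.
  by case: (P i) => //; rewrite normr0 powR0 ?gt_eqF// powR_ge0.
by exists y.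
Qed.

Definition below (K : nat) : pred nat := fun i => (i < K)%N.

(** An arbitrary set of rows is allowed so that heads ([below K]) and tails ([predC (below K)])
    share their lemmas. *)
Definition trunc (P : pred nat) (x : Y) : Y := sval (cid (trunc_exists P x)).

Lemma coord_trunc P x i : coord i (trunc P x) = if P i then coord i x else 0.
Proof. by rewrite /trunc; case: cid. Qed.

Lemma trunc_linear P : linear (trunc P).
Proof.
move=> a x y; apply: coordP => i; rewrite linearP/= !coord_trunc linearP.
by case: (P i) => //; rewrite scaler0 addr0.
Qed.

HB.instance Definition _ P := GRing.isLinear.Build R Y Y *:%R (trunc P) (trunc_linear P).

Lemma trunc_le P x : `|trunc P x| <= `|x|.
Proof.
by apply: lpsum_le_coord => i; rewrite coord_trunc; case: ifP => // _; rewrite normr0.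
Qed.

Lemma truncC P x : trunc P x + trunc (predC P) x = x.
Proof.
apply: coordP => i; rewrite linearD/= !coord_trunc/=.
by case: (P i); rewrite ?addr0 ?add0r.
Qed.

Lemma truncC_norm P x : `|x| `^ p = `|trunc P x| `^ p + `|trunc (predC P) x| `^ p.
Proof.
rewrite -{1}(truncC P x) lpsum_normD// => i; rewrite !coord_trunc/=.
by case: (P i); [right|left].
Qed.

Lemma trunc_lt_norm K x : `|trunc (below K) x| `^ p = \sum_(i < K) `|coord i x| `^ p.
Proof.
have E1 L : (K <= L)%N -> \sum_(i < L) `|coord i (trunc (below K) x)| `^ p =
    \sum_(i < K) `|coord i x| `^ p.
  move=> KL; rewrite -(big_mkord xpredT (fun i => `|coord i (trunc _ x)| `^ p)).
  rewrite (big_cat_nat (leq0n _) KL)//= [X in _ + X]big_nat_cond [X in _ + X]big1 ?addr0; last first.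
    move=> i /andP[/andP[Ki _] _]; rewrite coord_trunc /below ltnNge Ki/=.
    by rewrite normr0 powR0 ?gt_eqF.
  rewrite big_mkord; apply: eq_bigr => i _; by rewrite coord_trunc /below ltn_ord.
apply/eqP; rewrite eq_le -{2}(E1 K)// lpsum_psum_le andbT.
apply/ler_addgt0Pr => e e0.
have [L hL] := lpsum_psum_approx (trunc (below K) x) e0.
rewrite -(E1 _ (leq_maxl K L)); apply: (le_trans (ltW hL)); rewrite lerD2r.
apply: (@psum_monotone (fun i => `|coord i (trunc _ x)| `^ p)) (leq_maxr _ _).
by move=> i; exact: powR_ge0.
Qed.

Lemma trunc_tail x e : 0 < e ->
  exists K, forall L, (K <= L)%N -> `|trunc (predC (below L)) x| <= e.
Proof.
move=> e0; have [K hK] := lpsum_psum_approx x (powR_gt0 p e0).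
exists K => L KL; apply: (powR_le_inv p0 (ltW e0)).
have := truncC_norm (below L) x; rewrite trunc_lt_norm.
have := @psum_monotone (fun i => `|coord i x| `^ p) _ _ (fun=> powR_ge0 _ _) KL.
rewrite /predC; lra.
Qed.

Lemma inj_exists i (v : E i) : exists y : Y,
  (forall j, coord j y = @dfwith _ (fun k => E k : Type) (fun k => 0 : E k) i v j) /\ `|y| <= `|v|.
Proof.
apply: lpsum_exists => // K; have [iK|Ki] := ltnP i K.
  rewrite (bigD1 (Ordinal iK))//= dfwithin big1 ?addr0//.
  by move=> j ji; rewrite dfwithout ?normr0 ?powR0// eq_sym.
rewrite big1 ?powR_ge0// => j _; rewrite dfwithout ?normr0 ?powR0//.
by rewrite eq_sym neq_ltn (leq_trans (ltn_ord j)).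
Qed.

Definition lpinj i (v : E i) : Y := sval (cid (inj_exists v)).

Lemma coord_inj i (v : E i) : coord i (lpinj v) = v.
Proof. by rewrite /lpinj; case: cid => y [/= -> _]; rewrite dfwithin. Qed.

Lemma coord_inj0 i j (v : E i) : i != j -> coord j (lpinj v) = 0.
Proof. by move=> ij; rewrite /lpinj; case: cid => y [/= -> _]; rewrite dfwithout. Qed.

Lemma lpinj_linear i : linear (@lpinj i).
Proof.
move=> a u v; apply: coordP => j; rewrite linearP/=.
have [<-|ij] := eqVneq i j; first by rewrite !coord_inj.
by rewrite !coord_inj0// scaler0 addr0.
Qed.

HB.instance Definition _ i := GRing.isLinear.Build R (E i) Y *:%R (@lpinj i) (@lpinj_linear i).

Lemma lpinj_norm i (v : E i) : `|lpinj v| = `|v|.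
Proof.
apply/eqP; rewrite eq_le; apply/andP; split; last first.
  by rewrite -{1}(coord_inj v) coord_le.
by rewrite /lpinj; case: cid => y [].
Qed.

Lemma trunc_inj K x : trunc (below K) x = \sum_(i < K) lpinj (coord i x).
Proof.
apply: coordP => j; rewrite coord_trunc /below linear_sum/=; case: ifPn => jK.
  rewrite (bigD1 (Ordinal jK))//= coord_inj big1 ?addr0// => i ij.
  by rewrite coord_inj0.
rewrite big1// => i _; rewrite coord_inj0//; apply: contraNneq jK => <-.
exact: ltn_ord.
Qed.

End LpSumTheory.

(** * Embeddings and retractions *)

Section BoundedLinear.
Context (R : realType).
Implicit Types X Y W : normedModType R.

Definition mklin (U V : lmodType R) (f : U -> V) (lf : linear f) :
  {linear U -> V} := HB.pack f (GRing.isLinear.Build R U V *:%R f lf).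

Definition bounded_by X Y (C : R) (f : X -> Y) := forall x, `|f x| <= C * `|x|.

Lemma bounded_by_continuous X Y (T : {linear X -> Y}) C :
  bounded_by C T -> continuous T.
Proof.
move=> TC; apply: bounded_linear_continuous; apply/linear_boundedP.
by near=> r => x; apply: (le_trans (TC x)); rewrite ler_wpM2r//; near: r;
  exact: nbhs_pinfty_ge.
Unshelve. all: by end_near. Qed.

Lemma continuous_bounded_by X Y (T : {linear X -> Y}) :
  continuous T -> exists2 C, 0 < C & bounded_by C T.
Proof.
move=> /linear_bounded_continuous/linear_boundedP/pinfty_ex_gt0[C C0 TC].
by exists C.
Qed.

(** Complemented embedding with neither range nor projection mentioned; [retract_cembeds] and
    [cembeds_retract] give the equivalence. *)
Definition retract X Y := exists (T : {linear X -> Y}) (Q : {linear Y -> X}) (C : R),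
  [/\ 0 < C, bounded_by C T, bounded_by C Q & cancel T Q].

Lemma retract_of X Y (T : {linear X -> Y}) (Q : {linear Y -> X}) C D :
  bounded_by C T -> bounded_by D Q -> cancel T Q -> retract X Y.
Proof.
move=> TC QD TQ; exists T, Q, (`|C| + `|D| + 1); split => //.
- move=> x; apply: (le_trans (TC x)); rewrite ler_wpM2r//.
  by rewrite (le_trans (ler_norm C))// -addrA lerDl addr_ge0.
- move=> x; apply: (le_trans (QD x)); rewrite ler_wpM2r//.
  by rewrite (le_trans (ler_norm D))// addrAC lerDr addr_ge0.
Qed.

Lemma retract_trans X Y W : retract X Y -> retract Y W -> retract X W.
Proof.
move=> [T [Q [C [C0 TC QC TQ]]]] [T' [Q' [C' [C'0 TC' QC' TQ']]]].
apply: (@retract_of _ _ (T' \o T) (Q \o Q') (C' * C) (C * C')).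
- by move=> x; rewrite -mulrA (le_trans (TC' _))// ler_wpM2l// ltW.
- by move=> x; rewrite -mulrA (le_trans (QC _))// ler_wpM2l// ltW.
- by move=> x /=; rewrite TQ' TQ.
Qed.

Lemma retract_cembeds X Y : retract X Y -> cembeds X Y.
Proof.
move=> [T [Q [C [C0 TC QC TQ]]]]; exists (T \o Q), T; split; first split.
- move=> y; apply: continuous_comp; first exact: (bounded_by_continuous QC).
  exact: (bounded_by_continuous TC).
- by move=> y /=; rewrite TQ.
split; last exists Q => //.
- apply/seteqP; split => [_ [x _ <-]|_ [y _ <-]]; last by exists (Q y).
  by exists (T x) => //=; rewrite TQ.
- exact: (bounded_by_continuous TC).
- by apply: continuous_subspaceT; exact: (bounded_by_continuous QC).
Qed.

(** Continuity of [S] at 0 gives [e] such that image points of norm below [e] come from vectors of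
    norm below 1. A vector rescaled to norm 2 therefore has an image of norm at least [e]. *)
Lemma within_continuous_below X Y (T : {linear X -> Y}) (S : Y -> X) :
  cancel T S -> {within range T, continuous S} ->
  exists2 c, 0 < c & forall x, c * `|x| <= `|T x|.
Proof.
move=> TS /subspace_continuousP cS; have S0 : S 0 = 0 by have := TS 0; rewrite linear0.
have /cvgrPdist_lt/(_ 1 ltr01) := cS 0 (ex_intro2 _ _ 0 I (linear0 T)).
rewrite near_withinE /from_subspace S0 => /nbhs_normP[e /= e0 He]; exists (e / 2) => [|x]; first by rewrite divr_gt0.
have [->|x0] := eqVneq x 0; first by rewrite linear0 !normr0 mulr0.
rewrite leNgt; apply/negP => xe.
have nx : 0 < `|x| by rewrite normr_gt0.
have nZ (W : normedModType R) (z : W) : `|2 / `|x| *: z| = 2 / `|x| * `|z|.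
  by rewrite normrZ ger0_norm// divr_ge0.
have Txe : `|T (2 / `|x| *: x)| < e.
  by rewrite linearZ/= nZ mulrAC ltr_pdivrMr// mulrC -ltr_pdivlMr// mulrAC.
have := He (T (2 / `|x| *: x)); rewrite /= sub0r normrN TS sub0r normrN.
move=> /(_ Txe (ex_intro2 _ _ _ I erefl)); rewrite nZ divfK ?gt_eqF//.
by rewrite ltNge ler1n.
Qed.

Lemma embeds_below X Y : embeds X Y -> exists (T : {linear X -> Y}) (c C : R),
  [/\ 0 < c, 0 < C, bounded_by C T & forall x, c * `|x| <= `|T x|].
Proof.
move=> [A [T [_ [TA /continuous_bounded_by[C C0 TC] [S TS cS]]]]].
have [|c c0 Tc] := within_continuous_below TS; first by rewrite TA.
by exists T, c, C.
Qed.

(** [X] is a mere normed space, so closedness of the range cannot be deduced from the lower bound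
    and has to be supplied. *)
Lemma below_embeds X Y (T : {linear X -> Y}) (c C : R) : 0 < c ->
  bounded_by C T -> (forall x, c * `|x| <= `|T x|) -> closed (range T) ->
  embeds X Y.
Proof.
move=> c0 TC Tc clT; exists (range T), T; split => //; split => //.
  exact: bounded_by_continuous TC.
have inj x y : T x = T y -> x = y.
  move=> xy; apply/eqP; rewrite -subr_eq0 -normr_le0 -(ler_pM2l c0) mulr0.
  by rewrite (le_trans (Tc _))// linearB/= xy subrr normr0.
have /choice[S HS] : forall y, exists x, range T y -> T x = y.
  move=> y; have [[x _ xy]|h] := pselect (range T y); first by exists x.
  by exists 0.
have TS : cancel T S by move=> x; apply: inj; apply: HS; exists x.
exists S => //; apply/subspace_continuousP => _ [x _ <-].
apply/cvgrPdist_lt => e e0; rewrite near_withinE.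
near=> y => -[z _ zy]; rewrite -zy /from_subspace !TS -(ltr_pM2l c0) (le_lt_trans (Tc _))//.
rewrite linearB/= zy; near: y; apply: cvgr_dist_lt; last by rewrite mulr_gt0.
exact: cvg_id.
Unshelve. all: by end_near. Qed.

(** The left inverse is [S \o P]. [S] is only a function, but the composite is linear because [T]
    is, and [S] inverts it on the range of [P]. *)
Lemma cembeds_retract X Y : cembeds X Y -> retract X Y.
Proof.
move=> [P [T [[cP PP] [TP cT [S TS cS]]]]].
have [C C0 TC] := continuous_bounded_by cT.
have [D D0 PD] := continuous_bounded_by cP.
have [|c c0 Tc] := within_continuous_below TS; first by rewrite TP.
have TSP y : T (S (P y)) = P y.
  have [x _ xy] : range T (P y) by rewrite TP; exists y.
  by rewrite -xy TS.
have lin : linear (S \o P).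
  move=> a x y /=; have -> : P (a *: x + y) = T (a *: S (P x) + S (P y)).
    by rewrite [RHS]linearP [LHS]linearP /= !TSP.
  by rewrite TS.
apply: (@retract_of _ _ T (mklin lin) C (c^-1 * D)) => //.
- by move=> y /=; rewrite -mulrA ler_pdivlMl// (le_trans (Tc _))// TSP.
- move=> x /=; have : range P (T x) by rewrite -TP; exists x.
  by move=> [y _ yx]; rewrite -yx PP yx TS.
Qed.

Lemma closed_preimage X Y (T : {linear X -> Y}) C (A : set Y) :
  bounded_by C T -> closed A -> closed [set x | A (T x)].
Proof.
move=> TC; apply: preimage_closed => x _.
exact: (bounded_by_continuous TC).
Qed.

Lemma closed_kernel X Y (T : {linear X -> Y}) C :
  bounded_by C T -> closed [set x | T x = 0].
Proof.
move=> TC; apply: (closed_preimage (A := [set (0 : Y)]) TC).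
exact/accessible_closed_set1/hausdorff_accessible/norm_hausdorff.
Qed.

Lemma embeds_retract X Y W : embeds X Y -> retract Y W -> embeds X W.
Proof.
move=> [A [T [cA [TA /continuous_bounded_by[C C0 TC] [S TS cS]]]]].
have [|c c0 Tc] := within_continuous_below TS; first by rewrite TA.
move=> [T' [Q [D [D0 TD QD TQ]]]].
have Tlow y : D^-1 * `|y| <= `|T' y|.
  by rewrite ler_pdivrMl// -{1}(TQ y).
apply: (@below_embeds _ _ (T' \o T) (D^-1 * c) (D * C)).
- by rewrite mulr_gt0 ?invr_gt0.
- by move=> x; rewrite /= -mulrA (le_trans (TD _))// ler_pM2l.
- by move=> x; rewrite /= -mulrA (le_trans _ (Tlow _))// ler_pM2l ?invr_gt0.
(* A point is in the range exactly when [T' \o Q] fixes it and [Q] sends it into [A]; both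
   conditions are closed. *)
have -> : range (T' \o T) = [set w | (T' \o Q \- idfun) w = 0] `&` [set w | A (Q w)].
  apply/seteqP; split => [_ [x _ <-]|w [/= /eqP + Aw]].
    by split => /=; rewrite TQ ?subrr// -TA; exists x.
  rewrite subr_eq0 => /eqP w1; move: Aw; rewrite -TA => -[x _ xw].
  by exists x => //=; rewrite xw.
apply: closedI; last exact: closed_preimage QD cA.
apply: (@closed_kernel _ _ _ (D * D + 1)) => w /=.
rewrite (le_trans (ler_normB _ _))// mulrDl mul1r lerD2r -mulrA.
by rewrite (le_trans (TD _))// ler_pM2l.
Qed.

Lemma retract_embeds X Y : retract X Y -> embeds X Y.
Proof.
apply: embeds_retract; apply: (@below_embeds _ _ idfun 1 1) => //.
- by move=> x; rewrite mul1r.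
- by move=> x; rewrite mul1r.
Qed.

End BoundedLinear.

(** * Averages over signs *)

Section PowerInequalities.
Context (R : realType).
Implicit Types s t u x X A B : R.

(** Young's inequality for the product of [t] and 1, with the exponent [s] and its conjugate. *)
Lemma bernoulli s t : 1 <= s -> 0 <= t -> 1 + s * (t - 1) <= t `^ s.
Proof.
move=> s1 t0; have s0 : 0 < s by exact: lt_le_trans s1.
have [->|sn1] := eqVneq s 1; first by rewrite powRr1// mul1r addrC subrK.
have {sn1}s1 : 1 < s by rewrite lt_neqAle eq_sym sn1.
have q0 : 0 < 1 - s^-1 by rewrite subr_gt0 invf_lt1.
have := @conjugate_powR R t 1 s (1 - s^-1)^-1 t0 ler01 s0.
rewrite invr_gt0 invrK => /(_ q0); rewrite subrKC => /(_ erefl).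
rewrite mulr1 powR1 mul1r => h.
have := ler_wpM2l (ltW s0) h; rewrite mulrDr mulrCA mulfV ?gt_eqF// mulr1.
rewrite mulrBr mulfV ?gt_eqF// => h2; lra.
Qed.

Lemma bernoulli_concave s t : 0 < s <= 1 -> 0 <= t ->
  t `^ s <= 1 + s * (t - 1).
Proof.
move=> /andP[s0 s1] t0.
have := @bernoulli s^-1 (t `^ s); rewrite invf_ge1// powR_ge0 s1 => /(_ erefl erefl).
rewrite powRK ?gt_eqF// => h.
have := ler_wpM2l (ltW s0) h; rewrite mulrDr mulr1 mulrA mulfV ?gt_eqF//; lra.
Qed.

Lemma powR_tangent s X t : 1 <= s -> 0 < X -> 0 <= t ->
  X `^ s + s * X `^ (s - 1) * (t - X) <= t `^ s.
Proof.
move=> s1 X0 t0; have s0 : 0 < s by exact: lt_le_trans s1.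
have := bernoulli s1 (divr_ge0 t0 (ltW X0)).
rewrite -(ler_pM2l (powR_gt0 s X0)) -powRM ?divr_ge0 ?(ltW X0)//.
rewrite [X * _]mulrC divfK ?gt_eqF//; apply: le_trans.
rewrite [leRHS]mulrDr mulr1 lerD2l -(@mulr_powRB1 _ X s (ltW X0) s0).
suff -> : X * X `^ (s - 1) * (s * (t / X - 1)) = s * X `^ (s - 1) * (t - X) by [].
by field; rewrite gt_eqF.
Qed.

(** Sum of the tangent inequalities at the mean, where the linear terms cancel. *)
Lemma power_mean (I : Type) (l : seq I) (f : I -> R) s : 1 <= s ->
  (forall i, 0 <= f i) ->
  (size l)%:R * ((\sum_(i <- l) f i) / (size l)%:R) `^ s <= \sum_(i <- l) f i `^ s.
Proof.
move=> s1 f0; have s0 : 0 < s by exact: lt_le_trans s1.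
case: l => [|a l']; first by rewrite /= mul0r big_nil.
set l := a :: l'; set n := (size l)%:R; set S := \sum_(i <- l) f i.
have n0 : 0 < n :> R by rewrite ltr0n.
have S0 : 0 <= S by rewrite sumr_ge0.
have [S_eq0|Sn0] := eqVneq S 0.
  by rewrite S_eq0 mul0r powR0 ?gt_eqF// mulr0 sumr_ge0// => i _; exact: powR_ge0.
have X0 : 0 < S / n by rewrite divr_gt0// lt_neqAle eq_sym Sn0.
apply: (@le_trans _ _ (\sum_(i <- l) ((S / n) `^ s + s * (S / n) `^ (s - 1) * (f i - S / n)))).
  have C x : \sum_(i <- l) x = n * x.
    by rewrite big_const_seq count_predT iter_addr_0 -mulr_natl.
  rewrite big_split/= -mulr_sumr sumrB !C -/S.
  by rewrite [n * (S / n)]mulrC divfK ?gt_eqF// subrr mulr0 addr0.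
by apply: ler_sum => i _; exact: powR_tangent.
Qed.

Lemma power_mean2 s A B : 1 <= s -> 0 <= A -> 0 <= B ->
  2 * ((A + B) / 2) `^ s <= A `^ s + B `^ s.
Proof.
move=> s1 A0 B0.
have := @power_mean _ [:: A; B] (fun x => `|x|) s s1 (@normr_ge0 _ _).
by rewrite !big_cons !big_nil !addr0 !ger0_norm.
Qed.

(** Multiplication by [1 + u] and [1 - u] mixes even and odd parts, so the induction carries a crude
    bound on the even part and a bound on the odd part along. *)
Lemma even_pow_bound m u : 0 <= u <= 1 ->
  (1 + u) ^+ m + (1 - u) ^+ m <= 2 + 2 * 3 ^+ m * u ^+ 2.
Proof.
move=> /andP[u0 u1].
suff [_ _] : [/\ (1 + u) ^+ m + (1 - u) ^+ m <= 2 * 3 ^+ m,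
    (1 + u) ^+ m - (1 - u) ^+ m <= 2 * 3 ^+ m * u &
    (1 + u) ^+ m + (1 - u) ^+ m <= 2 + 2 * 3 ^+ m * u ^+ 2] by [].
elim: m => [|m [h1 h2 h3]].
  by rewrite !expr0; split; nra.
rewrite [(1 + u) ^+ m.+1]exprS [(1 - u) ^+ m.+1]exprS [3 ^+ m.+1]exprS.
have t0 : (0 : R) <= 3 ^+ m by rewrite exprn_ge0.
have t1 : (1 : R) <= 3 ^+ m by rewrite exprn_ege1// ler1n.
set a := (1 + u) ^+ m in h1 h2 h3 *; set b := (1 - u) ^+ m in h1 h2 h3 *.
set T := 3 ^+ m in h1 h2 h3 t0 t1 *.
have e1 : (1 + u) * a + (1 - u) * b = (a + b) + u * (a - b) by ring.
have e2 : (1 + u) * a - (1 - u) * b = (a - b) + u * (a + b) by ring.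
have h2' : u * (a - b) <= u * (2 * T * u) by rewrite ler_wpM2l.
have h1' : u * (a + b) <= u * (2 * T) by rewrite ler_wpM2l.
have uu : u * u <= 1 by nra.
have Tuu : T * (u * u) <= T by rewrite ler_piMr.
by rewrite e1 e2 expr2; rewrite expr2 in h3; split; nra.
Qed.

(** Reduction to an integer exponent [m >= s]: the s-th power is the power [s / m <= 1] of the m-th,
    and concavity bounds it by an affine function. *)
Lemma even_powR_bound s : 1 <= s -> exists2 k, 0 <= k &
  forall u, 0 <= u <= 1 -> (1 + u) `^ s + (1 - u) `^ s <= 2 + 2 * k * u ^+ 2.
Proof.
move=> s1; have s0 : 0 < s by exact: lt_le_trans s1.
pose m := (Num.trunc s).+1.
have sm : s <= m%:R by rewrite ltW// truncnS_gt.
have m0 : 0 < m%:R :> R by rewrite ltr0n.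
exists (3 ^+ m); first exact: exprn_ge0.
move=> u u01; have /andP[u0 u1] := u01.
have th : 0 < s / m%:R <= 1 by rewrite divr_gt0//= ler_pdivrMr// mul1r.
have E x : 0 <= x -> x `^ s <= 1 + s / m%:R * (x ^+ m - 1).
  move=> x0; apply: le_trans (bernoulli_concave th (exprn_ge0 m x0)).
  by rewrite -powR_mulrn// -powRrM mulrCA mulfV ?gt_eqF// mulr1.
have h1 := E _ (addr_ge0 ler01 u0).
have u1' : 0 <= 1 - u by rewrite subr_ge0.
have h2 := E _ u1'.
have h3 := even_pow_bound m u01.
have /andP[th0 th1] := th.
have h4 : s / m%:R * ((1 + u) ^+ m + (1 - u) ^+ m - 2) <= s / m%:R * (2 * 3 ^+ m * u ^+ 2).
  by rewrite ler_pM2l// lerBlDl.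
have h5 : s / m%:R * (2 * 3 ^+ m * u ^+ 2) <= 2 * 3 ^+ m * u ^+ 2.
  by rewrite ler_piMl// mulr_ge0 ?exprn_ge0// mulr_ge0// exprn_ge0.
move: h1 h2 (le_trans h4 h5).
move: (s / m%:R) ((1 + u) ^+ m) ((1 - u) ^+ m) (2 * 3 ^+ m * u ^+ 2) => c a b d.
lra.
Qed.

(* [A] and [B] stand for [|a + b|^2] and [|a - b|^2] in a Hilbert space, with
   [x = |a|^2] and [t = |b|^2]; the point is that the increment in [x] can be
   absorbed in a multiple of [t], whatever the other terms [r] are. *)
Lemma two_point s : 1 <= s -> exists2 k, 0 <= k &
  forall A B x t r, 0 <= A -> 0 <= B -> 0 <= x -> 0 <= t -> 0 <= r ->
    A + B = 2 * (x + t) -> (A - B) ^+ 2 <= 16 * (x * t) ->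
    (A + r) `^ s + (B + r) `^ s <= 2 * (x + k * t + r) `^ s.
Proof.
move=> s1; have s0 : 0 < s by exact: lt_le_trans s1.
have [k k0 Hk] := even_powR_bound s1.
exists (1 + 4 * k); first by rewrite addr_ge0// mulr_ge0.
suff wl A B x t r : B <= A -> 0 <= A -> 0 <= B -> 0 <= x -> 0 <= t -> 0 <= r ->
    A + B = 2 * (x + t) -> (A - B) ^+ 2 <= 16 * (x * t) ->
    (A + r) `^ s + (B + r) `^ s <= 2 * (x + (1 + 4 * k) * t + r) `^ s.
  move=> A B x t r A0 B0 x0 t0 r0 AB AB2; have [BA|/ltW AB'] := leP B A.
    exact: wl.
  by rewrite addrC; apply: wl => //; [rewrite addrC|rewrite -sqrrN opprB].
move=> BA A0 B0 x0 t0 r0 AB AB2.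
(* [X] is the mean of [A + r] and [B + r], and [d] is half their difference. *)
pose X := x + t + r; pose d := (A - B) / 2.
have [X_eq0|Xn0] := eqVneq X 0.
  have [-> -> ->] : [/\ A = 0, B = 0 & r = 0] by rewrite /X in X_eq0; split; lra.
  by rewrite addr0 powR0 ?gt_eqF// addr0 mulr_ge0 ?powR_ge0.
have X0 : 0 < X by rewrite lt_neqAle eq_sym Xn0 /X !addr_ge0.
have d0 : 0 <= d by rewrite divr_ge0 ?subr_ge0.
have dX : 0 <= d / X <= 1.
  rewrite divr_ge0 ?(ltW X0)//= ler_pdivrMr// mul1r /d /X; lra.
have EA : A + r = X * (1 + d / X).
  by rewrite mulrDr mulr1 [X * _]mulrC divfK// /X /d; lra.
have EB : B + r = X * (1 - d / X).
  by rewrite mulrBr mulr1 [X * (_ / _)]mulrC divfK// /X /d; lra.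
have /andP[u0 u1] := dX.
have p1 : 0 <= 1 + d / X by rewrite addr_ge0.
have p2 : 0 <= 1 - d / X by rewrite subr_ge0.
rewrite EA EB (powRM _ (ltW X0) p1) (powRM _ (ltW X0) p2) -mulrDr.
have h := ler_wpM2l (powR_ge0 X s) (Hk _ dX).
apply: (le_trans h); rewrite (_ : 2 + _ = 2 * (1 + k * (d / X) ^+ 2)); last ring.
rewrite mulrCA ler_pM2l//.
have k2 : 0 <= k * (d / X) ^+ 2 by rewrite mulr_ge0// sqr_ge0.
apply: (@le_trans _ _ (X `^ s * (1 + k * (d / X) ^+ 2) `^ s)).
  by rewrite ler_wpM2l ?powR_ge0// le1r_powR// lerDl.
rewrite -powRM ?(ltW X0) ?addr_ge0//; apply: powR_le; rewrite ?(ltW s0)//.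
  by rewrite mulr_ge0 ?(ltW X0) ?addr_ge0.
have -> : X * (1 + k * (d / X) ^+ 2) = X + k * (d ^+ 2 / X) by field.
(* [d^2 <= 4 x t] and [x <= X], so the excess is a multiple of [t] alone. *)
have : d ^+ 2 / X <= 4 * t.
  rewrite ler_pdivrMr// /d expr_div_n ler_pdivrMr ?exprn_gt0//.
  apply: (le_trans AB2); rewrite /X; nra.
move=> /(ler_wpM2l k0); rewrite /X; lra.
Qed.

End PowerInequalities.

Section Signs.
Context (R : realType) (I : eqType).

(** Method of conditional expectations: [F l v] bounds the mean of [F [::]] over the signs still to
    be chosen on [l], and by hypothesis one of the two choices of the next sign does not increase
    it. *)
Lemma signs_exist (V : lmodType R) (z : I -> V) (F : seq I -> V -> R) :
  (forall a l v, F l (v + z a) + F l (v - z a) <= 2 * F (a :: l) v) ->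
  forall l, uniq l -> forall v, exists e : I -> bool,
    F [::] (v + \sum_(k <- l) (-1) ^+ e k *: z k) <= F l v.
Proof.
move=> HF; elim=> [_ v|a l IH /= /andP[al ul] v].
  by exists xpredT; rewrite big_nil addr0.
have [b Hb] : exists b : bool, F l (v + (-1) ^+ b *: z a) <= F (a :: l) v.
  have [h|h] := leP (F l (v + z a)) (F (a :: l) v).
    by exists false; rewrite scale1r.
  exists true; rewrite expr1 scaleN1r; have := HF a l v; lra.
have [e He] := IH ul (v + (-1) ^+ b *: z a).
exists (fun k => if k == a then b else e k).
rewrite big_cons eqxx addrA (le_trans _ Hb)// (le_trans _ He)//.
rewrite le_eqVlt; apply/orP; left; apply/eqP; congr (F _ (_ + _)).
by apply: eq_big_seq => k kl; rewrite ifN//; apply: contraNneq al => <-.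
Qed.

(** The diagonal does not feel the signs. Each new sign is chosen so that the cross terms with those
    already fixed have a nonnegative sum. *)
Lemma signs_trace (b : I -> I -> R) l : uniq l -> exists e : I -> bool,
  \sum_(k <- l) b k k <= \sum_(k <- l) \sum_(j <- l) (-1) ^+ e k * (-1) ^+ e j * b k j.
Proof.
elim: l => [_|a l IH /= /andP[al ul]]; first by exists xpredT; rewrite !big_nil.
have [e He] := IH ul.
pose c := \sum_(j <- l) (-1) ^+ e j * (b a j + b j a).
pose s := c < 0; exists (fun k => if k == a then s else e k).
have E k : k \in l -> (if k == a then s else e k) = e k.
  by move=> kl; rewrite ifN//; apply: contraNneq al => <-.
rewrite !big_cons eqxx -signr_addb addbb mul1r -addrA lerD2l.
rewrite [X in _ <= _ + X](_ : _ = \sum_(k <- l) ((-1) ^+ s * ((-1) ^+ e k * b k a)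
   + \sum_(j <- l) (-1) ^+ e k * (-1) ^+ e j * b k j)); last first.
  apply: eq_big_seq => k kl; rewrite big_cons eqxx E// mulrCA !mulrA; congr (_ + _).
  by apply: eq_big_seq => j jl; rewrite E.
rewrite [X in _ <= X + _](_ : _ = \sum_(j <- l) ((-1) ^+ s * ((-1) ^+ e j * b a j))); last first.
  by apply: eq_big_seq => j jl; rewrite E// mulrA.
rewrite big_split/= addrA -big_split/=.
under [X in _ <= X + _]eq_bigr do rewrite -mulrDr -mulrDr.
rewrite -mulr_sumr -/c -[leLHS]add0r lerD// /s.
by have [c0|c0] := ltP c 0; rewrite ?expr1 ?mulN1r ?oppr_ge0 ?(ltW c0)// mul1r.
Qed.

End Signs.

(** * Khintchine inequalities for sequences of rows satisfying the parallelogram law *)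

Section Parallelogram.
Context (R : realType).

Definition parallelogram (H : normedModType R) := forall a b : H,
  `|a + b| ^+ 2 + `|a - b| ^+ 2 = 2 * (`|a| ^+ 2 + `|b| ^+ 2).

(** Both squared norms lie between [(|a| - |b|)^2] and [(|a| + |b|)^2], which differ by
    [4 |a| |b|]. *)
Lemma parallelogram_diff (H : normedModType R) (a b : H) :
  (`|a + b| ^+ 2 - `|a - b| ^+ 2) ^+ 2 <= 16 * (`|a| ^+ 2 * `|b| ^+ 2).
Proof.
have h1 := ler_normD a b; have h2 := ler_normB a b.
have h3 := lerB_dist a b; have h4 := lerB_dist b a.
have h5 := lerB_dist a (- b); have h6 := lerB_dist b (- a).
rewrite opprK normrN in h5; rewrite opprK normrN addrC (addrC b) in h6.
rewrite (distrC b) in h4.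
have a0 := normr_ge0 a; have b0 := normr_ge0 b.
have ab0 := normr_ge0 (a + b); have ab0' := normr_ge0 (a - b).
have u1 : `|a + b| ^+ 2 <= (`|a| + `|b|) ^+ 2 by rewrite lerXn2r// nnegrE addr_ge0.
have u2 : `|a - b| ^+ 2 <= (`|a| + `|b|) ^+ 2 by rewrite lerXn2r// nnegrE addr_ge0.
have u3 : (`|a| - `|b|) ^+ 2 <= `|a - b| ^+ 2 by rewrite -real_normK ?num_real// lerXn2r ?nnegrE// ler_norml; lra.
have u4 : (`|a| - `|b|) ^+ 2 <= `|a + b| ^+ 2 by rewrite -real_normK ?num_real// lerXn2r ?nnegrE// ler_norml; lra.
have -> : 16 * (`|a| ^+ 2 * `|b| ^+ 2) = (4 * (`|a| * `|b|)) ^+ 2 by ring.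
have ab : 0 <= 4 * (`|a| * `|b|) by rewrite !mulr_ge0.
rewrite -[leLHS]real_normK ?num_real// lerXn2r ?nnegrE// ler_norml; nra.
Qed.

Context (E : nat -> normedModType R) (parE : forall i, parallelogram (E i)).
Context (I : eqType) (s : R) (s1 : 1 <= s).
Implicit Types z : I -> seqspace E.

Lemma seqspace0E i : (0 : seqspace E) i = 0. Proof. by []. Qed.

Lemma seqspace_sumE (l : seq I) (f : I -> seqspace E) i :
  (\sum_(k <- l) f k) i = \sum_(k <- l) f k i.
Proof.
elim: l => [|a l IH]; first by rewrite !big_nil.
by rewrite !big_cons -IH.
Qed.

Let R2 z l i := \sum_(k <- l) `|z k i| ^+ 2.
Let R2_ge0 z l i : 0 <= R2 z l i. Proof. by rewrite sumr_ge0// => k _; exact: sqr_ge0. Qed.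

(** Lower Khintchine inequality with constant 1. The potential is minus the sum over the rows of the
    s-th powers of [|v i|^2] plus the remaining squares: the parallelogram law gives equality of
    means for [s = 1], convexity the inequality for [s >= 1]. *)
Lemma signs_lower z K l : uniq l -> exists e : I -> bool,
  \sum_(i < K) (\sum_(k <- l) `|z k i| ^+ 2) `^ s <=
  \sum_(i < K) (`|\sum_(k <- l) (-1) ^+ e k *: z k i| ^+ 2) `^ s.
Proof.
move=> ul; pose F l v := - \sum_(i < K) (`|(v : seqspace E) i| ^+ 2 + R2 z l i) `^ s.
have [|e He] := @signs_exist R I (seqspace E) z F _ l ul 0.
  move=> a {ul} l v; rewrite /F -opprD mulrN lerN2 -big_split/= mulr_sumr.
  apply: ler_sum => i _; rewrite /R2 big_cons -/(R2 z l i).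
  apply: le_trans (power_mean2 s1 _ _); rewrite ?addr_ge0 ?sqr_ge0//.
  rewrite ler_pM2l// le_eqVlt; apply/orP; left; apply/eqP; congr (_ `^ _).
  have := parE (v i) (z a i); rewrite /= -[(v + z a) i]/(v i + z a i) -[(v - z a) i]/(v i - z a i); lra.
exists e; move: He; rewrite /F lerN2; congr (_ <= _); apply: eq_bigr => i _.
  by rewrite seqspace0E normr0 expr0n add0r.
by rewrite /R2 big_nil addr0 add0r seqspace_sumE.
Qed.

(** Convexity now points the wrong way; [two_point] compensates by weighting the remaining squares
    with [c], which is fixed before the vectors and the rows. *)
Lemma signs_upper : exists2 c : R, 0 <= c & forall z K l, uniq l -> exists e : I -> bool,
  \sum_(i < K) (`|\sum_(k <- l) (-1) ^+ e k *: z k i| ^+ 2) `^ s <=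
  \sum_(i < K) (c * \sum_(k <- l) `|z k i| ^+ 2) `^ s.
Proof.
have [c c0 Hc] := two_point s1; exists c => // z K l ul.
pose F l v := \sum_(i < K) (`|(v : seqspace E) i| ^+ 2 + c * R2 z l i) `^ s.
have [|e He] := @signs_exist R I (seqspace E) z F _ l ul 0.
  move=> a {ul} l v; rewrite /F -big_split/= mulr_sumr.
  apply: ler_sum => i _; rewrite /R2 big_cons -/(R2 z l i) mulrDr addrA.
  apply: Hc; rewrite ?sqr_ge0 ?mulr_ge0//.
    by rewrite -[(v + z a) i]/(v i + z a i) -[(v - z a) i]/(v i - z a i) parE.
  exact: parallelogram_diff.
exists e; move: He; rewrite /F; congr (_ <= _); apply: eq_bigr => i _.
  by rewrite /R2 big_nil mulr0 addr0 add0r seqspace_sumE.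
by rewrite seqspace0E normr0 expr0n add0r.
Qed.

End Parallelogram.

(** * Maps between [l^p]-sums *)

Section LpSumMaps.
Context (R : realType) (p : R) (p1 : 1 <= p).
Let p0 : 0 < p. Proof. exact: lt_le_trans p1. Qed.
Let pn0 : p != 0. Proof. by rewrite gt_eqF. Qed.

Lemma lpsum_psum_cvg (E : nat -> normedModType R) (x : lpsum p1 E) :
  (\sum_(i < K) `|coord i x| `^ p) @[K --> \oo] --> `|x| `^ p.
Proof.
apply/cvgrPdist_le => e e0; have [K0 hK0] := lpsum_psum_approx x e0.
near=> K.
have := lpsum_psum_le x K.
have := @psum_monotone _ (fun i => `|coord i x| `^ p) K0 K (fun=> powR_ge0 _ _).
move=> /(_ _); rewrite ler_norml => h1 h2.
have {}h1 : \sum_(i < K0) `|coord i x| `^ p <= \sum_(i < K) `|coord i x| `^ p.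
  by apply: h1; near: K; exact: nbhs_infty_ge.
lra.
Unshelve. all: by end_near. Qed.

Lemma lpsum_map (X : normedModType R) (E : nat -> normedModType R)
    (f : forall i, X -> E i) (C : R) : 0 <= C -> (forall i, linear (f i)) ->
  (forall x K, \sum_(i < K) `|f i x| `^ p <= (C * `|x|) `^ p) ->
  exists T : {linear X -> lpsum p1 E},
    (forall x i, coord i (T x) = f i x) /\ bounded_by C T.
Proof.
move=> C0 lf fC.
have /choice[T HT] : forall x, exists y : lpsum p1 E,
    (forall i, coord i y = f i x) /\ `|y| <= C * `|x|.
  by move=> x; apply: lpsum_exists; [exact: mulr_ge0|exact: fC].
have lT : linear T.
  move=> a x y; apply: coordP => i; rewrite linearP/=.
  by rewrite !(fun z => (HT z).1) lf.
by exists (mklin lT); split => [x i|x]; have [] := HT x.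
Qed.

Lemma lpsum_functor (E F : nat -> normedModType R)
    (T : forall i, {linear E i -> F i}) (C : R) : 0 <= C ->
  (forall i, bounded_by C (T i)) ->
  exists U : {linear lpsum p1 E -> lpsum p1 F},
    (forall x i, coord i (U x) = T i (coord i x)) /\ bounded_by C U.
Proof.
move=> C0 TC.
apply: (@lpsum_map _ _ (fun i x => T i (coord i x)) C) => //.
  by move=> i a x y; rewrite !linearP.
move=> x K; rewrite powRM//; apply: le_trans (ler_wpM2l (powR_ge0 _ _) (lpsum_psum_le x K)).
rewrite mulr_sumr; apply: ler_sum => i _; rewrite -powRM//.
by apply: (powR_le (ltW p0)) => //; exact: TC.
Qed.

Lemma lpsum_functor_retract (E F : nat -> normedModType R)
    (T : forall i, {linear E i -> F i}) (Q : forall i, {linear F i -> E i}) (C : R) :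
  0 <= C -> (forall i, bounded_by C (T i)) -> (forall i, bounded_by C (Q i)) ->
  (forall i, cancel (T i) (Q i)) -> retract (lpsum p1 E) (lpsum p1 F).
Proof.
move=> C0 TC QC TQ; have [U [UE UC]] := lpsum_functor C0 TC.
have [V [VE VC]] := lpsum_functor C0 QC.
by apply: retract_of UC VC _ => x; apply: coordP => i; rewrite VE UE TQ.
Qed.

Lemma lpsum_functor_embeds (E F : nat -> normedModType R)
    (T : forall i, {linear E i -> F i}) (c C : R) : 0 < c -> 0 <= C ->
  (forall i, bounded_by C (T i)) ->
  (forall i x, c * `|x| <= `|T i x|) -> (forall i, closed (range (T i))) ->
  embeds (lpsum p1 E) (lpsum p1 F).
Proof.
move=> c0 C0 TC Tc clT; have [U [UE UC]] := lpsum_functor C0 TC.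
have low (x : lpsum p1 E) (y : lpsum p1 F) :
    (forall i, T i (coord i x) = coord i y) -> c * `|x| <= `|y|.
  move=> xy; rewrite -ler_pdivlMl//; apply/lpsum_normP.
    by rewrite mulr_ge0// invr_ge0 ltW.
  have cV0 : 0 <= c^-1 by rewrite invr_ge0 ltW.
  move=> K; rewrite powRM//.
  apply: le_trans (ler_wpM2l (powR_ge0 _ _) (lpsum_psum_le y K)).
  rewrite mulr_sumr; apply: ler_sum => i _; rewrite -powRM//.
  by apply: (powR_le (ltW p0)) => //; rewrite -xy ler_pdivlMl.
apply: (below_embeds c0 UC) => [x|]; first by apply: low => i; rewrite UE.
(* The uniform lower bound [c] lets preimages of the coordinates be assembled into one vector, so
   membership in the range is decided row by row. *)
have -> : range U = \bigcap_(i in setT) [set y | range (T i) (coord i y)].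
  apply/seteqP; split => [_ [x _ <-] i _|y Hy] /=.
    by rewrite UE; exists (coord i x).
  have ex i : exists x, T i x = coord i y by have [x _ xy] := Hy i I; exists x.
  pose x i := sval (cid (ex i)).
  have Hx i : T i (x i) = coord i y := svalP (cid (ex i)).
  have cV0 : 0 <= c^-1 by rewrite invr_ge0 ltW.
  have [|K|X [XE _]] := @lpsum_exists _ _ p1 E x (c^-1 * `|y|).
  - exact: mulr_ge0.
  - rewrite powRM//.
    apply: le_trans (ler_wpM2l (powR_ge0 _ _) (lpsum_psum_le y K)).
    rewrite mulr_sumr; apply: ler_sum => i _; rewrite -powRM//.
    by apply: (powR_le (ltW p0)) => //; rewrite -Hx ler_pdivlMl.
  exists X => //; apply: coordP => i; by rewrite UE XE Hx.
apply: closed_bigI => i _; apply: (@closed_preimage _ _ _ (coord i) 1) => //; last exact: clT.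
by move=> x; rewrite mul1r coord_le.
Qed.

Lemma sum_sub (I : eqType) (s t : seq I) (f : I -> R) : uniq s ->
  {subset s <= t} -> (forall i, 0 <= f i) -> \sum_(i <- s) f i <= \sum_(i <- t) f i.
Proof.
move=> + + f0; elim: s t => [|a s IH] t /=; first by rewrite big_nil sumr_ge0.
move=> /andP[as_ us] st; have at_ : a \in t by apply: st; rewrite mem_head.
rewrite big_cons (big_rem a at_)/= lerD2l; apply: IH => // k ks.
have kt : k \in t by apply: st; rewrite in_cons ks orbT.
rewrite (perm_mem (perm_to_rem at_)) in_cons in kt.
by case/orP: kt => // /eqP ka; rewrite -ka ks in as_.
Qed.

Lemma lpsum_sum_le (E : nat -> normedModType R) (x : lpsum p1 E) (s : seq nat) :
  uniq s -> \sum_(i <- s) `|coord i x| `^ p <= `|x| `^ p.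
Proof.
move=> us; pose K := (\max_(i <- s) i).+1.
apply: le_trans (lpsum_psum_le x K).
rewrite -(big_mkord xpredT (fun i => `|coord i x| `^ p)).
apply: sum_sub => // i si.
by rewrite mem_index_iota ltnS (@leq_bigmax_seq _ s xpredT id i si isT).
Qed.

Lemma lpsum_flatten (E : normedModType R) :
  retract (lpsum p1 (fun=> lpsum p1 (fun=> E))) (lpsum p1 (fun=> E)).
Proof.
pose W := lpsum p1 (fun=> lpsum p1 (fun=> E)).
(* Row [k] holds the entry whose pair of indices is coded by [k]; a number that codes no pair gets
   0. *)
pose f (k : nat) (w : W) : E :=
  if (pickle_inv k : option (nat * nat)) is Some a then coord a.2 (coord a.1 w) else 0.
have [||T [TE TC]] := @lpsum_map W (fun=> E) f 1 ler01.
- by move=> k a x y; rewrite /f; case: pickle_inv => [[N j]|]; rewrite ?linearP ?scaler0 ?addr0.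
- move=> w K; rewrite mul1r.
  pose s : seq (nat * nat) := pmap (fun k => (pickle_inv k : option (nat * nat))) (iota 0 K).
  have us : uniq s.
    exact: (pmap_uniq (@pickle_invK (nat * nat)%type) (iota_uniq 0 K)).
  have -> : \sum_(k < K) `|f k w| `^ p = \sum_(a <- s) `|coord a.2 (coord a.1 w)| `^ p.
    rewrite -(big_mkord xpredT (fun k => `|f k w| `^ p)) /index_iota subn0 /s.
    elim: (iota 0 K) => [|k l IH]; first by rewrite !big_nil.
    rewrite big_cons/= IH /f; case: (pickle_inv k) => [a|]/=.
      by rewrite big_cons.
    by rewrite normr0 powR0// add0r.
  pose L := (\max_(a <- s) maxn a.1 a.2).+1.
  apply: (@le_trans _ _ (\sum_(a <- [seq (N, j) | N <- iota 0 L, j <- iota 0 L])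
     `|coord a.2 (coord a.1 w)| `^ p)).
    apply: sum_sub => // a sa.
    have := @leq_bigmax_seq _ s xpredT (fun a => maxn a.1 a.2) a sa isT.
    rewrite -/L geq_max => /andP[a1 a2]; case: a sa a1 a2 => N j sa a1 a2.
    apply/allpairsP; exists (N, j).
    by split; rewrite // mem_iota add0n ltnS.
  rewrite big_allpairs; apply: le_trans (lpsum_psum_le w L).
  rewrite -(big_mkord xpredT (fun N => `|coord N w| `^ p)) /index_iota subn0.
  apply: ler_sum => N _; apply: le_trans (lpsum_psum_le (coord N w) L).
  by rewrite -(big_mkord xpredT (fun j => `|coord j (coord N w)| `^ p)) /index_iota subn0.
pose g (N : nat) (z : lpsum p1 (fun=> E)) (j : nat) : E := coord (pickle (N, j)) z.
have upk (l : seq (nat * nat)) : uniq l -> uniq (map pickle l).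
  by move=> ul; rewrite map_inj_uniq//; exact: (pcan_inj pickleK_inv).
have gP z (s : seq (nat * nat)) : uniq s ->
    \sum_(a <- s) `|g a.1 z a.2| `^ p <= `|z| `^ p.
  move=> us; have := lpsum_sum_le z (upk _ us); rewrite big_map.
  by congr (_ <= _); apply: eq_bigr => -[].
have gN N : exists G : {linear lpsum p1 (fun=> E) -> lpsum p1 (fun=> E)},
    (forall z i, coord i (G z) = g N z i) /\ bounded_by 1 G.
  apply: (@lpsum_map _ (fun=> E) (fun i z => g N z i) 1) => //.
  move=> z K; rewrite mul1r; have := @gP z [seq (N, j) | j <- iota 0 K].
  rewrite big_map -(big_mkord xpredT (fun j => `|g N z j| `^ p)) /index_iota subn0.
  by apply; rewrite map_inj_uniq ?iota_uniq// => i j [].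
have /choice[G HG] := gN.
have [||Q [QE QC]] := @lpsum_map (lpsum p1 (fun=> E)) (fun=> lpsum p1 (fun=> E)) (fun N z => G N z) 1 ler01.
- by move=> N a x y; rewrite linearP.
- move=> z L; rewrite mul1r; apply/ler_addgt0Pr => e e0.
  (* Each of the [L] rows is approximated by a finite sum of its own length [J N], so that only
     finitely many codes occur; the errors add up to at most [e]. *)
  have eL : 0 < e / L.+1%:R by rewrite divr_gt0.
  have /choice[J HJ] := fun N => lpsum_psum_approx (G N z) eL.
  pose s : seq (nat * nat) := [seq (N, j) | N <- iota 0 L, j <- iota 0 (J N)].
  have us : uniq s.
    apply: allpairs_uniq_dep => [|N _|[a b] [c d] _ _ /= [-> ->]//]; exact: iota_uniq.
  have := gP z _ us; rewrite big_allpairs_dep/= => h.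
  apply: (@le_trans _ _ (\sum_(N < L) (\sum_(j <- iota 0 (J N)) `|g N z j| `^ p + e / L.+1%:R))).
    apply: ler_sum => N _; apply: (le_trans (ltW (HJ N))); rewrite lerD2r.
    rewrite -(big_mkord xpredT (fun j => `|coord j (G N z)| `^ p)) /index_iota subn0.
    by apply: ler_sum => j _; rewrite (HG N).1.
  rewrite big_split/= lerD//.
    rewrite -(big_mkord xpredT (fun N => \sum_(j <- iota 0 (J N)) `|g N z j| `^ p)).
    by rewrite /index_iota subn0.
  rewrite sumr_const card_ord -[leLHS]mulr_natl mulrCA ler_piMr ?(ltW e0)//.
  by rewrite ler_pdivrMr// mul1r ler_nat.
apply: retract_of TC QC _ => w; apply: coordP => N; apply: coordP => j.
by rewrite QE (HG N).1 /g TE /f pickleK_inv.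
Qed.

End LpSumMaps.

Lemma lpsum2_parallelogram (R : realType) (p1 : 1 <= (2 : R)) (E : nat -> normedModType R) :
  (forall i, parallelogram (E i)) -> parallelogram (lpsum p1 E).
Proof.
move=> parE a b.
have c x := @lpsum_psum_cvg R 2 p1 E x.
have h1 : (\sum_(i < K) `|coord i (a + b)| `^ 2 +
    \sum_(i < K) `|coord i (a - b)| `^ 2) @[K --> \oo] --> `|a + b| `^ 2 + `|a - b| `^ 2.
  by apply: cvgD; exact: c.
have h2 : (2 * (\sum_(i < K) `|coord i a| `^ 2 + \sum_(i < K) `|coord i b| `^ 2))
    @[K --> \oo] --> 2 * (`|a| `^ 2 + `|b| `^ 2).
  by apply: cvgM; [exact: cvg_cst|apply: cvgD; exact: c].
rewrite -!powR_mulrn//; apply: (cvg_unique (@norm_hausdorff _ _) h1).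
apply: cvg_trans h2; apply: near_eq_cvg; near=> K.
rewrite -!big_split/= mulr_sumr; apply: eq_bigr => i _.
by rewrite !powR_mulrn// linearD linearB/= parE.
Unshelve. all: by end_near. Qed.

Lemma real_parallelogram (R : realType) : parallelogram (R : normedModType R).
Proof. by move=> a b; rewrite !real_normK ?num_real//; ring. Qed.

Lemma ell2_parallelogram (R : realType) : parallelogram (ell2 R).
Proof. by apply: lpsum2_parallelogram => _; exact: real_parallelogram. Qed.

Lemma ell2_psum (R : realType) (y : ell2 R) K : \sum_(i < K) (coord i y) ^+ 2 <= `|y| ^+ 2.
Proof.
have := lpsum_psum_le y K; rewrite powR_mulrn//; apply: le_trans.
by apply: ler_sum => i _; rewrite powR_mulrn// real_normK ?num_real.
Qed.

(** Entries are at most the norm, so [|z_k|^p <= |z|^(p-2) |z_k|^2]. *)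
Lemma ell2_lp (R : realType) (p : R) (z : ell2 R) K : 2 <= p ->
  \sum_(k < K) `|coord k z| `^ p <= `|z| `^ p.
Proof.
move=> p2; have pn0 : p != 0 by rewrite gt_eqF// (lt_le_trans _ p2).
have [->|z0] := eqVneq z 0.
  rewrite big1 ?powR_ge0// => i _; by rewrite linear0 normr0 powR0.
have nz : 0 < `|z| by rewrite normr_gt0.
have split2 (b : R) : 0 < b -> b `^ p = b `^ (p - 2) * b ^+ 2.
  move=> b0; rewrite -powR_mulrn ?(ltW b0)// -powRD ?subrK//.
  by rewrite (gt_eqF b0) implybT.
rewrite (split2 _ nz).
apply: le_trans (ler_wpM2l (powR_ge0 _ _) (ell2_psum z K)).
rewrite mulr_sumr; apply: ler_sum => i _.
have [->|zi0] := eqVneq (coord i z) 0.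
  by rewrite normr0 powR0// mulr_ge0 ?powR_ge0// sqr_ge0.
have nzi : 0 < `|coord i z| by rewrite normr_gt0.
rewrite (split2 _ nzi) real_normK ?num_real// ler_wpM2r ?sqr_ge0//.
apply: powR_le; rewrite ?subr_ge0 ?p2//; exact: coord_le.
Qed.

(** * The spaces [X_{p,w}] and [B_p] *)

Section XpTheory.
Context (R : realType) (p : R) (p2 : 2 < p) (w : nat -> R).
Local Notation p1 := (ge1_gt2 p2).
Local Notation X := (Xp p2 w).
Let p0 : 0 < p. Proof. exact: lt_le_trans p1. Qed.
Let pn0 : p != 0. Proof. by rewrite gt_eqF. Qed.

Definition xcoord (i : nat) (x : X) : R^o :=
  (\val (x : finpart (Xp_extnorm w p1)) : seqspace (fun=> (R : normedModType R))) i.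

Lemma xcoord_linear i : linear (xcoord i).
Proof. by []. Qed.

HB.instance Definition _ i :=
  GRing.isLinear.Build R X R^o *:%R (xcoord i) (xcoord_linear i).

Lemma xcoordP (x y : X) : (forall i, xcoord i x = xcoord i y) -> x = y.
Proof. by move=> xy; apply/val_inj/seqspace_ext. Qed.

Lemma Xp_enorm_le (y : seqspace (fun=> (R : normedModType R))) (M : R) : 0 <= M ->
  (Xp_enorm w p y <= M%:E)%E <->
  (forall K, \sum_(i < K) `|y i| `^ p <= M `^ p) /\
  (forall K, \sum_(i < K) (w i * y i) ^+ 2 <= M ^+ 2).
Proof.
move=> M0; have E2 K : \sum_(i < K) `|wmul w y i| `^ 2 = \sum_(i < K) (w i * y i) ^+ 2.
  by apply: eq_bigr => i _; rewrite powR_mulrn// real_normK ?num_real.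
rewrite /Xp_enorm ge_max; split => [/andP[/(lp_enorm_le p1 _ M0) h1]|[h1 h2]].
  move=> /(lp_enorm_le (ler1n R 2) _ M0) h2; split => // K.
  by rewrite -E2 -powR_mulrn.
apply/andP; split; first exact/(lp_enorm_le p1 _ M0).
by apply/(lp_enorm_le (ler1n R 2) _ M0) => K; rewrite E2 powR_mulrn.
Qed.

Lemma Xp_normP (x : X) M : 0 <= M -> `|x| <= M <->
  (forall K, \sum_(i < K) `|xcoord i x| `^ p <= M `^ p) /\
  (forall K, \sum_(i < K) (w i * xcoord i x) ^+ 2 <= M ^+ 2).
Proof.
move=> M0; rewrite -Xp_enorm_le//.
by rewrite -lee_fin (_ : (`|x|)%:E = Xp_enorm w p (fun i => xcoord i x))//; exact: finpart_normE.
Qed.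

Lemma Xp_exists (y : nat -> R) M : 0 <= M ->
  (forall K, \sum_(i < K) `|y i| `^ p <= M `^ p) ->
  (forall K, \sum_(i < K) (w i * y i) ^+ 2 <= M ^+ 2) ->
  exists x : X, (forall i, xcoord i x = y i) /\ `|x| <= M.
Proof.
move=> M0 h1 h2.
have yfin : finpart_pred (Xp_extnorm w p1) (y : seqspace (fun=> (R : normedModType R))).
  have /Xp_enorm_le yM : (forall K, \sum_(i < K) `|y i| `^ p <= M `^ p) /\
    (forall K, \sum_(i < K) (w i * y i) ^+ 2 <= M ^+ 2) by [].
  by apply: (le_lt_trans (yM M0)); rewrite ltry.
exists (exist _ (y : seqspace (fun=> (R : normedModType R))) yfin : finpart (Xp_extnorm w p1)).
split => //; exact/Xp_normP.
Qed.

Lemma Xp_lp_exists : exists S : {linear X -> lpsum p1 (fun=> (R : normedModType R))},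
  (forall x i, coord i (S x) = xcoord i x) /\ bounded_by 1 S.
Proof.
apply: (@lpsum_map _ p p1 X (fun=> R) (fun i x => xcoord i x)) => // x K.
by rewrite mul1r; exact: ((Xp_normP x (normr_ge0 x)).1 (lexx _)).1.
Qed.

Lemma Xp_l2_exists : exists L : {linear X -> ell2 R},
  (forall x i, coord i (L x) = w i * xcoord i x) /\ bounded_by 1 L.
Proof.
apply: (@lpsum_map _ 2 _ X (fun=> R) (fun i x => w i * xcoord i x)) => //.
  move=> i a x y; rewrite linearP/= mulrDr; congr (_ + _).
  exact: mulrCA.
move=> x K; rewrite mul1r powR_mulrn//.
apply: le_trans (((Xp_normP x (normr_ge0 x)).1 (lexx _)).2 K).
by apply: ler_sum => i _; rewrite powR_mulrn// real_normK ?num_real.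
Qed.

Definition Xp_lp := sval (cid Xp_lp_exists).
Definition Xp_l2 := sval (cid Xp_l2_exists).

Lemma Xp_lpE x i : coord i (Xp_lp x) = xcoord i x.
Proof. by rewrite /Xp_lp; case: cid => S []. Qed.

Lemma Xp_l2E x i : coord i (Xp_l2 x) = w i * xcoord i x.
Proof. by rewrite /Xp_l2; case: cid => S []. Qed.

Lemma Xp_lp_le x : `|Xp_lp x| <= `|x|.
Proof. by rewrite /Xp_lp; case: cid => S [_ h] /=; have := h x; rewrite mul1r. Qed.

Lemma Xp_l2_le x : `|Xp_l2 x| <= `|x|.
Proof. by rewrite /Xp_l2; case: cid => S [_ h] /=; have := h x; rewrite mul1r. Qed.

Lemma xcoord_le x i : `|xcoord i x| <= `|x|.
Proof. by rewrite -Xp_lpE; apply: le_trans (coord_le _ i) (Xp_lp_le x). Qed.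

Lemma Xp_norm_le x M : `|Xp_lp x| <= M -> `|Xp_l2 x| <= M -> `|x| <= M.
Proof.
move=> h1 h2; have M0 : 0 <= M by exact: le_trans h1.
apply/Xp_normP => //; split => K.
  apply: (@le_trans _ _ (`|Xp_lp x| `^ p)); last exact: powR_le (ltW p0) _ _.
  apply: le_trans (lpsum_psum_le _ K); apply: ler_sum => i _; by rewrite Xp_lpE.
apply: (@le_trans _ _ (`|Xp_l2 x| ^+ 2)); last by rewrite lerXn2r ?nnegrE.
by apply: le_trans (ell2_psum _ K); apply: ler_sum => i _; rewrite Xp_l2E.
Qed.

(** Row 0 is the weighted [l^2]-part, and row [m + 1] carries the single entry [x_m] in column 0.
    The [l^p]-sum of these rows is equivalent to the maximum that defines the norm of [x]. *)
Definition Xp_row (m : nat) (x : X) : ell2 R :=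
  if m is m'.+1 then @lpinj R 2 (ler1n R 2) (fun=> R) 0 (xcoord m' x) else Xp_l2 x.

Lemma Xp_into : exists T : {linear X -> lpsum_ell2 p1},
  [/\ bounded_by 2 T, forall x, 1 * `|x| <= `|T x| & closed (range T)].
Proof.
have [||T [TE TC]] := @lpsum_map _ p p1 X (fun=> ell2 R) Xp_row 2 (ler0n _ 2).
- by move=> [|m] a x y; rewrite /Xp_row ?linearP.
- move=> x [|K]; first by rewrite big_ord0 powR_ge0.
  rewrite big_ord_recl/= powRM//.
  have h2 : 2 <= 2 `^ p :> R by rewrite le1r_powR// ?ler1n// p1.
  apply: (@le_trans _ _ (2 * `|x| `^ p)); last by rewrite ler_wpM2r ?powR_ge0.
  have -> : 2 * `|x| `^ p = `|x| `^ p + `|x| `^ p by rewrite mulr_natl mulr2n.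
  rewrite lerD//; first by apply: (powR_le (ltW p0)); rewrite // Xp_l2_le.
  apply: le_trans (((Xp_normP x (normr_ge0 x)).1 (lexx _)).1 K).
  by apply: ler_sum => i _; rewrite lpinj_norm.
exists T; split => //.
  move=> x; rewrite mul1r; apply: Xp_norm_le.
    apply/lpsum_normP => // K; apply: le_trans (lpsum_psum_le _ K.+1).
    rewrite big_ord_recl/= ler_wpDl ?powR_ge0//; apply: ler_sum => i _.
    by rewrite TE /= lpinj_norm Xp_lpE.
  by have := coord_le (T x) 0; rewrite TE.
(* The range is the common kernel of two families: [k1] makes the rows after row 0 vanish outside
   column 0, and [k2] ties row 0 to the weighted column 0. *)
pose k1 (a : nat * nat) (z : lpsum_ell2 p1) : R^o := if a.2 == 0 then 0 else coord a.2 (coord a.1.+1 z).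
pose k2 i (z : lpsum_ell2 p1) : R^o := coord i (coord 0 z) - w i * coord 0 (coord i.+1 z).
have l1 a : linear (k1 a).
  by move=> c x y; rewrite /k1; case: ifP => _; rewrite ?scaler0 ?addr0// !linearP.
have l2 i : linear (k2 i).
  move=> c x y; rewrite /k2 !linearP/= scalerBr mulrDr opprD addrACA; congr (_ + _ + _).
  by congr (- _); exact: mulrCA.
have b1 a : bounded_by 1 (mklin (l1 a)).
  move=> z /=; rewrite /k1 mul1r; case: ifP => _; first by rewrite normr0.
  by apply: le_trans (coord_le _ _) (coord_le _ _).
have b2 i : bounded_by (1 + `|w i|) (mklin (l2 i)).
  move=> z /=; rewrite /k2 mulrDl mul1r (le_trans (ler_normB _ _))//.
  rewrite lerD ?normrM ?ler_wpM2l//; by apply: le_trans (coord_le _ _) (coord_le _ _).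
suff -> : range T = (\bigcap_(a in setT) [set z | mklin (l1 a) z = 0]) `&`
    (\bigcap_(i in setT) [set z | mklin (l2 i) z = 0]).
  apply: closedI; apply: closed_bigI => a _.
    exact: closed_kernel (b1 a).
  exact: closed_kernel (b2 a).
apply/seteqP; split => [_ [x _ <-]|z [h1 h2]].
  split => [[m i] _|i _] /=.
    rewrite /k1/=; case: eqVneq => // i0; rewrite TE/= coord_inj0//.
    by rewrite eq_sym.
  by rewrite /k2 !TE/= coord_inj Xp_l2E subrr.
have {}h2 i : coord i (coord 0 z) = w i * coord 0 (coord i.+1 z).
  by apply/eqP; rewrite -subr_eq0; apply/eqP; exact: (h2 i I).
have [||| x [xE _]] := @Xp_exists (fun i => coord 0 (coord i.+1 z)) `|z| => //.
- move=> K; apply: le_trans (lpsum_psum_le z K.+1).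
  rewrite big_ord_recl ler_wpDl ?powR_ge0//; apply: ler_sum => i _.
  by apply: (powR_le (ltW p0)) => //; exact: coord_le.
- move=> K; apply: (@le_trans _ _ (`|coord 0 z| ^+ 2)).
    by apply: le_trans (ell2_psum _ K); apply: ler_sum => i _; rewrite h2.
  by rewrite lerXn2r ?nnegrE// coord_le.
exists x => //; apply: coordP => m; apply: coordP => i; rewrite TE.
case: m => [|m]/=; first by rewrite Xp_l2E xE h2.
have [i0|i0] := eqVneq i 0.
  by rewrite i0 coord_inj xE.
rewrite coord_inj0 1?eq_sym//; have := h1 (m, i) I.
by rewrite /= /k1/= (negPf i0).
Qed.

End XpTheory.

(** * The complemented copy of [l^2] spanned by blocks *)

Section Blocks.
Context (R : realType) (p : R) (p2 : 2 < p) (N : nat).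
Local Notation p1 := (ge1_gt2 p2).
Local Notation X := (Xp p2 (vseq p N.+1)).
Let p0 : 0 < p. Proof. exact: lt_le_trans p1. Qed.
Let pn0 : p != 0. Proof. by rewrite gt_eqF. Qed.
Local Notation c := ((N.+1%:R^-1 : R) `^ ((p - 2) / (2 * p))).
Local Notation a := ((N.+1%:R^-1 : R) `^ p^-1).
Let n0 : 0 < (N.+1%:R^-1 : R). Proof. by rewrite invr_gt0. Qed.

Lemma vseq_gt0 : 0 < c. Proof. exact: powR_gt0. Qed.

Lemma vseq_le1 : c <= 1.
Proof.
rewrite -[leRHS](powRr0 (N.+1%:R^-1 : R)); apply: ger_powR.
  by rewrite n0/= invf_le1// ler1n.
by rewrite divr_ge0 ?mulr_ge0 ?subr_ge0 ?(ltW p0)// ltW.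
Qed.

Lemma vseq_power : a `^ p = N.+1%:R^-1.
Proof. by rewrite -powRrM mulVf// powRr1// ltW. Qed.

(** The factor [a] normalizes the indicator of a block of length [N.+1] in [l^p] ([vseq_power]); its
    weighted [l^2]-norm is then 1 as well. This is what the exponent in [vseq] is made for. *)
Lemma vseq_balance : N.+1%:R * (c * a) ^+ 2 = 1.
Proof.
rewrite -powR_mulrn ?mulr_ge0 ?powR_ge0// powRM ?powR_ge0// -!powRrM.
rewrite -powRD; last by rewrite (gt_eqF n0) implybT.
have -> : (p - 2) / (2 * p) * 2 + p^-1 * 2 = 1 by field.
by rewrite powRr1 ?(ltW n0)// mulfV.
Qed.

Lemma sum_blocks (V : nmodType) (n K : nat) (f : nat -> V) :
  \sum_(j < K * n) f j = \sum_(k < K) \sum_(r < n) f (k * n + r)%N.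
Proof.
elim: K => [|K IH]; first by rewrite mul0n !big_ord0.
rewrite big_ord_recr/= -IH -!(big_mkord xpredT f) mulSnr.
rewrite (@big_cat_nat _ _ _ (K * n)) ?leq_addr//=; congr (_ + _).
rewrite -{1}[(K * n)%N]add0n big_addn addKn big_mkord.
by apply: eq_bigr => i _; rewrite addnC.
Qed.

(** Entry [k] is spread over block [k]. By [vseq_balance] the weighted [l^2]-part has the norm of
    [z]; the [l^p]-part is controlled by [ell2_lp]. *)
Lemma block_map : exists T : {linear ell2 R -> X},
  (forall z j, xcoord j (T z) = a * coord (j %/ N.+1) z) /\ bounded_by 1 T.
Proof.
have bl (f : nat -> R) K : (forall k, 0 <= f k) ->
    \sum_(j < K) f (j %/ N.+1)%N <= N.+1%:R * \sum_(k < K) f k.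
  move=> f0; apply: (@le_trans _ _ (\sum_(j < K * N.+1) f (j %/ N.+1)%N)).
    apply: (@psum_monotone _ (fun j => f (j %/ N.+1)%N)) => //.
    by rewrite leq_pmulr.
  rewrite (sum_blocks _ _ (fun j => f (j %/ N.+1)%N)) mulr_sumr; apply: ler_sum => k _.
  rewrite (eq_bigr (fun=> f k)) ?sumr_const ?card_ord ?mulr_natl// => r _.
  by rewrite divnMDl// divn_small ?addn0.
have ex (z : ell2 R) : exists x : X, (forall j, xcoord j x = a * coord (j %/ N.+1) z) /\ `|x| <= `|z|.
  apply: Xp_exists => // K.
    pose f k : R := `|a * coord k z| `^ p.
    apply: (le_trans (bl f K (fun=> powR_ge0 _ _))); rewrite mulr_sumr.
    have E k : N.+1%:R * f k = `|coord k z| `^ p.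
      rewrite /f normrM powRM// ger0_norm ?powR_ge0// vseq_power mulrA.
      by rewrite mulfV ?mul1r.
    rewrite (eq_bigr (fun k : 'I_K => `|coord k z| `^ p)) => [|k _]; last exact: E.
    exact: (ell2_lp z K (ltW p2)).
  pose f k : R := (c * (a * coord k z)) ^+ 2.
  apply: (le_trans (bl f K (fun=> sqr_ge0 _))); rewrite mulr_sumr.
  apply: le_trans (ell2_psum z K); apply: ler_sum => k _.
  by rewrite /f mulrA exprMn mulrA vseq_balance mul1r.
have /choice[T HT] := ex.
have lT : linear T.
  move=> b x y; apply: xcoordP => j; rewrite linearP/= !(fun z => (HT z).1) linearP/=.
  rewrite mulrDr; congr (_ + _); exact: mulrCA.
exists (mklin lT); split => [z j|z]; first exact: (HT z).1.
by rewrite mul1r; exact: (HT z).2.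
Qed.

(** The weighted [l^2]-part of [x] bounds the block averages, by Cauchy-Schwarz in each block
    ([power_mean] with exponent 2). *)
Lemma block_average : exists Q : {linear X -> ell2 R},
  (forall x k, coord k (Q x) = a^-1 / N.+1%:R * \sum_(r < N.+1) xcoord (k * N.+1 + r) x) /\
  bounded_by 1 Q.
Proof.
apply: (@lpsum_map _ 2 _ X (fun=> R)
   (fun k x => a^-1 / N.+1%:R * \sum_(r < N.+1) xcoord (k * N.+1 + r) x)) => //.
  move=> k b x y; rewrite [RHS](_ : _ = b * (a^-1 / N.+1%:R * \sum_(r < N.+1) xcoord (k * N.+1 + r) x)
     + (a^-1 / N.+1%:R * \sum_(r < N.+1) xcoord (k * N.+1 + r) y))//.
  rewrite (eq_bigr (fun r : 'I_N.+1 => b * (xcoord (k * N.+1 + r) x : R) +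
    (xcoord (k * N.+1 + r) y : R))) => [|r _]; last by rewrite linearP.
  by rewrite big_split/= -mulr_sumr mulrDr mulrCA.
move=> x K; rewrite mul1r powR_mulrn//.
apply: le_trans (((Xp_normP x (normr_ge0 x)).1 (lexx _)).2 (K * N.+1)%N).
rewrite (sum_blocks _ _ (fun i => (vseq p N.+1 i * xcoord i x) ^+ 2)).
apply: ler_sum => k _; rewrite powR_mulrn// real_normK ?num_real//.
under [leRHS]eq_bigr do rewrite exprMn.
rewrite /vseq -mulr_sumr.
set S := \sum_(r < _) xcoord _ x.
set S2 := \sum_(r < _) xcoord _ x ^+ 2.
have h : S ^+ 2 <= N.+1%:R * S2.
  have := @power_mean R _ (index_enum 'I_N.+1) (fun r => `|xcoord (k * N.+1 + r) x|) 2.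
  rewrite ler1n => /(_ isT (fun=> normr_ge0 _)).
  have -> : size (index_enum 'I_N.+1) = N.+1 by rewrite -sum1_size sum1_card card_ord.
  rewrite powR_mulrn; last by rewrite divr_ge0// sumr_ge0.
  under [X in _ <= X -> _]eq_bigr do rewrite powR_mulrn// real_normK ?num_real//.
  rewrite -/S2 => h; set A := \sum_r _ in h.
  have SA : S ^+ 2 <= A ^+ 2.
    by rewrite -real_normK ?num_real// lerXn2r ?nnegrE ?sumr_ge0// ler_norm_sum.
  apply: (le_trans SA).
  have -> : A ^+ 2 = N.+1%:R * (N.+1%:R * (A / N.+1%:R) ^+ 2) by field.
  by rewrite ler_pM2l ?ltr0Sn.
rewrite exprMn; have a0 : 0 < a by exact: powR_gt0.
have hc : (a^-1 / N.+1%:R) ^+ 2 * N.+1%:R = c ^+ 2.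
  have <- : N.+1%:R * (c * a) ^+ 2 * ((a^-1 / N.+1%:R) ^+ 2 * N.+1%:R) = c ^+ 2.
    by field; rewrite gt_eqF//=.
  by rewrite vseq_balance mul1r.
apply: (@le_trans _ _ ((a^-1 / N.+1%:R) ^+ 2 * (N.+1%:R * S2))).
  by rewrite ler_wpM2l// sqr_ge0.
by rewrite mulrA hc.
Qed.

Lemma block_retract : exists (T : {linear ell2 R -> X}) (Q : {linear X -> ell2 R}),
  [/\ bounded_by 1 T, bounded_by 1 Q & cancel T Q].
Proof.
have [T [TE TC]] := block_map; have [Q [QE QC]] := block_average.
exists T, Q; split => // z; apply: coordP => k; rewrite QE.
rewrite (eq_bigr (fun=> a * coord k z)) => [|r _].
  have a0 : 0 < a by exact: powR_gt0.
  by rewrite sumr_const card_ord -mulr_natl; field; rewrite gt_eqF//=.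
by rewrite TE divnMDl// divn_small ?addn0.
Qed.

End Blocks.

(** * The positive embeddings between [X_p], [B_p] and the sum of copies of [l^2] *)

Section BpEmbeddings.
Context (R : realType) (p : R) (p2 : 2 < p).
Local Notation p1 := (ge1_gt2 p2).

Lemma retract_sum_ell2_Bp : retract (lpsum_ell2 p1) (Bp p2).
Proof.
pose T N := sval (cid (block_retract p2 N)).
pose Q N := sval (cid (svalP (cid (block_retract p2 N)))).
have H N : [/\ bounded_by 1 (T N), bounded_by 1 (Q N) & cancel (T N) (Q N)] :=
  svalP (cid (svalP (cid (block_retract p2 N)))).
by apply: (@lpsum_functor_retract _ _ _ _ _ T Q 1) => // N; have [] := H N.
Qed.

(** The bounds 1 and 2 of [Xp_into] do not depend on [N], so the summands embed simultaneously into
    a double sum, which is flattened. *)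
Lemma embeds_Bp_sum_ell2 : embeds (Bp p2) (lpsum_ell2 p1).
Proof.
apply: embeds_retract (lpsum_flatten p1 (ell2 R)).
pose T N := sval (cid (Xp_into p2 (vseq p N.+1))).
have H N : [/\ bounded_by 2 (T N), forall x, 1 * `|x| <= `|T N x| & closed (range (T N))] :=
  svalP (cid (Xp_into p2 (vseq p N.+1))).
by apply: (@lpsum_functor_embeds _ _ _ _ _ T 1 2) => // N; have [] := H N.
Qed.

Lemma embeds_Xp_Bp w : embeds (Xp p2 w) (Bp p2).
Proof.
have [T [TC Tc clT]] := Xp_into p2 w.
exact: embeds_retract (below_embeds ltr01 TC Tc clT) retract_sum_ell2_Bp.
Qed.

End BpEmbeddings.

(** * Real inequalities and selection of indices *)

Section RealTools.
Context (R : realType).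

Lemma pow_unbounded (r C : R) : 0 < r -> exists n : nat, C < n.+1%:R `^ r.
Proof.
move=> r0; have [C0|C0] := ltP C 0; first by exists 0%N; rewrite (lt_le_trans C0)// powR_ge0.
exists (Num.trunc (C `^ r^-1)).
rewrite -{1}(powRVK (lt0r_neq0 r0) C0); apply: powR_lt => //; first exact: powR_ge0.
exact: truncnS_gt.
Qed.

Lemma pow_lt_linear (r C : R) : r < 1 -> exists n : nat, C * n.+1%:R `^ r < n.+1%:R.
Proof.
move=> r1; have [|n Hn] := @pow_unbounded (1 - r) C; first by rewrite subr_gt0.
have n0 : 0 < n.+1%:R :> R by rewrite ltr0n.
have E : n.+1%:R = n.+1%:R `^ (1 - r) * n.+1%:R `^ r :> R.
  by rewrite -powRD ?subrK ?powRr1 ?(ltW n0)// (gt_eqF n0) implybT.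
by exists n; rewrite [ltRHS]E ltr_pM2r// powR_gt0.
Qed.

Lemma powR_right_near (r A e : R) : 0 < r -> 0 <= A -> 0 < e ->
  exists2 d, 0 < d & (A + d) `^ r <= A `^ r + e.
Proof.
move=> r0 A0 e0; exists ((A `^ r + e) `^ r^-1 - A).
  rewrite subr_gt0 -[X in X < _](powRK (lt0r_neq0 r0) A0).
  by apply: powR_lt; rewrite ?invr_gt0 ?powR_ge0// ltrDl.
rewrite [A + _]addrC subrK powRVK ?lt0r_neq0//.
by rewrite addr_ge0 ?powR_ge0// ltW.
Qed.

Lemma cauchy_schwarz (I : Type) (l : seq I) (a b : I -> R) :
  (\sum_(i <- l) a i * b i) ^+ 2 <= (\sum_(i <- l) a i ^+ 2) * (\sum_(i <- l) b i ^+ 2).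
Proof.
set A := \sum_(i <- l) a i ^+ 2; set B := \sum_(i <- l) b i ^+ 2; set C := \sum_(i <- l) _.
have A0 : 0 <= A by rewrite sumr_ge0// => i _; exact: sqr_ge0.
have B0 : 0 <= B by rewrite sumr_ge0// => i _; exact: sqr_ge0.
have H t : 0 <= t ^+ 2 * A - 2 * t * C + B.
  have -> : t ^+ 2 * A - 2 * t * C + B = \sum_(i <- l) (t * a i - b i) ^+ 2.
    rewrite !mulr_sumr -sumrB -big_split/=; apply: eq_bigr => i _; ring.
  by rewrite sumr_ge0// => i _; exact: sqr_ge0.
have [A_eq0|An0] := eqVneq A 0.
  (* For [A = 0] the quadratic in [t] is affine, and this [t] gives it the value -1 unless
     [C = 0]. *)
  have := H ((B + 1) / (2 * C)); rewrite A_eq0 mulr0 add0r mul0r.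
  have [->|C0] := eqVneq C 0; first by rewrite expr0n.
  have -> : - (2 * ((B + 1) / (2 * C)) * C) + B = -1 by field.
  by rewrite oppr_ge0 ler10.
have Ap : 0 < A by rewrite lt_neqAle eq_sym An0.
have := H (C / A); rewrite -(pmulr_rge0 _ Ap).
have -> : A * ((C / A) ^+ 2 * A - 2 * (C / A) * C + B) = A * B - C ^+ 2 by field.
by rewrite subr_ge0.
Qed.

(** An ultrafilter finer than the neighbourhoods of infinity replaces a diagonal extraction: all
    coordinates converge along it, so any finitely many of them are close to their limits at the
    same large [j]. *)
Lemma cluster_seq (a : nat -> nat -> R) (M : R) : (forall j i, `|a j i| <= M) ->
  exists l : nat -> R, forall K m e, 0 < e ->
    exists2 j, (m <= j)%N & forall i, (i < K)%N -> `|a j i - l i| <= e.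
Proof.
move=> aM; have [U [UU ooU]] := @ultraFilterLemma nat (nbhs \oo) _.
have Up := @ultra_proper _ _ UU.
have /choice[l Hl] : forall i, exists l : R, (a ^~ i) j @[j --> U] --> l.
  move=> i; have [|l [_ lc]] := @segment_compact R (- M) M (fmap (a^~ i) U) _.
    apply: (@filterS _ U _ setT); last exact: filterT.
    by move=> j _ /=; rewrite in_itv/= -ler_norml.
  exists l => V Vl; have [//|UV] := in_ultra_setVsetC ((a^~ i) @^-1` V) UU.
  by have [x [/= nVx Vx]] := lc (~` V) V UV Vl.
exists l => K m e e0.
have U1 : U [set j | (m <= j)%N] := ooU _ (nbhs_infty_ge m).
have U2 : U [set j | forall i, (i < K)%N -> `|a j i - l i| <= e].
  elim: K => [|K IH]; first by apply: (@filterS _ U _ setT); last exact: filterT.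
  have h : U [set j | `|l K - a j K| <= e].
    by have /cvgrPdist_le/(_ e e0) := Hl K.
  apply: (@filterS _ U _ _ _ _ (filterI IH h)) => j [h1 h2] i.
  rewrite ltnS leq_eqVlt => /orP[/eqP->|]; first by rewrite distrC.
  exact: h1.
by have [j [jm jK]] := filter_ex (filterI U1 U2); exists j.
Qed.

Lemma infinitely_list (P : nat -> Prop) : (forall m, exists2 j, (m <= j)%N & P j) ->
  forall n m, exists l : seq nat,
    [/\ uniq l, size l = n, forall j, j \in l -> (m <= j)%N & forall j, j \in l -> P j].
Proof.
move=> HP; elim=> [m|n IH m]; first by exists [::].
have [j mj Pj] := HP m; have [l [ul sl lj lP]] := IH j.+1.
exists (j :: l); split => /=.
- by rewrite ul andbT; apply/negP => /lj; rewrite ltnn.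
- by rewrite sl.
- by move=> k; rewrite in_cons => /orP[/eqP->//|/lj /ltnW]; exact: leq_trans.
- by move=> k; rewrite in_cons => /orP[/eqP->//|]; exact: lP.
Qed.

End RealTools.

(** * Gliding humps *)

Section LpSumSequences.
Context (R : realType) (p : R) (p1 : 1 <= p).
Let p0 : 0 < p. Proof. exact: lt_le_trans p1. Qed.
Let pn0 : p != 0. Proof. by rewrite gt_eqF. Qed.
Context (E : nat -> normedModType R).
Local Notation Y := (lpsum p1 E).

Lemma trunc_idem (P : pred nat) (x : Y) : trunc P (trunc P x) = trunc P x.
Proof. by apply: coordP => i; rewrite !coord_trunc; case: (P i). Qed.

Lemma lpsum_sum_inj (l : seq nat) (v : forall i, E i) : uniq l ->
  `|\sum_(k <- l) lpinj p1 (v k)| `^ p = \sum_(k <- l) `|v k| `^ p.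
Proof.
elim: l => [_|a l IH /= /andP[al ul]]; first by rewrite !big_nil normr0 powR0.
rewrite !big_cons lpsum_normD ?IH ?lpinj_norm// => i.
have [->|ia] := eqVneq i a; [right|left]; last by rewrite coord_inj0 1?eq_sym.
rewrite linear_sum/= big1_seq// => k /= kl; rewrite coord_inj0//.
by apply: contraNneq al => <-.
Qed.

(** The sum so far has a small tail beyond some [K], and the next vector is taken with a small head
    below [K]. In p-th powers the step then costs at most [C^p + 1], half of the 1 for each of the
    two overlaps. *)
Lemma null_selection (y : nat -> Y) (C : R) : 0 <= C -> (forall k, `|y k| <= C) ->
  (forall K m d, 0 < d -> exists2 k, (m <= k)%N & `|trunc (below K) (y k)| <= d) ->
  forall n m, exists l : seq nat, [/\ uniq l, size l = n,
    forall k, k \in l -> (m <= k)%N & `|\sum_(k <- l) y k| `^ p <= n%:R * (C `^ p + 1)].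
Proof.
move=> C0 yC ynull; elim=> [m|n IH m].
  by exists [::]; rewrite big_nil normr0 powR0// mul0r.
have [l [ul sl lm lC]] := IH m; set s := \sum_(k <- l) y k in lC.
have h2 : 0 < (2^-1 : R) by rewrite invr_gt0.
have [d1 d10 Hd1] := powR_right_near p0 (normr_ge0 s) h2.
have [d2 d20 Hd2] := powR_right_near p0 C0 h2.
have [K HK] := trunc_tail s d20; have {}HK := HK K (leqnn K).
have [k km kd] := ynull K (maxn m (\max_(j <- l) j).+1) d1 d10.
have kl : k \notin l.
  apply/negP => kl; have := @leq_bigmax_seq _ l xpredT id k kl isT.
  by move: km; rewrite geq_max => /andP[_]; rewrite /= ltnNge => /negPf ->.
exists (k :: l); split => /=; first by rewrite kl.
- by rewrite sl.
- move=> j; rewrite in_cons => /orP[/eqP->|/lm//].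
  by move: km; rewrite geq_max => /andP[].
rewrite big_cons -/s (truncC_norm (below K)) !linearD/=.
have b1 : `|trunc (below K) (y k) + trunc (below K) s| `^ p <= `|s| `^ p + 2^-1.
  apply: le_trans Hd1; apply: (powR_le (ltW p0)) => //.
  by rewrite (le_trans (ler_normD _ _))// addrC lerD// trunc_le.
have b2 : `|trunc (predC (below K)) (y k) + trunc (predC (below K)) s| `^ p <= C `^ p + 2^-1.
  apply: le_trans Hd2; apply: (powR_le (ltW p0)) => //.
  by rewrite (le_trans (ler_normD _ _))// lerD// (le_trans (trunc_le _ _)).
have -> : n.+1%:R * (C `^ p + 1) = n%:R * (C `^ p + 1) + (C `^ p + 1).
  by rewrite -natr1 mulrDl mul1r.
apply: (le_trans (lerD b1 b2)); move: lC.
set A := C `^ p; set B := `|s| `^ p; lra.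
Qed.

(* Truncating the [y k] to successive blocks of rows makes their signed sums
   grow only like [n^(1/p)], whereas the functionals [psi k] grow like
   [n^(1/2)]; averaging over signs, their pairings cannot add up to [n]. *)
Lemma block_trace (X : normedModType R) (Q : {linear Y -> X}) (y : nat -> Y)
    (psi : nat -> {linear X -> R^o}) (s : nat -> R) (CQ D : R) : 2 < p ->
  0 <= CQ -> bounded_by CQ Q -> 0 <= D -> (forall k, 0 <= s k) ->
  (forall K m, exists F : seq nat, [/\ uniq F, forall k, k \in F -> (m <= k)%N,
     \sum_(k <- F) s k <= 2,
     forall e : nat -> bool, `|\sum_(k <- F) (-1) ^+ e k *: y k| <= D &
     1 <= 2 * \sum_(k <- F) psi k (Q (trunc (predC (below K)) (y k)))]) ->
  (forall F : seq nat, uniq F -> forall (e : nat -> bool) x,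
     `|\sum_(k <- F) (-1) ^+ e k * psi k x| <= D * (\sum_(k <- F) s k) `^ 2^-1 * `|x|) ->
  False.
Proof.
move=> p2 CQ0 QC D0 s0 Hy Hpsi.
have step (n : nat) : exists K m (G : seq nat) (b : nat -> Y),
    [/\ uniq G, forall k, k \in G -> (k < m)%N, \sum_(k <- G) s k <= 2 * n%:R,
      (forall e : nat -> bool, `|\sum_(k <- G) (-1) ^+ e k *: b k| `^ p <= n%:R * D `^ p) &
      (forall k, k \in G -> trunc (below K) (b k) = b k) /\
      n%:R <= 4 * \sum_(k <- G) psi k (Q (b k))].
  elim: n => [|n [K [m [G [b [uG Gm Gs GD [bK bn]]]]]]].
    exists 0%N, 0%N, [::], y; split => //.
    - by rewrite big_nil mulr0.
    - by move=> e; rewrite big_nil normr0 powR0// mul0r.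
    - by split => //; rewrite big_nil mulr0.
  have [F [uF Fm Fs FD F1]] := Hy K m.
  pose B k := D * (s k) `^ 2^-1.
  have psiB k x : `|psi k x| <= B k * `|x|.
    have := Hpsi [:: k] isT xpred0 x; rewrite !big_cons !big_nil !addr0.
    by rewrite expr0 mul1r.
  have B0 k : 0 <= B k by rewrite mulr_ge0 ?powR_ge0.
  pose S := 1 + \sum_(k <- F) B k * CQ.
  have S0 : 0 < S by rewrite ltr_pwDl// sumr_ge0// => k _; exact: mulr_ge0.
  (* With tails below [1 / (4 S)], cutting the new block off at [K'] costs at most 1/4 of its
     pairing, which was at least 1/2; this is the origin of the factor 4 in [step]. *)
  have d0 : 0 < (4 * S)^-1 by rewrite invr_gt0 mulr_gt0.
  pose z k := trunc (predC (below K)) (y k).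
  have /choice[J HJ] := fun k => trunc_tail (z k) d0.
  pose K' := maxn K (\max_(k <- F) J k).
  have zK' k : k \in F -> `|z k - trunc (below K') (z k)| <= (4 * S)^-1.
    move=> kF; rewrite -{1}(truncC (below K') (z k)) addrAC subrr add0r.
    apply: HJ; rewrite leq_max; apply/orP; right.
    exact: (@leq_bigmax_seq _ F xpredT J k kF isT).
  have FG k : k \in G -> k \notin F.
    by move=> /Gm km; apply/negP => /Fm; rewrite leqNgt km.
  (* Old vectors live on rows below [K] and new ones on rows from [K] to [K'], so that p-th powers
     of signed sums add. *)
  pose b' k := if k \in F then trunc (below K') (z k) else b k.
  have KK' : (K <= K')%N by exact: leq_maxl.
  exists K', (maxn m (\max_(k <- F) k).+1), (F ++ G), b'; split.
  - rewrite cat_uniq uF uG andbT/=; apply/hasPn => k; exact: FG.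
  - move=> k; rewrite mem_cat => /orP[kF|/Gm km]; rewrite leq_max ?km//.
    by apply/orP; right; rewrite ltnS (@leq_bigmax_seq _ F xpredT id k kF isT).
  - by rewrite big_cat/= -[n.+1%:R]natr1 mulrDr mulr1 addrC lerD.
  - move=> e; rewrite big_cat/=.
    rewrite (eq_big_seq (fun k => (-1) ^+ e k *: trunc (below K') (z k))); last first.
      by move=> k kF; rewrite /b' kF.
    rewrite [X in _ + X](eq_big_seq (fun k => (-1) ^+ e k *: b k)); last first.
      by move=> k kG; rewrite /b' (negPf (FG _ kG)).
    have E1 : \sum_(k <- F) (-1) ^+ e k *: trunc (below K') (z k) =
        trunc (below K') (trunc (predC (below K)) (\sum_(k <- F) (-1) ^+ e k *: y k)).
      by rewrite !linear_sum/=; apply: eq_bigr => k _; rewrite !linearZ.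
    have E2 : \sum_(k <- G) (-1) ^+ e k *: b k = trunc (below K) (\sum_(k <- G) (-1) ^+ e k *: b k).
      by rewrite linear_sum/=; apply: eq_big_seq => k kG; rewrite linearZ/= bK.
    rewrite E1 lpsum_normD; last first.
      move=> i; rewrite E2 !coord_trunc/= /below; case: (ltnP i K) => _; [left|by right].
      by case: ifP.
    rewrite -[n.+1%:R]natr1 mulrDl mul1r addrC lerD//.
    apply: (powR_le (ltW p0)) => //.
    by apply: le_trans (trunc_le _ _) _; apply: le_trans (trunc_le _ _) (FD e).
  split.
    move=> k; rewrite /b' mem_cat => /orP[->|kG].
      exact: trunc_idem.
    rewrite (negPf (FG _ kG)); apply: coordP => i.
    have := congr1 (coord i) (bK k kG); rewrite !coord_trunc /below.
    by case: (ltnP i K') => // Ki; rewrite ltnNge (leq_trans KK' Ki).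
  rewrite big_cat/= mulrDr -[n.+1%:R]natr1 addrC lerD//; last first.
    apply: (le_trans bn); rewrite ler_pM2l// le_eqVlt; apply/orP; left; apply/eqP.
    by apply: eq_big_seq => k kG; rewrite /b' (negPf (FG _ kG)).
  have F2 : \sum_(k <- F) psi k (Q (z k)) - \sum_(k <- F) psi k (Q (b' k)) <= 4^-1.
    rewrite -sumrB; apply: (@le_trans _ _ (\sum_(k <- F) B k * CQ / (4 * S))).
      rewrite big_seq [leRHS]big_seq; apply: ler_sum => k kF; rewrite /b' kF -!linearB/=.
      apply: (le_trans (ler_norm _)); apply: (le_trans (psiB _ _)).
      rewrite -mulrA ler_wpM2l//; apply: (le_trans (QC _)); rewrite ler_wpM2l//.
      exact: zK'.
    rewrite -mulr_suml invfM mulrCA ler_piMr ?invr_ge0//.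
    by rewrite ler_pdivrMr// mul1r /S lerDr.
  move: F1 F2; rewrite -/(z _).
  set u := \sum_(k <- F) psi k (Q (b' k)); set v := \sum_(k <- F) _.
  lra.
have pV : 2^-1 + p^-1 < 1.
  have : p^-1 < 2^-1 by rewrite ltf_pV2 ?posrE// (lt_trans _ p2).
  lra.
have [n Hn] := pow_lt_linear (4 * (D * 2 `^ 2^-1 * (CQ * D))) pV.
have [K [m [G [b [uG _ Gs GD [_ bn]]]]]] := step n.+1.
(* With these signs, one signed functional at one signed vector [Yb] dominates all diagonal pairings
   together. *)
have [e He] := signs_trace (fun k j => psi k (Q (b j))) uG.
pose Yb := \sum_(j <- G) (-1) ^+ e j *: b j.
have E1 : \sum_(k <- G) \sum_(j <- G) (-1) ^+ e k * (-1) ^+ e j * psi k (Q (b j)) =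
    \sum_(k <- G) (-1) ^+ e k * psi k (Q Yb).
  apply: eq_bigr => k _; rewrite /Yb !linear_sum/= mulr_sumr; apply: eq_bigr => j _.
  by rewrite !linearZ/= mulrA.
have n0 : 0 <= n.+1%:R :> R by [].
have YbD : `|Yb| <= n.+1%:R `^ p^-1 * D.
  apply: (powR_le_inv p0); first by rewrite mulr_ge0 ?powR_ge0.
  by rewrite powRM ?powR_ge0// powRVK// GD.
have E2 : \sum_(k <- G) (-1) ^+ e k * psi k (Q Yb) <=
    D * (2 `^ 2^-1 * n.+1%:R `^ 2^-1) * (CQ * (n.+1%:R `^ p^-1 * D)).
  apply: (le_trans (ler_norm _)); apply: (le_trans (Hpsi _ uG e _)).
  apply: ler_pM; rewrite ?mulr_ge0 ?powR_ge0//.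
    rewrite ler_wpM2l// -powRM//.
    by apply: powR_le => //; rewrite sumr_ge0.
  by apply: (le_trans (QC _)); rewrite ler_wpM2l.
rewrite powRD in Hn; last by rewrite [n.+1%:R == 0]gt_eqF ?implybT ?ltr0n.
have h4 : n.+1%:R <= 4 * (D * (2 `^ 2^-1 * n.+1%:R `^ 2^-1) * (CQ * (n.+1%:R `^ p^-1 * D))).
  by apply: (le_trans bn); rewrite ler_pM2l// (le_trans He)// E1.
by move: (lt_le_trans Hn h4); rewrite -subr_gt0 [X in 0 < X](_ : _ = 0) ?ltxx//; ring.
Qed.

End LpSumSequences.

(** * Unit vectors of [X_{p,w}] *)

Section Units.
Context (R : realType) (p : R) (p2 : 2 < p) (w : nat -> R).
Local Notation p1 := (ge1_gt2 p2).
Local Notation X := (Xp p2 w).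
Let p0 : 0 < p. Proof. exact: lt_le_trans p1. Qed.
Let pn0 : p != 0. Proof. by rewrite gt_eqF. Qed.

Lemma psum_support (l : seq nat) (f : nat -> R) K : (forall i, 0 <= f i) ->
  \sum_(i < K) (if (i : nat) \in l then f i else 0) <= \sum_(i <- l) f i.
Proof.
move=> f0; rewrite -(big_mkord xpredT (fun i => if i \in l then f i else 0)).
rewrite -big_mkcond -big_filter; apply: sum_sub => //.
  by rewrite filter_uniq ?iota_uniq.
by move=> i; rewrite mem_filter => /andP[].
Qed.

Lemma xunit_exists k : exists x : X, forall i, xcoord i x = (i == k)%:R.
Proof.
have [|K|K|x [xE _]] := @Xp_exists R p p2 w (fun i => (i == k)%:R) (1 + `|w k|).
- by rewrite addr_ge0.
- have := @psum_support [:: k] (fun=> 1) K (fun=> ler01).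
  rewrite big_cons big_nil addr0 => h.
  apply: (@le_trans _ _ 1); last first.
    by have := @powR_le R p 1 (1 + `|w k|) (ltW p0) ler01; rewrite powR1; apply; rewrite lerDl.
  apply: le_trans h; apply: ler_sum => i _; rewrite inE.
  by case: eqP => _; rewrite ?normr1 ?powR1// normr0 powR0.
- have := @psum_support [:: k] (fun k => (w k) ^+ 2) K (fun=> sqr_ge0 _).
  rewrite big_cons big_nil addr0 => h.
  apply: (@le_trans _ _ (w k ^+ 2)); last first.
    by rewrite -[leLHS]real_normK ?num_real// lerXn2r ?nnegrE ?addr_ge0// lerDr.
  apply: le_trans h; apply: ler_sum => i _; rewrite inE.
  by case: eqP => [->|_]; rewrite ?mulr1// mulr0 expr0n.
by exists x.
Qed.

Definition xunit k : X := sval (cid (xunit_exists k)).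

Lemma xcoord_xunit i k : xcoord i (xunit k) = (i == k)%:R.
Proof. by rewrite /xunit; case: cid. Qed.

Lemma xcoordZ k (a : R) (x : X) : xcoord k (a *: x) = a * (xcoord k x : R).
Proof. by []. Qed.

Lemma Xp_comb_le (l : seq nat) (c : nat -> R) M : uniq l -> 0 <= M ->
  \sum_(k <- l) `|c k| `^ p <= M `^ p -> \sum_(k <- l) (w k * c k) ^+ 2 <= M ^+ 2 ->
  `|\sum_(k <- l) c k *: xunit k| <= M.
Proof.
move=> ul M0 h1 h2.
have E i : xcoord i (\sum_(k <- l) c k *: xunit k) = if i \in l then c i else 0.
  rewrite linear_sum/=; case: ifPn => il.
    rewrite (bigD1_seq i)//= xcoordZ xcoord_xunit eqxx mulr1 big1 ?addr0// => k ki.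
    by rewrite xcoordZ xcoord_xunit eq_sym (negPf ki) mulr0.
  rewrite big1_seq// => k /= kl; rewrite xcoordZ xcoord_xunit.
  by rewrite (_ : i == k = false) ?mulr0//; apply: contraNF il => /eqP->.
apply/Xp_normP => //; split => K.
  apply: le_trans h1; apply: le_trans (psum_support l K (fun i => powR_ge0 `|c i| p)).
  by apply: ler_sum => i _; rewrite E; case: ifP => // _; rewrite normr0 powR0.
apply: le_trans h2; apply: le_trans (psum_support l K (fun i => sqr_ge0 (w i * c i))).
by apply: ler_sum => i _; rewrite E; case: ifP => // _; rewrite mulr0 expr0n.
Qed.

Lemma Xp_l2_sum_le (x : X) (l : seq nat) : uniq l ->
  \sum_(k <- l) (w k * (xcoord k x : R)) ^+ 2 <= `|x| ^+ 2 :> R.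
Proof.
move=> ul; apply: (@le_trans _ _ (`|Xp_l2 p2 w x| ^+ 2)); last first.
  by rewrite lerXn2r ?nnegrE// Xp_l2_le.
have := lpsum_sum_le (Xp_l2 p2 w x) ul; rewrite powR_mulrn//; apply: le_trans.
apply: ler_sum => k _; by rewrite Xp_l2E powR_mulrn// real_normK ?num_real.
Qed.

Lemma abs_le_sqrt (x A B : R) : 0 <= A -> 0 <= B -> x ^+ 2 <= A * B ^+ 2 ->
  `|x| <= A `^ 2^-1 * B.
Proof.
move=> A0 B0 h; rewrite powR12_sqrt//.
rewrite -(@ler_pXn2r _ 2)// ?nnegrE ?mulr_ge0 ?sqrtr_ge0//.
by rewrite exprMn sqr_sqrtr// real_normK ?num_real.
Qed.

Lemma norm_signZ (V : normedModType R) (b : bool) (x : V) : `|(-1) ^+ b *: x| = `|x|.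
Proof. by rewrite normrZ normrX normrN1 expr1n mul1r. Qed.

End Units.

(** * The negative statements (d), (g) and (f) *)

Section BpNotComplementedInSum.
Context (R : realType) (p : R) (p2 : 2 < p).
Local Notation p1 := (ge1_gt2 p2).
Local Notation Z := (lpsum_ell2 p1).
Let p0 : 0 < p. Proof. exact: lt_le_trans p1. Qed.
Let pn0 : p != 0. Proof. by rewrite gt_eqF. Qed.
Let E N := Xp p2 (vseq p N.+1).

Definition bunit N k : Bp p2 := @lpinj R p p1 E N (xunit p2 (vseq p N.+1) k).

Lemma bunit_le1 N k : `|bunit N k| <= 1.
Proof.
rewrite lpinj_norm; have := @Xp_comb_le R p p2 (vseq p N.+1) [:: k] (fun=> 1) 1 isT ler01.
rewrite !big_cons !big_nil !addr0 normr1 !powR1 expr1n mulr1 scale1r; apply => //.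
by rewrite expr_le1// ?vseq_le1// ltW// vseq_gt0.
Qed.

(** For [N.+1] unit vectors both parts of the norm equal the p-th root of [N.+1], again by
    [vseq_balance]. *)
Lemma bunit_sum_le N (l : seq nat) (e : nat -> bool) : uniq l -> size l = N.+1 ->
  `|\sum_(k <- l) (-1) ^+ e k *: bunit N k| `^ p <= N.+1%:R.
Proof.
move=> ul sl; pose a : R := N.+1%:R^-1 `^ p^-1.
have a0 : 0 < a by rewrite powR_gt0// invr_gt0.
have M0 : 0 <= a^-1 by rewrite invr_ge0 ltW.
have Mp : a^-1 `^ p = N.+1%:R.
  rewrite -powR_inv1 ?(ltW a0)// -powRrM mulN1r powRN vseq_power// invrK//.
have -> : \sum_(k <- l) (-1) ^+ e k *: bunit N k =
    @lpinj R p p1 E N (\sum_(k <- l) (-1) ^+ e k *: xunit p2 (vseq p N.+1) k).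
  by rewrite linear_sum/=; apply: eq_bigr => k _; rewrite linearZ.
rewrite lpinj_norm -Mp; apply: (powR_le (ltW p0)) => //; apply: Xp_comb_le => //.
  rewrite (eq_bigr (fun=> 1)) => [|k _]; last by rewrite normrX normrN1 expr1n powR1.
  by rewrite big_const_seq count_predT iter_addr_0 sl Mp.
rewrite (eq_bigr (fun=> (vseq p N.+1 0) ^+ 2)) => [|k _]; last first.
  by rewrite exprMn sqrr_sign mulr1.
rewrite big_const_seq count_predT iter_addr_0 sl.
have := vseq_balance p2 N; rewrite exprMn mulrA -/a => h.
have := congr1 (fun x => x * a^-1 ^+ 2) h; rewrite mul1r exprVn mulfK ?expf_neq0 ?gt_eqF//.
by rewrite -[leLHS]mulr_natl => ->.
Qed.

(** Take [N.+1] images whose first [K] row norms nearly agree. Some signed sum is on these rows at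
    least [(N+1)^(1/2)] times the common row norms, while its norm is at most [CT (N+1)^(1/p)]; the
    quotient of the powers is the weight. It matters that the bound is free of [K]. *)
Lemma small_rows (T : {linear Bp p2 -> Z}) (CT : R) N K m : 0 < CT -> bounded_by CT T ->
  exists2 j, (m <= j)%N &
    `|trunc (below K) (T (bunit N j))| <= 4 * (CT * vseq p N.+1 0).
Proof.
move=> CT0 TC; pose c : R := vseq p N.+1 0; have c0 : 0 < c by exact: vseq_gt0.
pose A := CT * c; have A0 : 0 < A by exact: mulr_gt0.
pose a j i : R := `|coord i (T (bunit N j))|.
have a_le j i : `|a j i| <= CT.
  rewrite normr_id; apply: le_trans (coord_le _ _) _; apply: le_trans (TC _) _.
  by rewrite ler_piMr ?(ltW CT0)// bunit_le1.
have [lim Hlim] := cluster_seq a_le.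
(* A tolerance per row whose [l^p]-norm over [K] rows is at most [A]. *)
pose d := A / K.+1%:R `^ p^-1.
have d0 : 0 < d by rewrite divr_gt0// powR_gt0.
have d20 : 0 < d / 2 by rewrite divr_gt0.
have [l [ul sl lm lP]] := infinitely_list (fun m => Hlim K m _ d20) N.+1 m.
case: l => // j0 l' in ul sl lm lP *; set l := j0 :: l' in ul sl lm lP *.
have j0l : j0 \in l by rewrite mem_head.
exists j0; first exact: lm.
(* A lower bound for row [i] shared by all selected vectors, each of which is within [d / 2] of the
   limit. *)
pose b i : R := Num.max 0 (a j0 i - d).
have b0 i : 0 <= b i by rewrite le_max lexx.
have ab k i : k \in l -> (i < K)%N -> b i <= a k i.
  move=> kl iK; rewrite ge_max normr_ge0/=.
  have := lP _ kl i iK; have := lP _ j0l i iK; rewrite !ler_norml; lra.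
have s1 : 1 <= p / 2 by rewrite ler_pdivlMr// mul1r ltW.
have sqp (x : R) : 0 <= x -> (x ^+ 2) `^ (p / 2) = x `^ p.
  by move=> x0; rewrite -powR_mulrn// -powRrM mulrCA mulfV ?mulr1.
have [e He] := @signs_lower R (fun=> ell2 R) (fun=> @ell2_parallelogram R) nat (p / 2) s1
  (fun k i => coord i (T (bunit N k))) K l ul.
have up : \sum_(i < K) (`|\sum_(k <- l) (-1) ^+ e k *: coord i (T (bunit N k))| ^+ 2) `^ (p / 2)
    <= CT `^ p * N.+1%:R.
  apply: (@le_trans _ _ (`|T (\sum_(k <- l) (-1) ^+ e k *: bunit N k)| `^ p)).
    apply: le_trans (lpsum_psum_le _ K); apply: ler_sum => i _; rewrite sqp//.
    rewrite !linear_sum/= le_eqVlt; apply/orP; left; apply/eqP; congr (`|_| `^ _).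
    by apply: eq_bigr => k _; rewrite !linearZ.
  apply: (@le_trans _ _ ((CT * `|\sum_(k <- l) (-1) ^+ e k *: bunit N k|) `^ p)).
    by apply: (powR_le (ltW p0)) => //; exact: TC.
  rewrite powRM ?(ltW CT0)// ler_wpM2l ?powR_ge0//.
  exact: bunit_sum_le.
have low : N.+1%:R `^ (p / 2) * \sum_(i < K) b i `^ p <=
    \sum_(i < K) (\sum_(k <- l) `|coord i (T (bunit N k))| ^+ 2) `^ (p / 2).
  rewrite mulr_sumr; apply: ler_sum => i _; rewrite -sqp// -powRM ?sqr_ge0//.
  apply: (powR_le (le_trans ler01 s1)); rewrite ?mulr_ge0 ?sqr_ge0//.
  rewrite -sl mulr_natl.
  have <- : \sum_(k <- l) b i ^+ 2 = b i ^+ 2 *+ size l.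
    by rewrite big_const_seq count_predT iter_addr_0.
  rewrite big_seq [leRHS]big_seq; apply: ler_sum => k kl.
  by rewrite lerXn2r ?nnegrE ?normr_ge0//; exact: (ab _ _ kl (ltn_ord i)).
have n0 : 0 < N.+1%:R :> R by rewrite ltr0n.
have cp : c `^ p = N.+1%:R / N.+1%:R `^ (p / 2).
  rewrite /c /vseq -powRrM -powR_inv1 ?(ltW n0)// -powRrM -powRN.
  rewrite -{2}(powRr1 (ltW n0)) -powRD; last by rewrite (gt_eqF n0) implybT.
  congr (_ `^ _); field; rewrite pn0 /=; lra.
have bsum : \sum_(i < K) b i `^ p <= A `^ p.
  rewrite powRM ?(ltW CT0) ?(ltW c0)// cp mulrA ler_pdivlMr ?powR_gt0// mulrC.
  by apply: (le_trans low); apply: le_trans up.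
have two : 2 `^ p * 2 <= 4 `^ p :> R.
  have -> : 4 = 2 * 2 :> R by ring.
  by rewrite powRM// ler_pM2l ?powR_gt0// le1r_powR// ?ler1n// p1.
apply: (powR_le_inv p0); first by rewrite !mulr_ge0 ?(ltW CT0) ?(ltW c0).
rewrite -/c -/A powRM ?(ltW A0)// trunc_lt_norm.
apply: le_trans (ler_wpM2r (powR_ge0 _ _) two); rewrite -mulrA.
apply: (@le_trans _ _ (\sum_(i < K) 2 `^ p * (b i `^ p + d `^ p))).
  apply: ler_sum => i _; rewrite -/(a j0 i).
  (* [a <= b + d <= 2 max(b, d)]; with [2^p * 2 <= 4^p] this accounts for the factor 4. *)
  pose M := Num.max (b i) d.
  have M0 : 0 <= M by rewrite le_max b0.
  have aM : a j0 i <= 2 * M.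
    have h1 : a j0 i - d <= b i by rewrite le_max lexx orbT.
    have h2 : b i <= M by rewrite le_max lexx.
    have h3 : d <= M by rewrite le_max lexx orbT.
    lra.
  apply: (@le_trans _ _ ((2 * M) `^ p)); first by apply: (powR_le (ltW p0)) => //; exact: normr_ge0.
  rewrite powRM// ler_wpM2l ?powR_ge0// /M; case: (leP (b i) d) => _.
    by rewrite lerDr powR_ge0.
  by rewrite lerDl powR_ge0.
rewrite -mulr_sumr ler_wpM2l ?powR_ge0// big_split/= mulr_natl mulr2n lerD//.
have dA : A `^ p = d `^ p * K.+1%:R.
  have K0 : 0 < K.+1%:R `^ p^-1 :> R by exact: powR_gt0.
  have KE : K.+1%:R = (K.+1%:R `^ p^-1) `^ p :> R by rewrite powRVK.
  by rewrite [X in _ = _ * X]KE -(powRM _ (ltW d0) (ltW K0)) divfK ?gt_eqF.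
by rewrite sumr_const card_ord -[leLHS]mulr_natr dA ler_wpM2l ?powR_ge0// ler_nat.
Qed.

Lemma not_retract_Bp_sum_ell2 : ~ retract (Bp p2) Z.
Proof.
move=> [T [Q [C [C0 TC QC TQ]]]].
have th : 0 < (p - 2) / (2 * p) by rewrite divr_gt0 ?subr_gt0// mulr_gt0.
(* The weight of summand [N] is so small that the rows below any [K] contribute at most half of a
   diagonal pairing equal to 1. *)
have [N HN] := @pow_unbounded R ((p - 2) / (2 * p)) (8 * C * C) th.
pose c : R := vseq p N.+1 0; have c0 : 0 < c by exact: vseq_gt0.
have cV : c^-1 = N.+1%:R `^ ((p - 2) / (2 * p)).
  apply: (mulfI (lt0r_neq0 c0)); rewrite mulfV ?lt0r_neq0//.
  by rewrite /c /vseq -powRM ?invr_ge0// mulVf ?powR1.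
have cC : C * (4 * (C * c)) <= 2^-1.
  have : 8 * C * C * c <= 1 by rewrite -ler_pdivlMr// mul1r cV ltW.
  lra.
pose f k (x : Bp p2) : R^o := xcoord k (coord N x).
have lf k : linear (f k) by move=> a x y; rewrite /f !linearP.
have f1 k x : `|f k x| <= `|x| by apply: le_trans (xcoord_le _ _) (coord_le _ _).
(* Blocks are single vectors. In [D = C + c^-1], [C] bounds the images, and [c^-1] bounds the signed
   coordinate functionals through the weighted [l^2]-norm. *)
apply: (@block_trace R p p1 (fun=> ell2 R) (Bp p2) Q (fun k => T (bunit N k))
  (fun k => mklin (lf k)) (fun=> 1) C (C + c^-1)) => //.
- exact: ltW.
- by rewrite addr_ge0 ?invr_ge0 ?(ltW C0) ?(ltW c0).
- move=> K m; have [j mj jK] := small_rows N K m C0 TC.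
  exists [:: j]; split => //.
  + by move=> k; rewrite inE => /eqP->.
  + by rewrite big_cons big_nil addr0 ler1n.
  + move=> e; rewrite big_cons big_nil addr0 norm_signZ (le_trans (TC _))//.
    rewrite (@le_trans _ _ C)// ?lerDl ?invr_ge0 ?(ltW c0)//.
    by rewrite ler_piMr ?(ltW C0)// bunit_le1.
  + rewrite big_cons big_nil addr0 /=.
    have E1 : f j (Q (T (bunit N j))) = 1.
      by rewrite TQ /f /bunit coord_inj xcoord_xunit eqxx.
    have : f j (Q (T (bunit N j))) = f j (Q (trunc (below K) (T (bunit N j))))
        + f j (Q (trunc (predC (below K)) (T (bunit N j)))).
      by rewrite -{1}(truncC (below K) (T (bunit N j))) linearD /f !linearD.
    rewrite E1 => h.
    have h2 : f j (Q (trunc (below K) (T (bunit N j)))) <= 2^-1.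
      apply: (le_trans (ler_norm _)); apply: (le_trans (f1 _ _)).
      apply: (le_trans (QC _)); apply: le_trans cC; by rewrite ler_pM2l.
    move: h h2; set u := f j _; set v := f j _; lra.
- move=> F uF e x.
  apply: (@le_trans _ _ ((\sum_(k <- F) 1) `^ 2^-1 * (c^-1 * `|x|))); last first.
    rewrite mulrCA mulrA ler_wpM2r// ler_wpM2r ?powR_ge0//.
    by rewrite lerDr ltW.
  apply: abs_le_sqrt; rewrite ?sumr_ge0 ?mulr_ge0 ?invr_ge0 ?(ltW c0)//=.
  apply: le_trans (cauchy_schwarz _ _ _) _; rewrite (eq_bigr (fun=> 1)) => [|k _]; last exact: sqrr_sign.
  rewrite ler_wpM2l ?sumr_ge0// exprMn exprVn ler_pdivlMl ?exprn_gt0//.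
  apply: (@le_trans _ _ (`|coord N x| ^+ 2)); last by rewrite lerXn2r ?nnegrE ?coord_le.
  apply: le_trans (Xp_l2_sum_le (coord N x) uF); rewrite mulr_sumr.
  by apply: ler_sum => k _; rewrite exprMn.
Qed.

End BpNotComplementedInSum.

(** * [X_p] is not complemented in [B_p] *)

Section XpNotComplementedInBp.
Context (R : realType) (p : R) (p2 : 2 < p) (w : nat -> R)
  (w0 : forall n, 0 < w n).
Local Notation p1 := (ge1_gt2 p2).
Local Notation X := (Xp p2 w).
Let p0 : 0 < p. Proof. exact: lt_le_trans p1. Qed.
Let pn0 : p != 0. Proof. by rewrite gt_eqF. Qed.
Let p20 : 0 < p - 2. Proof. by rewrite subr_gt0. Qed.

(** The term of the series in [condition_star]. For the n-th unit vector times [beta n], the p-th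
    power of the [l^p]-part and the square of the weighted [l^2]-part both equal [t n]. The n-th
    coordinate times [gamma n] takes the value [t n] there, and the square of its norm for the
    weighted [l^2]-part is [t n]. *)
Let t n : R := w n `^ (2 * p / (p - 2)).
Let beta n : R := w n `^ (2 / (p - 2)).
Let gamma n : R := t n / beta n.

Let t_gt0 n : 0 < t n. Proof. exact: powR_gt0. Qed.
Let beta_gt0 n : 0 < beta n. Proof. exact: powR_gt0. Qed.

Let beta_pow n : beta n `^ p = t n.
Proof. by rewrite -powRrM; congr (_ `^ _); field; rewrite gt_eqF. Qed.

Let w_beta n : (w n * beta n) ^+ 2 = t n.
Proof.
rewrite -{1}(powRr1 (ltW (w0 n))) /beta -powRD; last by rewrite (gt_eqF (w0 n)) implybT.
by rewrite -powR_mulrn ?powR_ge0// -powRrM; congr (_ `^ _); field; rewrite gt_eqF.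
Qed.

Let gamma_beta n : gamma n * beta n = t n.
Proof. by rewrite /gamma divfK// gt_eqF. Qed.

Let gamma_w n : (gamma n / w n) ^+ 2 = t n.
Proof.
have : t n != 0 by rewrite gt_eqF.
rewrite /gamma -(w_beta n) => h; field.
by rewrite (gt_eqF (w0 n)) (gt_eqF (beta_gt0 n)).
Qed.

Let gamma_sq n : gamma n ^+ 2 = t n * w n ^+ 2.
Proof. by rewrite -gamma_w -exprMn divfK// gt_eqF. Qed.

(** Terms with small weights are collected until their sum first reaches 1; the last one is at most
    1 because [w n < e <= 1]. *)
Lemma star_block (e : R) (m : nat) : condition_star p w -> 0 < e <= 1 ->
  exists F : seq nat, [/\ uniq F, forall n, n \in F -> (m <= n)%N,
    forall n, n \in F -> w n < e & 1 <= \sum_(n <- F) t n <= 2].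
Proof.
move=> star /andP[e0 e1].
pose S L := \sum_(m <= n < L | w n < e) t n.
have [L HL] : exists L, 1 <= S L.
  apply/not_existsP => H.
  have := star e e0; suff : (\sum_(n <oo | (w n < e)%R) (t n)%:E <= (\sum_(0 <= n < m | w n < e) t n + 1)%R%:E)%E.
    by move=> + E1; rewrite E1 leye_eq.
  apply: lime_le.
    by apply: is_cvg_nneseries_cond => n _ _; rewrite lee_fin ltW.
  apply: nearW => L; rewrite sumEFin lee_fin.
  have [Lm|mL] := leqP L m.
    rewrite (big_cat_nat (leq0n _) Lm)//= -addrA lerDl addr_ge0//.
    by rewrite sumr_ge0// => n _; rewrite ltW.
  rewrite (big_cat_nat (leq0n _) (ltnW mL))//= lerD2l ltW// ltNge.
  exact/negP/H.
have exL : exists L, 1 <= S L by exists L.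
case: (ex_minnP exL) => {HL exL}L HL Lmin.
exists [seq n <- index_iota m L | w n < e]; split.
- by rewrite filter_uniq// iota_uniq.
- by move=> n; rewrite mem_filter mem_index_iota => /and3P[].
- by move=> n; rewrite mem_filter => /andP[].
rewrite big_filter HL/=; case: L HL Lmin => [|L] HL Lmin.
  by rewrite big_geq// ler0n.
have SL : S L < 1 by rewrite ltNge; apply/negP => /Lmin; rewrite ltnn.
have [mL|Lm] := leqP m L; last by rewrite big_geq// ler0n.
rewrite big_mkcond big_nat_recr//= -big_mkcond/=.
have : (if w L < e then t L else 0) <= 1.
  case: ifP => // wLe; have ex0 : 0 <= 2 * p / (p - 2) by rewrite divr_ge0 ?mulr_ge0 ?(ltW p0) ?(ltW p20).
  have := powR_le ex0 (ltW (w0 L)) (ltW (lt_le_trans wLe e1)).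
  by rewrite powR1.
rewrite -/(S L); move: SL; set a := S L; set b := if _ then _ else _; lra.
Qed.

Let comb_le (F : seq nat) (e : nat -> bool) : uniq F -> \sum_(n <- F) t n <= 2 ->
  `|\sum_(n <- F) ((-1) ^+ e n * beta n) *: xunit p2 w n| <= 2.
Proof.
move=> uF F2; apply: Xp_comb_le => //.
  rewrite (eq_bigr t) => [|n _]; last first.
    by rewrite normrM normrX normrN1 expr1n mul1r gtr0_norm.
  by apply: (le_trans F2); rewrite le1r_powR// ?ler1n// p1.
rewrite (eq_bigr t) => [|n _]; last by rewrite mulrCA exprMn sqrr_sign mul1r.
apply: (le_trans F2); nra.
Qed.

(** Finitely many summands of [B_p] are Hilbertian: for the constant weight [v i] the norm is at
    most [(v i)^-1] times the weighted [l^2]-part. Bounded signed sums then have square summable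
    heads, uniformly in [F]. *)
Lemma rows_hilbert (T : {linear X -> Bp p2}) (CT : R) K : 0 < CT -> bounded_by CT T ->
  exists2 CK, 0 <= CK & forall F, uniq F -> \sum_(n <- F) t n <= 2 ->
    \sum_(n <- F) (beta n * `|trunc (below K) (T (xunit p2 w n))|) ^+ 2 <= CK.
Proof.
move=> CT0 TC; pose v i : R := vseq p i.+1 0.
have v0 i : 0 < v i by exact: vseq_gt0.
pose L i := Xp_l2 p2 (vseq p i.+1).
have LN i (x : Xp p2 (vseq p i.+1)) : `|x| <= (v i)^-1 * `|L i x|.
  have M0 : 0 <= (v i)^-1 * `|L i x| by rewrite mulr_ge0 ?invr_ge0 ?(ltW (v0 i)).
  apply/Xp_normP => //; split => k.
    rewrite powRM ?invr_ge0 ?(ltW (v0 i))//.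
    apply: le_trans (ler_wpM2l (powR_ge0 _ _) (ell2_lp (L i x) k (ltW p2))).
    rewrite mulr_sumr; apply: ler_sum => j _; rewrite -powRM ?invr_ge0 ?(ltW (v0 i))//.
    rewrite /L Xp_l2E normrM (gtr0_norm (v0 i)) mulrA mulVf ?mul1r//.
    by rewrite gt_eqF.
  apply: (@le_trans _ _ (`|L i x| ^+ 2)).
    apply: le_trans (ell2_psum (L i x) k); apply: ler_sum => j _.
    by rewrite /L Xp_l2E.
  by rewrite lerXn2r ?nnegrE// ler_peMl// invf_ge1// vseq_le1.
pose S := \sum_(i < K) (v i)^-1 ^+ 2.
have S0 : 0 <= S by rewrite sumr_ge0// => i _; exact: sqr_ge0.
exists (S * (K%:R * (CT * 2) ^+ 2)).
  by apply: mulr_ge0 => //; apply: mulr_ge0 => //; exact: sqr_ge0.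
move=> F uF F2.
pose g n i := beta n *: L i (coord i (T (xunit p2 w n))).
have [e He] := @signs_lower R (fun=> ell2 R) (fun=> @ell2_parallelogram R) nat 1
  (lexx _) g K F uF.
apply: (@le_trans _ _ (S * \sum_(n <- F) \sum_(i < K) `|g n i| ^+ 2)).
  rewrite mulr_sumr; apply: ler_sum => n _.
  apply: le_trans (cauchy_schwarz _ _ _); rewrite lerXn2r ?nnegrE//.
  - by rewrite mulr_ge0// ltW.
  - by rewrite sumr_ge0// => i _; rewrite mulr_ge0 ?invr_ge0 ?(ltW (v0 i)).
  rewrite trunc_inj; apply: (@le_trans _ _ (beta n * \sum_(i < K) `|coord i (T (xunit p2 w n))|)).
    rewrite ler_wpM2l ?(ltW (beta_gt0 n))// (le_trans (ler_norm_sum _ _ _))//.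
    by apply: ler_sum => i _; rewrite lpinj_norm.
  rewrite mulr_sumr; apply: ler_sum => i _.
  rewrite /g normrZ (gtr0_norm (beta_gt0 n)) [leRHS]mulrCA (ler_pM2l (beta_gt0 n)).
  exact: (LN i (coord i (T (xunit p2 w n)))).
rewrite ler_wpM2l// exchange_big/=.
rewrite (eq_bigr (fun i : 'I_K => (\sum_(n <- F) `|g n i| ^+ 2) `^ 1)) => [|i _]; last first.
  by rewrite powRr1// sumr_ge0// => n _; exact: sqr_ge0.
apply: (le_trans He); apply: (@le_trans _ _ (\sum_(i < K) (CT * 2) ^+ 2)); last first.
  by rewrite sumr_const card_ord mulr_natl.
apply: ler_sum => i _; rewrite powRr1 ?sqr_ge0// lerXn2r ?nnegrE ?mulr_ge0 ?(ltW CT0)//.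
have -> : \sum_(n <- F) (-1) ^+ e n *: g n i =
   L i (coord i (T (\sum_(n <- F) ((-1) ^+ e n * beta n) *: xunit p2 w n))).
  rewrite !linear_sum/=; apply: eq_bigr => n _; by rewrite /g scalerA !linearZ.
apply: le_trans (Xp_l2_le _) _; apply: le_trans (coord_le _ _) _.
by apply: le_trans (TC _) _; rewrite ler_pM2l// comb_le.
Qed.

Lemma not_retract_Xp_Bp : condition_star p w -> ~ retract X (Bp p2).
Proof.
move=> star [T [Q [C [C0 TC QC TQ]]]].
pose psi n (x : X) : R^o := gamma n * (xcoord n x : R).
have lpsi n : linear (psi n).
  move=> a x y; rewrite /psi linearP/= mulrDr; congr (_ + _); exact: mulrCA.
have gamma0 n : 0 <= gamma n by rewrite divr_ge0 ?(ltW (t_gt0 n)) ?(ltW (beta_gt0 n)).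
apply: (@block_trace R p p1 (fun N => Xp p2 (vseq p N.+1)) X Q
  (fun n => beta n *: T (xunit p2 w n)) (fun n => mklin (lpsi n)) t C (C * 2 + 1)) => //.
- exact: ltW.
- by rewrite addr_ge0 ?mulr_ge0 ?(ltW C0).
- by move=> k; rewrite ltW.
- move=> K m; have [CK CK0 HCK] := rows_hilbert K C0 TC.
  (* Cauchy-Schwarz bounds the contribution of the heads by [C] times the root of [CK] times the sum
     of [gamma^2 = t w^2], which is at most [t e] for weights below [e <= 1]. With [e = 1 / (1 + D)]
     this is at most 1/2. *)
  pose D := 8 * CK * C ^+ 2.
  have D0 : 0 <= D := mulr_ge0 (mulr_ge0 (ler0n R 8) CK0) (sqr_ge0 C).
  have e01 : 0 < (1 + D)^-1 <= 1 by rewrite invr_gt0 ltr_pwDl//= invf_le1 ?ltr_pwDl// lerDl.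
  have [F [uF Fm Fw /andP[F1 F2]]] := star_block m star e01.
  exists F; split => //.
    move=> e; have -> : \sum_(k <- F) (-1) ^+ e k *: (beta k *: T (xunit p2 w k)) =
       T (\sum_(n <- F) ((-1) ^+ e n * beta n) *: xunit p2 w n).
      by rewrite linear_sum; apply: eq_bigr => n _; rewrite scalerA [RHS]linearZ.
    apply: (le_trans (TC _)); apply: (@le_trans _ _ (C * 2)); last by rewrite lerDl.
    by rewrite ler_pM2l// comb_le.
  pose z n := trunc (below K) (T (xunit p2 w n)).
  have E1 n : psi n (Q (trunc (predC (below K)) (beta n *: T (xunit p2 w n)))) =
      t n - gamma n * beta n * (xcoord n (Q (z n)) : R).
    rewrite linearZ/= linearZ/= /psi xcoordZ.
    have := TQ (xunit p2 w n); rewrite -{1}(truncC (below K) (T (xunit p2 w n))) linearD/=.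
    move=> /(congr1 (xcoord n)); rewrite linearD/= xcoord_xunit eqxx => h.
    have -> : xcoord n (Q (trunc (predC (below K)) (T (xunit p2 w n)))) = 1 - (xcoord n (Q (z n)) : R) :> R.
      by apply/eqP; rewrite eq_sym subr_eq eq_sym addrC; apply/eqP.
    by rewrite mulrA mulrBr mulr1 gamma_beta.
  rewrite (eq_bigr (fun n => t n - gamma n * beta n * (xcoord n (Q (z n)) : R))) => [|n _]; last exact: E1.
  rewrite sumrB.
  suff h : \sum_(n <- F) gamma n * beta n * (xcoord n (Q (z n)) : R) <= 2^-1.
    move: F1 h; set a := \sum_(n <- F) t n; set b := \sum_(n <- F) _; lra.
  apply: (@le_trans _ _ (C * \sum_(n <- F) gamma n * (beta n * `|z n|))).
    rewrite mulr_sumr; apply: ler_sum => n _; rewrite -mulrA [leRHS]mulrCA ler_wpM2l//.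
    rewrite [leRHS]mulrCA ler_wpM2l ?(ltW (beta_gt0 n))//.
    apply: (le_trans (ler_norm _)); apply: (le_trans (xcoord_le _ _)); exact: QC.
  set S := \sum_(n <- F) _.
  have S0 : 0 <= S.
    rewrite sumr_ge0// => n _.
    exact: (mulr_ge0 (gamma0 n) (mulr_ge0 (ltW (beta_gt0 n)) (normr_ge0 _))).
  have S2 : S ^+ 2 <= 2 * (1 + D)^-1 * CK.
    apply: (le_trans (cauchy_schwarz _ _ _)).
    apply: ler_pM; [by rewrite sumr_ge0// => n _; exact: sqr_ge0|
      by rewrite sumr_ge0// => n _; exact: sqr_ge0| |exact: HCK].
    apply: (@le_trans _ _ (\sum_(n <- F) t n * (1 + D)^-1)); last first.
      by rewrite -mulr_suml ler_wpM2r ?invr_ge0 ?addr_ge0.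
    rewrite big_seq [leRHS]big_seq; apply: ler_sum => n nF.
    rewrite gamma_sq ler_wpM2l ?(ltW (t_gt0 n))//.
    have /andP[e0 e1] := e01; have := Fw n nF; have := w0 n.
    set d := (1 + D)^-1 in e0 e1 *; set x := w n; nra.
  rewrite -(@ler_pXn2r _ 2)// ?nnegrE ?mulr_ge0 ?(ltW C0) ?invr_ge0// exprMn.
  apply: (@le_trans _ _ (C ^+ 2 * (2 * (1 + D)^-1 * CK))); first by rewrite ler_wpM2l// sqr_ge0.
  have -> : C ^+ 2 * (2 * (1 + D)^-1 * CK) = (D / (1 + D)) / 4.
    by rewrite /D; field; rewrite gt_eqF// ltr_pwDl.
  have : D / (1 + D) <= 1 by rewrite ler_pdivrMr ?ltr_pwDl// mul1r lerDr.
  lra.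
- move=> F uF e x.
  apply: (@le_trans _ _ ((\sum_(k <- F) t k) `^ 2^-1 * `|x|)); last first.
    rewrite ler_wpM2r// ler_peMl ?powR_ge0// lerDr mulr_ge0// ltW//.
  have t0 : 0 <= \sum_(k <- F) t k by rewrite sumr_ge0// => k _; rewrite ltW.
  apply: abs_le_sqrt => //=.
  rewrite (eq_bigr (fun k => ((-1) ^+ e k * (gamma k / w k)) * (w k * (xcoord k x : R)))) => [|k _]; last first.
    by rewrite /psi; field; rewrite gt_eqF.
  apply: (le_trans (cauchy_schwarz _ _ _)).
  have -> : \sum_(i <- F) ((-1) ^+ e i * (gamma i / w i)) ^+ 2 = \sum_(i <- F) t i.
    by apply: eq_bigr => k _; rewrite exprMn sqrr_sign mul1r gamma_w.
  rewrite ler_wpM2l//; exact: Xp_l2_sum_le.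
Qed.

End XpNotComplementedInBp.

(** * [B_p] does not embed into [X_p] *)

Section BpNotInXp.
Context (R : realType) (p : R) (p2 : 2 < p).
Local Notation p1 := (ge1_gt2 p2).
Local Notation Z := (lpsum_ell2 p1).
Let p0 : 0 < p. Proof. exact: lt_le_trans p1. Qed.
Let pn0 : p != 0. Proof. by rewrite gt_eqF. Qed.

Definition eunit k : ell2 R := @lpinj R 2 (ler1n R 2) (fun=> R) k (1 : R).

(** [f] is tested on the vector whose entries are its own values at the unit vectors. *)
Lemma ell2_bessel (f : {linear ell2 R -> R^o}) (C : R) (l : seq nat) : 0 <= C ->
  bounded_by C f -> uniq l -> \sum_(k <- l) (f (eunit k) : R) ^+ 2 <= C ^+ 2.
Proof.
move=> C0 fC ul; set A := \sum_(k <- l) _.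
have A0 : 0 <= A by rewrite sumr_ge0// => k _; exact: sqr_ge0.
pose x : ell2 R := \sum_(k <- l) @lpinj R 2 (ler1n R 2) (fun=> R) k (f (eunit k) : R).
have x2 : `|x| ^+ 2 = A.
  have := @lpsum_sum_inj R 2 (ler1n R 2) (fun=> R) l (fun k => (f (eunit k) : R)) ul.
  rewrite powR_mulrn// -/x => ->; apply: eq_bigr => k _.
  by rewrite powR_mulrn// real_normK ?num_real.
have fx : f x = A.
  rewrite linear_sum/=; apply: eq_bigr => k _.
  have -> : @lpinj R 2 (ler1n R 2) (fun=> R) k (f (eunit k) : R) = (f (eunit k) : R) *: eunit k.
    rewrite -linearZ/=; congr lpinj; by rewrite [RHS]mulr1.
  by rewrite linearZ.
have h := fC x; rewrite fx ger0_norm// in h.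
have [->|An0] := eqVneq A 0; first exact: sqr_ge0.
have Ap : 0 < A by rewrite lt_neqAle eq_sym An0.
rewrite -(ler_pM2r Ap) -{3}x2 -exprMn -expr2 lerXn2r ?nnegrE//.
by rewrite mulr_ge0.
Qed.

(** By Bessel the first [K] coordinates of the [S (eunit k)] are square summable over [k], so they
    cannot all stay large along a long enough run of indices. *)
Lemma ell2_null (S : {linear ell2 R -> lpsum p1 (fun=> R)}) (C : R) K m d :
  0 <= C -> bounded_by C S -> 0 < d ->
  exists2 k, (m <= k)%N & `|trunc (below K) (S (eunit k))| <= d.
Proof.
move=> C0 SC d0; pose f i (x : ell2 R) : R^o := coord i (S x).
have lf i : linear (f i) by move=> a x y; rewrite /f !linearP.
have fC i : bounded_by C (mklin (lf i)) by move=> x; apply: le_trans (coord_le _ _) (SC x).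
pose h := d ^+ 2 / K.+1%:R; have h0 : 0 < h by rewrite divr_gt0// exprn_gt0.
have [k mk kh] : exists2 k, (m <= k)%N & \sum_(i < K) (f i (eunit k) : R) ^+ 2 <= h.
  apply/not_exists2P => H.
  pose n := (Num.trunc (K%:R * C ^+ 2 / h)).+1.
  have nh : K%:R * C ^+ 2 < n%:R * h.
    by rewrite -ltr_pdivrMr// truncnS_gt.
  have h1 : n%:R * h <= \sum_(k <- iota m n) \sum_(i < K) (f i (eunit k) : R) ^+ 2.
    have -> : n%:R * h = \sum_(k <- iota m n) h.
      by rewrite big_const_seq count_predT iter_addr_0 size_iota mulr_natl.
    rewrite big_seq [leRHS]big_seq; apply: ler_sum => k; rewrite mem_iota => /andP[mk _].
    by have [//|/negP] := H k; rewrite -ltNge => /ltW.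
  have h2 : \sum_(k <- iota m n) \sum_(i < K) (f i (eunit k) : R) ^+ 2 <= K%:R * C ^+ 2.
    rewrite exchange_big/=; apply: (@le_trans _ _ (\sum_(i < K) C ^+ 2)).
      apply: ler_sum => i _; exact: (ell2_bessel C0 (fC i) (iota_uniq m n)).
    by rewrite sumr_const card_ord mulr_natl.
  by have := lt_le_trans nh (le_trans h1 h2); rewrite ltxx.
exists k => //; rewrite trunc_inj.
rewrite -(@ler_pXn2r _ 2)// ?nnegrE ?(ltW d0)//.
apply: (@le_trans _ _ ((\sum_(i < K) 1 * `|f i (eunit k)|) ^+ 2)).
  rewrite lerXn2r ?nnegrE//; first by rewrite sumr_ge0// => i _; rewrite mul1r.
  rewrite (le_trans (ler_norm_sum _ _ _))//; apply: ler_sum => i _.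
  by rewrite lpinj_norm mul1r.
apply: (le_trans (cauchy_schwarz _ _ _)).
rewrite (eq_bigr (fun=> 1)) => [|i _]; last by rewrite expr1n.
rewrite sumr_const card_ord (eq_bigr (fun i : 'I_K => (f i (eunit k) : R) ^+ 2)) => [|i _]; last first.
  by rewrite real_normK ?num_real.
apply: (@le_trans _ _ (K%:R * h)); first by rewrite ler_wpM2l.
by rewrite /h mulrCA ler_piMr ?sqr_ge0// ler_pdivrMr// mul1r ler_nat.
Qed.

Lemma not_embeds_Bp_Xp (w : nat -> R) : ~ embeds (Bp p2) (Xp p2 w).
Proof.
move=> /embeds_below[V [c' [C' [c'0 C'0 VC Vc]]]].
(* The embedding is restricted to the complemented copy of [Z], whose rows are exact copies of
   [l^2]. *)
have [T [Q [D [D0 TD QD TQ]]]] := retract_sum_ell2_Bp p2.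
pose U : {linear Z -> Xp p2 w} := V \o T; pose C := C' * D; pose c := c' / D.
have C0 : 0 < C by exact: mulr_gt0.
have c0 : 0 < c by exact: divr_gt0.
have UC z : `|U z| <= C * `|z|.
  by rewrite /U/= (le_trans (VC _))// /C -mulrA ler_pM2l.
have Uc z : c * `|z| <= `|U z|.
  rewrite /U/= (le_trans _ (Vc _))// /c -mulrA ler_pM2l// ler_pdivrMl//.
  by rewrite -{1}(TQ z).
clearbody U C c.
pose row i : {linear ell2 R -> Z} := @lpinj R p p1 (fun=> ell2 R) i.
pose S i : {linear ell2 R -> lpsum p1 (fun=> R)} := Xp_lp p2 w \o (U \o row i).
have SC i : bounded_by C (S i).
  move=> x; apply: le_trans (Xp_lp_le _) _; apply: le_trans (UC _) _.
  by rewrite lpinj_norm.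
have eun k : `|eunit k| = 1 by rewrite lpinj_norm normr1.
have NNE (N : R) : 0 <= N -> (N `^ 2^-1) ^+ 2 = N.
  by move=> N0; rewrite powR12_sqrt// sqr_sqrtr.
have th : 0 < 2^-1 - p^-1.
  by rewrite subr_gt0 ltf_pV2 ?posrE// (lt_trans _ p2).
(* In a row, the sum of [N] suitable unit vectors has norm [N^(1/2)], but the [l^p]-part of its
   image is only of order [N^(1/p)]. For this [N] the weighted [l^2]-part [g i] has to carry the
   lower bound. *)
have [n Hn] := @pow_unbounded R _ ((C `^ p + 1) `^ p^-1 / c) th.
pose N : R := n.+1%:R; have N0 : 0 < N by rewrite ltr0n.
have NN := NNE N (ltW N0).
have /choice[l Hl] : forall i, exists l : seq nat, uniq l /\ size l = n.+1 /\
    `|\sum_(k <- l) S i (eunit k)| `^ p <= N * (C `^ p + 1).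
  move=> i; have [|k|K m d d0|] := @null_selection R p p1 (fun=> R) (fun k => S i (eunit k)) C _ _ _ n.+1 0.
  - exact: ltW.
  - by apply: (le_trans (SC i _)); rewrite eun mulr1.
  - exact: (@ell2_null (S i) C K m d (ltW C0) (SC i) d0).
  - by move=> l [ul sl _ h]; exists l.
pose x i : ell2 R := \sum_(k <- l i) eunit k.
have x2 i : `|x i| ^+ 2 = N.
  have [ul [sl _]] := Hl i.
  have := @lpsum_sum_inj R 2 (ler1n R 2) (fun=> R) (l i) (fun=> 1) ul.
  rewrite powR_mulrn// => ->.
  rewrite (eq_bigr (fun=> 1)) => [|k _]; last by rewrite normr1 powR1.
  by rewrite big_const_seq count_predT iter_addr_0 sl.
have xN i : `|x i| = N `^ 2^-1 by rewrite powR12_sqrt ?(ltW N0)// -(x2 i) sqrtr_sqr normr_id.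
pose g i := Xp_l2 p2 w (U (row i (x i))).
have gc i : c * N `^ 2^-1 <= `|g i|.
  have [ul [sl Sl]] := Hl i.
  have h1 : `|Xp_lp p2 w (U (row i (x i)))| < c * N `^ 2^-1.
    have -> : Xp_lp p2 w (U (row i (x i))) = \sum_(k <- l i) S i (eunit k).
      by rewrite /x /S /row/= !linear_sum.
    apply: (@le_lt_trans _ _ ((N * (C `^ p + 1)) `^ p^-1)).
      apply: (powR_le_inv p0); rewrite ?powR_ge0// powRVK//.
      by rewrite mulr_ge0 ?addr_ge0 ?powR_ge0// ltW.
    rewrite powRM ?(ltW N0) ?addr_ge0 ?powR_ge0//.
    have -> : 2^-1 = p^-1 + (2^-1 - p^-1) :> R by rewrite addrC subrK.
    rewrite powRD; last by rewrite (gt_eqF N0) implybT.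
    by rewrite mulrCA ltr_pM2l ?powR_gt0// mulrC -ltr_pdivrMr.
  have h2 : c * N `^ 2^-1 <= `|U (row i (x i))|.
    by apply: le_trans (Uc _); rewrite lpinj_norm xN.
  rewrite leNgt; apply/negP => h3.
  have := @Xp_norm_le R p p2 w (U (row i (x i)))
    (Num.max `|Xp_lp p2 w (U (row i (x i)))| `|g i|).
  rewrite !le_max !lexx orbT => /(_ isT isT) /orP[h4|h4].
    by have := lt_le_trans h1 (le_trans h2 h4); rewrite ltxx.
  by have := lt_le_trans h3 (le_trans h2 h4); rewrite ltxx.
have p21 : 2 / p < 1 by rewrite ltr_pdivrMr// mul1r.
(* Over [M.+1] rows the squared norm in [Z] grows with exponent [2/p], while the squared [l^2]-part
   of the image of a signed sum grows linearly. *)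
have [M HM] := pow_lt_linear (C ^+ 2 / c ^+ 2) p21.
have [e He] := @signs_lower R (fun=> ell2 R) (fun=> @ell2_parallelogram R) nat 1
  (lexx _) (fun i _ => g i) 1 _ (iota_uniq 0 M.+1).
rewrite !big_ord_recl !big_ord0 !addr0 in He.
have g0 : 0 <= \sum_(k <- iota 0 M.+1) `|g k| ^+ 2 by rewrite sumr_ge0// => k _; exact: sqr_ge0.
rewrite (powRr1 g0) (powRr1 (sqr_ge0 _)) in He.
have low : M.+1%:R * (c ^+ 2 * N) <= \sum_(k <- iota 0 M.+1) `|g k| ^+ 2.
  have -> : M.+1%:R * (c ^+ 2 * N) = \sum_(k <- iota 0 M.+1) (c ^+ 2 * N).
    by rewrite big_const_seq count_predT iter_addr_0 size_iota mulr_natl.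
  apply: ler_sum => k _; have -> : c ^+ 2 * N = (c * N `^ 2^-1) ^+ 2.
    by rewrite exprMn NN.
  by rewrite lerXn2r ?nnegrE ?mulr_ge0 ?powR_ge0 ?(ltW c0).
pose y : Z := \sum_(k <- iota 0 M.+1) row k ((-1) ^+ e k *: x k).
have yN : `|y| = M.+1%:R `^ p^-1 * N `^ 2^-1.
  have h : `|y| `^ p = M.+1%:R * (N `^ 2^-1) `^ p.
    rewrite lpsum_sum_inj ?iota_uniq// (eq_bigr (fun=> (N `^ 2^-1) `^ p)) => [|k _].
      by rewrite big_const_seq count_predT iter_addr_0 size_iota mulr_natl.
    by rewrite norm_signZ xN.
  by rewrite -(powRK pn0 (normr_ge0 y)) h powRM ?powR_ge0// powRK ?powR_ge0.
have up : \sum_(k <- iota 0 M.+1) (-1) ^+ e k *: g k = Xp_l2 p2 w (U y).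
  rewrite /y !linear_sum/=; apply: eq_bigr => k _.
  by rewrite /g !linearZ.
have fin : M.+1%:R * (c ^+ 2 * N) <= C ^+ 2 * (M.+1%:R `^ (2 / p) * N).
  apply: (le_trans low); apply: (le_trans He); rewrite up.
  have -> : C ^+ 2 * (M.+1%:R `^ (2 / p) * N) = (C * `|y|) ^+ 2.
    rewrite yN !exprMn NN; congr (_ * (_ * _)).
    by rewrite -powR_mulrn ?powR_ge0// -powRrM mulrC.
  rewrite lerXn2r ?nnegrE ?mulr_ge0 ?(ltW C0)//.
  exact: le_trans (Xp_l2_le _) (UC _).
move: fin; rewrite !mulrA ler_pM2r// leNgt => /negP; apply.
by move: HM; rewrite mulrAC ltr_pdivrMr ?exprn_gt0// -[X in _ -> _ < X]mulrA -expr2.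
Qed.

End BpNotInXp.

(** * Duality *)

Section HahnBanach.
Context (R : realType) (U : lmodType R) (V : normedModType R).
Context (T : {linear U -> V}) (f : {linear U -> R^o}) (C : R).
Context (C0 : 0 <= C) (fC : forall u, `|f u| <= C * `|T u|).

(* Partial extensions of [f] are represented by their graphs. *)
Let admissible (G : set (V * R)) :=
  [/\ G !=set0 -> forall u, G (T u, f u : R),
      forall v a, G (v, a) -> a <= C * `|v| &
      forall (t : R) v a w b, G (v, a) -> G (w, b) -> G (t *: v + w, t * a + b)].

(** The first clause of [admissible] is conditional so that the empty graph, the union of the empty
    chain, qualifies. *)
Let admissible_chain (F : set (set (V * R))) : F `<=` admissible ->
  total_on F subset -> admissible (\bigcup_(X in F) X).
Proof.
move=> FP tot; split.
- move=> [x [X FX Xx]] u; exists X => //; have [h _ _] := FP X FX.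
  by apply: h; exists x.
- by move=> v a [X FX Xva]; have [_ h _] := FP X FX; exact: h.
- move=> t v a w b [X FX Xva] [X' FX' Xwb].
  have [h|h] := tot X X' FX FX'.
    by exists X' => //; have [_ _ hl] := FP X' FX'; apply: hl => //; exact: h.
  by exists X => //; have [_ _ hl] := FP X FX; apply: hl => //; exact: h.
Qed.

Let graph_admissible : admissible [set x | exists u, x = (T u, f u : R)].
Proof.
split => [_ u|v a [u [-> ->]]|t v a w b [u [-> ->]] [u' [-> ->]]].
- by exists u.
- by apply: le_trans (fC u); exact: ler_norm.
- by exists (t *: u + u'); rewrite !linearP.
Qed.

(** The new value at [v0] must lie above all [b - C |v - v0|] and below all [C |x + v0| - a]. The
    triangle inequality separates the two families, and [c] is the supremum of the first. *)
Let extend_step (G : set (V * R)) (v0 : V) : admissible G -> G !=set0 ->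
  (forall a, ~ G (v0, a)) -> exists2 H, G `<` H & admissible H.
Proof.
move=> [Gf GC Gl] G0 Gv0; have G00 : G (0, 0).
  by have := Gf G0 0; rewrite !linear0.
have GZ t v a : G (v, a) -> G (t *: v, t * a).
  by move=> Gva; have := Gl t v a 0 0 Gva G00; rewrite !addr0.
pose S := [set x | exists v b, G (v, b) /\ x = b - C * `|v - v0|].
have Sub x y a : G (x, a) -> S y -> y <= C * `|x + v0| - a.
  move=> Gxa [v [b [Gvb ->]]]; rewrite lerBrDr addrAC lerBlDr -mulrDr.
  have := Gl 1 x a v b Gxa Gvb; rewrite scale1r mul1r => /GC h.
  rewrite addrC (le_trans h)// ler_wpM2l//.
  by rewrite (le_trans _ (ler_normD _ _))// addrACA subrr addr0.
have hS : has_sup S.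
  split; first by exists (0 - C * `|0 - v0|), 0, 0.
  by exists (C * `|0 + v0| - 0) => y; exact: Sub.
pose c := sup S.
have c_le x a : G (x, a) -> c <= C * `|x + v0| - a.
  by move=> Gxa; apply: (ge_sup hS.1) => y; exact: Sub.
have c_ge x a : G (x, a) -> a - C * `|x - v0| <= c.
  by move=> Gxa; apply: (ub_le_sup hS.2); exists x, a.
exists [set x | exists t v a, G (v, a) /\ x = (v + t *: v0, a + t * c)].
  split.
    by move=> [v a] Gva; exists 0, v, a; rewrite scale0r mul0r !addr0.
  move=> H; apply: (Gv0 c); apply: H; exists 1, 0, 0.
  by rewrite scale1r mul1r !add0r.
split.
- by move=> _ u; exists 0, (T u), (f u); split; [exact: Gf|rewrite scale0r mul0r !addr0].
- move=> _ _ [t [v [a [Gva [-> ->]]]]].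
  (* Division by [|t|] reduces to the coefficients -1 and 1, which are [c_ge] and [c_le]. *)
  have [t0|t0|->] := ltrgtP t 0.
  + have s0 : 0 < - t by rewrite oppr_gt0.
    have := c_ge _ _ (GZ (- t)^-1 v a Gva).
    rewrite -(ler_pM2l s0) mulrBr mulrA mulfV ?gt_eqF// mul1r.
    have -> : - t * (C * `|(- t)^-1 *: v - v0|) = C * `|v + t *: v0|.
      rewrite mulrCA -{1}(gtr0_norm s0) -normrZ scalerBr scalerA mulfV ?gt_eqF//.
      by rewrite scale1r scaleNr opprK.
    lra.
  + have := c_le _ _ (GZ t^-1 v a Gva).
    rewrite -(ler_pM2l t0) mulrBr mulrA [t * (t^-1 * a)]mulrA mulfV ?gt_eqF// mul1r.
    have -> : t * C * `|t^-1 *: v + v0| = C * `|v + t *: v0|.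
      rewrite mulrAC mulrC -{1}(gtr0_norm t0) -normrZ scalerDr scalerA mulfV ?gt_eqF//.
      by rewrite scale1r.
    lra.
  + by rewrite scale0r mul0r !addr0; exact: GC.
- move=> s _ _ _ _ [t [v [a [Gva [-> ->]]]]] [t' [v' [a' [Gva' [-> ->]]]]].
  exists (s * t + t'), (s *: v + v'), (s * a + a'); split; first exact: Gl.
  congr (_, _); last by ring.
  by rewrite scalerDr scalerDl scalerA addrACA.
Qed.

(** By [fC], [f] factors through [T]. A maximal graph is nonempty, is defined everywhere by
    [extend_step], and is single-valued since [(0, a)] in it forces [a <= 0]. *)
Lemma hahn_banach : exists g : {linear V -> R^o},
  bounded_by C g /\ forall u, g (T u) = f u.
Proof.
have [G [adG maxG]] := Zorn_bigcup admissible_chain.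
have G0 : G !=set0.
  apply/set0P/eqP => G0; apply: maxG graph_admissible; rewrite G0; split => // H.
  by have := H (T 0, f 0 : R) (ex_intro _ 0 erefl).
have [Gf GC Gl] := adG.
have /choice[g Gg] : forall v, exists a, G (v, a).
  move=> v; apply/not_existsP => h.
  by have [H GH /(maxG H GH)] := extend_step adG G0 h.
have uniq v a b : G (v, a) -> G (v, b) -> a = b.
  have main a' b' : G (v, a') -> G (v, b') -> a' <= b'.
    move=> Ga Gb; have := Gl (-1) v b' v a' Gb Ga.
    rewrite scaleN1r addNr mulN1r => /GC; rewrite normr0 mulr0; lra.
  by move=> Ga Gb; apply/eqP; rewrite eq_le !main.
have lg : linear (g : V -> R^o).
  move=> t v w; apply: uniq (Gg _) _; exact: Gl (Gg v) (Gg w).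
exists (mklin lg); split => [v|u] /=; last exact: uniq (Gg _) (Gf G0 u).
rewrite ler_norml; apply/andP; split; last exact: GC (Gg v).
rewrite lerNl; have := Gl (-1) v (g v) 0 0 (Gg v).
have G00 : G (0, 0) by have := Gf G0 0; rewrite !linear0.
move=> /(_ G00) /GC; rewrite !addr0 mulN1r scaleN1r normrN; exact.
Qed.

End HahnBanach.

(** * Dual spaces and reflexivity *)

Section DualSpace.
Context (R : realType).
Implicit Types X Y Z : normedModType R.

Definition dapp X (phi : dual X) (x : X) : R^o := val (phi : dual_type X) x.

Lemma dapp_linear X (phi : dual X) : linear (dapp phi).
Proof. by rewrite /dapp; case: (phi : dual_type X) => g /= /asboolP[]. Qed.

Lemma dapp_linearl X (x : X) : linear ((@dapp X)^~ x).
Proof.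
move=> a f g; rewrite /dapp.
have -> : val ((a *: f + g : dual X) : dual_type X) = a *: val (f : dual_type X) + val (g : dual_type X).
  by rewrite linearP.
by [].
Qed.

Lemma dapp0 X (f : dual X) : dapp f 0 = 0.
Proof. exact: (linear0 (mklin (dapp_linear f))). Qed.

Lemma dappB X (f : dual X) x y : dapp f (x - y) = dapp f x - dapp f y.
Proof. exact: (linearB (mklin (dapp_linear f))). Qed.

Lemma dappZ X (f : dual X) (a : R) x : dapp f (a *: x) = a * dapp f x.
Proof. exact: (linearZ_LR (mklin (dapp_linear f))). Qed.

Lemma dapp_inj X (f g : dual X) : (forall x, dapp f x = dapp g x) -> f = g.
Proof. by move=> fg; apply/val_inj/funext. Qed.

Lemma dapp_le X (f : dual X) x : `|dapp f x| <= `|f| * `|x|.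
Proof.
have [->|x0] := eqVneq x 0.
  by rewrite dapp0 !normr0 mulr0.
have nx : 0 < `|x| by rewrite normr_gt0.
have h : `|dapp f (`|x|^-1 *: x)| <= `|f|.
  by apply: dual_norm_ub; rewrite normrZ normfV normr_id mulVf ?gt_eqF.
move: h; rewrite dappZ normrM normfV normr_id.
by rewrite ler_pdivrMl// mulrC.
Qed.

Lemma dual_exists X (f : X -> R^o) C : linear f -> 0 <= C -> bounded_by C f ->
  exists phi : dual X, (forall x, dapp phi x = f x) /\ `|phi| <= C.
Proof.
move=> lf C0 fC; have fP : dual_pred (f : X -> R).
  by apply/asboolP; split => //; exact: (@bounded_by_continuous _ _ _ (mklin lf) C).
exists (exist _ (f : X -> R) fP : dual_type X); split => //.
apply: ge_sup; first by have [] := dual_has_sup (exist _ (f : X -> R) fP : dual_type X).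
move=> _ [x /= x1 <-]; apply: (le_trans (fC x)); by rewrite ler_piMr.
Qed.

Lemma norming X (x : X) : exists f : dual X, `|f| <= 1 /\ dapp f x = `|x|.
Proof.
pose T (a : R^o) : X := (a : R) *: x; pose g (a : R^o) : R^o := (a : R) * `|x|.
have lT : linear T by move=> a b c; rewrite /T scalerDl scalerA.
have lg : linear g by move=> a b c; rewrite /g mulrDl; congr (_ + _); exact/esym/mulrA.
have [|h [h1 hT]] := @hahn_banach R R^o X (mklin lT) (mklin lg) 1 ler01.
  move=> a; rewrite mul1r; have h := normrM (a : R) `|x|.
  by rewrite normr_id -normrZ in h; rewrite /= /T -h; exact: lexx.
have [f [fE f1]] := dual_exists (linearP h) ler01 h1.
exists f; split => //; rewrite fE; have := hT 1; rewrite /= /T /g scale1r mul1r; exact.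
Qed.

Lemma dual_separates X (x y : X) : (forall f : dual X, dapp f x = dapp f y) -> x = y.
Proof.
move=> xy; apply/eqP; rewrite -subr_eq0 -normr_eq0.
have [f [_ <-]] := norming (x - y).
by rewrite dappB xy subrr.
Qed.

Definition reflexive_space X := forall (F : dual X -> R^o) C, linear F -> 0 <= C ->
  bounded_by C F -> exists x, forall f, F f = dapp f x.

Lemma dual_map X Y (T : {linear X -> Y}) C : 0 <= C -> bounded_by C T ->
  exists T' : {linear dual Y -> dual X},
    (forall f x, dapp (T' f) x = dapp f (T x)) /\ bounded_by C T'.
Proof.
move=> C0 TC.
have /choice[T' HT] : forall f : dual Y, exists g : dual X,
    (forall x, dapp g x = dapp f (T x)) /\ `|g| <= C * `|f|.
  move=> f; apply: dual_exists; last 2 first.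
  - exact: mulr_ge0.
  - by move=> x; rewrite (le_trans (dapp_le _ _))// mulrAC mulrC ler_wpM2r.
  - by move=> a x y; rewrite linearP dapp_linear.
have lT : linear T'.
  move=> a f g; apply: dapp_inj => x.
  by rewrite dapp_linearl !(fun h => (HT h).1) dapp_linearl.
by exists (mklin lT); split => [f x|f]; have [] := HT f.
Qed.

Lemma retract_dual X Y : retract X Y -> retract (dual X) (dual Y).
Proof.
move=> [T [Q [C [C0 TC QC TQ]]]].
have [T' [TE T'C]] := dual_map (ltW C0) TC.
have [Q' [QE Q'C]] := dual_map (ltW C0) QC.
by apply: retract_of Q'C T'C _ => f; apply: dapp_inj => x; rewrite TE QE TQ.
Qed.

(** For fixed [x], the value of [T f] at [x] is a bounded functional of [f]; the point of [Y]
    representing it is the image of [x]. *)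
Lemma predual_map X Y (T : {linear dual Y -> dual X}) C : reflexive_space Y ->
  0 <= C -> bounded_by C T -> exists T' : {linear X -> Y},
    (forall f x, dapp f (T' x) = dapp (T f) x) /\ bounded_by C T'.
Proof.
move=> rY C0 TC.
have /choice[T' HT] : forall x : X, exists y, forall f, dapp (T f) x = dapp f y.
  move=> x; apply: (rY _ (C * `|x|)).
  - by move=> a f g; rewrite linearP dapp_linearl.
  - exact: mulr_ge0.
  - move=> f; rewrite (le_trans (dapp_le _ _))// mulrAC ler_wpM2r//; exact: TC.
have lT : linear T'.
  move=> a x y; apply: dual_separates => f.
  by rewrite -HT dapp_linear !HT dapp_linear.
exists (mklin lT); split => [f x|x] /=; first by rewrite HT.
have [f [f1 <-]] := norming (T' x); rewrite -HT.
apply: (le_trans (ler_norm _)); apply: (le_trans (dapp_le _ _)).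
rewrite ler_wpM2r// (le_trans (TC f))// ler_piMr//.
Qed.

Lemma retract_predual X Y : reflexive_space X -> reflexive_space Y ->
  retract (dual X) (dual Y) -> retract X Y.
Proof.
move=> rX rY [T [Q [C [C0 TC QC TQ]]]].
have [Q' [QE Q'C]] := predual_map rY (ltW C0) QC.
have [T' [TE T'C]] := predual_map rX (ltW C0) TC.
apply: retract_of Q'C T'C _ => x; apply: dual_separates => f.
by rewrite TE QE TQ.
Qed.

(** Composed with the adjoint [T'], [F] is evaluation at some [z] of [Z]. If [z] were off the closed
    range, some [k] would vanish on the range with [k z = 1], although [T' k = 0]. *)
Lemma reflexive_embeds X Z : embeds X Z -> reflexive_space Z -> reflexive_space X.
Proof.
move=> [A [T [cA [TA /continuous_bounded_by[C C0 TC] [S TS cS]]]]] rZ F D lF D0 FD.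
have [|c c0 Tc] := within_continuous_below TS; first by rewrite TA.
have [T' [TE T'C]] := dual_map (ltW C0) TC.
have [z Hz] : exists z, forall g, F (T' g) = dapp g z.
  apply: (rZ _ (D * C)).
  - by move=> a g h; rewrite linearP lF.
  - by rewrite mulr_ge0// ltW.
  - by move=> g; rewrite (le_trans (FD _))// -mulrA ler_wpM2l.
have F0 : F 0 = 0 by exact: (linear0 (mklin lF)).
have [x zx] : exists x, T x = z.
  have [[x _ xz]|nz] := pselect (range T z); first by exists x.
  have /nbhs_normP[e /= e0 He] : nbhs z (~` A).
    by apply: open_nbhs_nbhs; split; [exact: closed_openC|rewrite -TA].
  have dist y : e <= `|z - T y|.
    rewrite leNgt; apply/negP => h; apply: (He (T y)) => //.
    by rewrite -TA; exists y.
  (* [L] parametrizes the span of the range and [z], and [h] reads off the coefficient of [z]; it is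
     bounded by [e^-1] because [z] has distance at least [e] from the range. *)
  pose L (u : X * R^o) : Z := T u.1 + (u.2 : R) *: z.
  pose h (u : X * R^o) : R^o := u.2.
  have lL : linear L.
    by move=> a u v; rewrite /L linearP/= scalerDl scalerDr scalerA addrACA.
  have lh : linear h by [].
  have [||g [gC gL]] := @hahn_banach R (X * R^o)%type Z (mklin lL) (mklin lh) e^-1.
  - by rewrite invr_ge0 ltW.
  - move=> [y t]; rewrite /= /L /h/= ler_pdivlMl//.
    have [->|t0] := eqVneq t 0; first by rewrite normr0 mulr0.
    have nt : 0 < `|t| by rewrite normr_gt0.
    rewrite mulrC -ler_pdivlMl// -normfV -normrZ scalerDr scalerA mulVf// scale1r.
    by rewrite addrC (le_trans (dist (- (t^-1 *: y))))// linearN linearZ opprK.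
  have eV0 : 0 <= e^-1 by rewrite invr_ge0 ltW.
  have [k [kE _]] := dual_exists (linearP g) eV0 gC.
  have kT y : dapp k (T y) = 0.
    by rewrite kE; have := gL (y, 0); rewrite /= /L /h/= scale0r addr0.
  have kz : dapp k z = 1.
    by rewrite kE; have := gL (0, 1); rewrite /= /L /h/= scale1r linear0 add0r.
  have T'k : T' k = 0.
    by apply: dapp_inj => y; rewrite TE kT.
  by have := Hz k; rewrite T'k F0 kz => /esym/eqP; rewrite oner_eq0.
exists x => f.
have fT : forall u, `|(mklin (dapp_linear f)) u| <= `|f| / c * `|T u|.
  move=> u /=; rewrite (le_trans (dapp_le _ _))// -mulrA ler_wpM2l// ler_pdivlMl//.
have fc0 : 0 <= `|f| / c by rewrite divr_ge0// ltW.
have [g [gC gT]] := @hahn_banach R X Z T (mklin (dapp_linear f)) _ fc0 fT.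
have [k [kE _]] := dual_exists (linearP g) fc0 gC.
have -> : f = T' k by apply: dapp_inj => y; rewrite TE kE gT.
by rewrite Hz TE zx.
Qed.

End DualSpace.

(** * Pairings that represent dual spaces *)

Section Pairings.
Context (R : realType).
Implicit Types E F : normedModType R.

(* [b] identifies [E] isometrically with the dual of [F]. *)
Definition half_pair E F (b : E -> F -> R^o) : Prop :=
  [/\ forall y, linear (b^~ y), forall x, linear (b x),
      forall x y, `|b x y| <= `|x| * `|y|,
      forall x, exists y, `|y| <= 1 /\ b x y = `|x| &
      forall (f : F -> R^o) C, linear f -> 0 <= C -> bounded_by C f ->
        exists x, forall y, f y = b x y].

Definition dual_pair E F (b : E -> F -> R^o) := half_pair b /\ half_pair (fun y x => b x y).

Lemma half_pair_retract E F (b : E -> F -> R^o) : half_pair b ->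
  retract E (dual F) /\ retract (dual F) E.
Proof.
move=> [l1 l2 ble bnorm brep].
have /choice[J HJ] : forall x : E, exists phi : dual F,
    (forall y, dapp phi y = b x y) /\ `|phi| <= `|x|.
  by move=> x; apply: dual_exists => //; exact: ble.
have lJ : linear J.
  by move=> a x y; apply: dapp_inj => z; rewrite dapp_linearl !(fun h => (HJ h).1) l1.
have /choice[L HL] : forall phi : dual F, exists x, forall y, dapp phi y = b x y.
  move=> phi; apply: (brep _ `|phi|) => //; first exact: dapp_linear.
  exact: dapp_le.
have JL phi : J (L phi) = phi by apply: dapp_inj => y; rewrite (HJ _).1 HL.
have inj x x' : (forall y, b x y = b x' y) -> x = x'.
  move=> xx'; apply/eqP; rewrite -subr_eq0 -normr_eq0.
  have [y [_ <-]] := bnorm (x - x').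
  by have /= -> := linearB (mklin (l1 y)) x x'; rewrite xx' subrr.
have LJ x : L (J x) = x by apply: inj => y; rewrite -HL (HJ _).1.
have lL : linear L.
  by move=> a f g; apply: inj => y; rewrite l1 -!HL dapp_linearl.
have JC : bounded_by 1 (mklin lJ) by move=> x; rewrite mul1r (HJ x).2.
have LC : bounded_by 1 (mklin lL).
  move=> f; rewrite mul1r /=; have [y [y1 <-]] := bnorm (L f).
  by rewrite -HL (le_trans (ler_norm _))// (le_trans (dapp_le _ _))// ler_piMr.
by split; [apply: retract_of JC LC _|apply: retract_of LC JC _].
Qed.

Lemma dual_pair_reflexive E F (b : E -> F -> R^o) : dual_pair b -> reflexive_space F.
Proof.
move=> [[l1 l2 ble bnorm brep] [_ _ _ _ brep']] G C lG C0 GC.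
have /choice[J HJ] : forall x : E, exists phi : dual F,
    (forall y, dapp phi y = b x y) /\ `|phi| <= `|x|.
  by move=> x; apply: dual_exists => //; exact: ble.
have lJ : linear J.
  by move=> a x y; apply: dapp_inj => z; rewrite dapp_linearl !(fun h => (HJ h).1) l1.
have [|x|y Hy] := brep' (fun x => G (J x)) C _ C0.
- by move=> a x y; rewrite lJ lG.
- by rewrite (le_trans (GC _))// ler_wpM2l// (HJ x).2.
exists y => f; have [x Hx] := brep (dapp f) `|f| (dapp_linear f) (normr_ge0 _) (dapp_le f).
have -> : f = J x by apply: dapp_inj => z; rewrite (HJ x).1 Hx.
by rewrite Hy (HJ x).1.
Qed.

Lemma real_pair : dual_pair (fun x y : R => (x * y : R^o)).
Proof.
suff h : half_pair (fun x y : R => (x * y : R^o)).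
  split => //; rewrite (_ : (fun y x : R => _) = (fun x y : R => (x * y : R^o)))//.
  by apply/funext => x; apply/funext => y; exact: mulrC.
split.
- by move=> y a x x'; rewrite mulrDl; congr (_ + _); exact/esym/mulrA.
- by move=> x a y y'; rewrite mulrDr; congr (_ + _); exact: mulrCA.
- by move=> x y; rewrite -normrM.
- move=> x; exists (Num.sg x); rewrite mulrC -normrEsg; split => //.
  by rewrite normr_sg; case: (_ != _).
- move=> f C lf _ _; exists (f 1 : R) => y.
  have := linearZ_LR (mklin lf) (y : R) (1 : R); rewrite /= => h.
  by rewrite mulrC -[X in f X](mulr1 y); exact: h.
Qed.

End Pairings.

(** * Duality between [l^q]-sums and [l^p]-sums *)

Section LpSumPairing.
Context (R : realType) (p q : R) (p1 : 1 <= p) (q1 : 1 <= q).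
Context (pq : q^-1 + p^-1 = 1).
Context (E F : nat -> normedModType R) (b : forall i, E i -> F i -> R^o).
Local Notation X := (lpsum q1 E).
Local Notation Y := (lpsum p1 F).
Let p0 : 0 < p. Proof. exact: lt_le_trans p1. Qed.
Let q0 : 0 < q. Proof. exact: lt_le_trans q1. Qed.
Let pn0 : p != 0. Proof. by rewrite gt_eqF. Qed.
Let qn0 : q != 0. Proof. by rewrite gt_eqF. Qed.

Lemma lpsum_hoelder (x : X) (y : Y) K :
  \sum_(i < K) `|coord i x| * `|coord i y| <= `|x| * `|y|.
Proof.
have [->|x0] := eqVneq x 0.
  by rewrite normr0 mul0r big1// => i _; rewrite linear0 normr0 mul0r.
have [->|y0] := eqVneq y 0.
  by rewrite normr0 mulr0 big1// => i _; rewrite linear0 normr0 mulr0.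
have nx : 0 < `|x| by rewrite normr_gt0.
have ny : 0 < `|y| by rewrite normr_gt0.
rewrite -[leRHS]mul1r -ler_pdivrMr ?mulr_gt0// mulr_suml.
apply: (@le_trans _ _ (\sum_(i < K) ((`|coord i x| `^ q / `|x| `^ q) / q +
    (`|coord i y| `^ p / `|y| `^ p) / p))).
  apply: ler_sum => i _.
  have := @conjugate_powR R (`|coord i x| / `|x|) (`|coord i y| / `|y|) q p.
  rewrite !divr_ge0// => /(_ isT isT q0 p0 pq).
  have pd (a c r : R) : 0 <= a -> 0 < c -> (a / c) `^ r = a `^ r / c `^ r.
    move=> a0 c0; rewrite powRM ?invr_ge0 ?(ltW c0)//; congr (_ * _).
    by rewrite -powR_inv1 ?(ltW c0)// -powRrM mulN1r powRN.
  rewrite !pd//; apply: le_trans.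
  by rewrite invfM mulrACA.
rewrite big_split/= -!mulr_suml -pq lerD// ler_piMl ?invr_ge0 ?(ltW p0) ?(ltW q0)//.
  by rewrite ler_pdivrMr ?powR_gt0// mul1r lpsum_psum_le.
by rewrite ler_pdivrMr ?powR_gt0// mul1r lpsum_psum_le.
Qed.

Lemma lpsum_pairing : (forall i x y, `|@b i x y : R| <= `|x| * `|y|) ->
  exists B : X -> Y -> R^o, forall x y,
    (\sum_(i < K) @b i (coord i x) (coord i y)) @[K --> \oo] --> (B x y : R).
Proof.
move=> bb; suff /choice[B HB] : forall xy : X * Y, exists l : R,
    (\sum_(i < K) @b i (coord i xy.1) (coord i xy.2)) @[K --> \oo] --> l.
  by exists (fun x y => B (x, y)) => x y; exact: (HB (x, y)).
move=> [x y] /=; pose u i : R := @b i (coord i x) (coord i y).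
have cu : cvgn (series u).
  apply: normed_cvg; apply: nondecreasing_is_cvgn.
    by apply: nondecreasing_series => i _ _ /=.
  exists (`|x| * `|y|) => _ [K _ <-]; rewrite /normed_series_of seriesEord/=.
  by apply: le_trans (lpsum_hoelder x y K); apply: ler_sum => i _; exact: bb.
exists (limn (series u)); apply: cvg_trans cu; apply: near_eq_cvg; near=> K.
by rewrite seriesEord.
Unshelve. all: by end_near. Qed.

Lemma lpsum_half_pair (B : X -> Y -> R^o) : (forall i, half_pair (@b i)) ->
  (forall x y, (\sum_(i < K) @b i (coord i x) (coord i y)) @[K --> \oo] --> (B x y : R)) ->
  half_pair B.
Proof.
move=> hb HB; have uni := @cvg_unique _ (@norm_hausdorff R R).
have bl1 i y : linear ((@b i)^~ y) by have [] := hb i.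
have bl2 i x : linear (@b i x) by have [] := hb i.
have ble i x y : `|@b i x y : R| <= `|x| * `|y| by have [] := hb i.
have bn i : exists g : E i -> F i, forall x, `|g x| <= 1 /\ @b i x (g x) = `|x|.
  by have [_ _ _ h _] := hb i; have [g gE] := choice h; exists g.
pose g i := sval (cid (bn i)).
have gE i x : `|g i x| <= 1 /\ @b i x (g i x) = `|x| := svalP (cid (bn i)) x.
have pq1 : (q - 1) * p = q.
  have : p * q * (q^-1 + p^-1) = p * q by rewrite pq mulr1.
  rewrite mulrDr mulfK// mulrAC mulfV// mul1r; lra.
have pw1 a := @powR_pred R q a qn0.
have pwp a : (a `^ (q - 1)) `^ p = a `^ q by rewrite -powRrM pq1.
have bZ i x (a : R) y : (@b i x (a *: y) : R) = a * (@b i x y : R).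
  exact: (linearZ_LR (mklin (@bl2 i x)) a y).
split.
- move=> y a x x'; apply: (uni _ _ _ _ (HB _ _)).
  have -> : (fun K => \sum_(i < K) @b i (coord i (a *: x + x')) (coord i y) : R) =
    (fun K => a * (\sum_(i < K) @b i (coord i x) (coord i y) : R) + \sum_(i < K) @b i (coord i x') (coord i y)).
    apply/funext => K; rewrite mulr_sumr -big_split/=; apply: eq_bigr => i _.
    by rewrite linearP bl1.
  by apply: cvgD (HB x' y); apply: cvgMr (HB x y).
- move=> x a y y'; apply: (uni _ _ _ _ (HB _ _)).
  have -> : (fun K => \sum_(i < K) @b i (coord i x) (coord i (a *: y + y')) : R) =
    (fun K => a * (\sum_(i < K) @b i (coord i x) (coord i y) : R) + \sum_(i < K) @b i (coord i x) (coord i y')).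
    apply/funext => K; rewrite mulr_sumr -big_split/=; apply: eq_bigr => i _.
    by rewrite linearP bl2.
  by apply: cvgD (HB x y'); apply: cvgMr (HB x y).
- move=> x y; apply: (ler_cvg_to (cvg_norm (HB x y)) (cvg_cst (`|x| * `|y|))).
  apply: nearW => K; apply: le_trans (lpsum_hoelder x y K).
  by apply: (le_trans (ler_norm_sum _ _ _)); apply: ler_sum => i _; exact: ble.
- move=> x; have [->|x0] := eqVneq x 0.
    exists 0; rewrite !normr0; split; first exact: ler01.
    apply: (uni _ _ _ _ (HB _ _)).
    have -> : (fun K => \sum_(i < K) @b i (coord i (0 : X)) (coord i (0 : Y)) : R) = (fun=> 0).
      apply/funext => K; rewrite big1// => i _; rewrite linear0.
      by have := bZ i 0 0 0; rewrite scale0r mul0r linear0.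
    exact: cvg_cst.
  have nx : 0 < `|x| by rewrite normr_gt0.
  (* Equality case of Hoelder: row [i] of the norming vector is [|x_i|^(q-1)] times a norming vector
     of [x_i], and [c] normalizes the whole. *)
  pose c := (`|x| `^ (q - 1))^-1.
  have c0 : 0 <= c by rewrite invr_ge0 powR_ge0.
  have cp : c `^ p = (`|x| `^ q)^-1.
    by rewrite /c -powR_inv1 ?powR_ge0// -!powRrM mulrCA pq1 mulN1r powRN.
  have yi i : `|(c * `|coord i x| `^ (q - 1)) *: g i (coord i x)| `^ p <=
      (`|x| `^ q)^-1 * `|coord i x| `^ q.
    rewrite -cp -pwp -powRM ?powR_ge0// normrZ.
    apply: powR_le; [exact: ltW|by rewrite mulr_ge0|].
    by rewrite ger0_norm ?mulr_ge0 ?powR_ge0// ler_piMr ?(gE _ _).1// mulr_ge0 ?powR_ge0.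
  have [|y [yE y1]] := @lpsum_exists R p p1 F
      (fun i => (c * `|coord i x| `^ (q - 1)) *: g i (coord i x)) 1 ler01.
    move=> K; rewrite powR1; apply: (@le_trans _ _ ((`|x| `^ q)^-1 * `|x| `^ q)); last first.
      by rewrite mulVf// gt_eqF// powR_gt0.
    apply: (@le_trans _ _ (\sum_(i < K) (`|x| `^ q)^-1 * `|coord i x| `^ q)).
      by apply: ler_sum => i _; exact: yi.
    by rewrite -mulr_sumr ler_wpM2l ?invr_ge0 ?powR_ge0// lpsum_psum_le.
  exists y; split => //; apply: (uni _ _ _ _ (HB _ _)).
  have -> : (fun K => \sum_(i < K) @b i (coord i x) (coord i y) : R) =
      (fun K => c * \sum_(i < K) `|coord i x| `^ q).
    apply/funext => K; rewrite mulr_sumr; apply: eq_bigr => i _.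
    by rewrite yE bZ (gE _ _).2 -mulrA pw1.
  have -> : (`|x| : R^o) = c * `|x| `^ q.
    by rewrite -pw1 ?normr_ge0// mulrA mulVf ?mul1r// gt_eqF// powR_gt0.
  by apply: cvgMr; exact: lpsum_psum_cvg.
move=> f C lf C0 fC; pose fl := mklin lf.
have rep i : exists x : E i, forall v, f (lpinj p1 v) = @b i x v.
  have [_ _ _ _ h] := hb i; apply: (h _ C) => //.
    by move=> a u v; rewrite linearP lf.
  by move=> v; rewrite (le_trans (fC _))// lpinj_norm.
pose xi i := sval (cid (rep i)).
have xiE i v : f (lpinj p1 v) = @b i (xi i) v := svalP (cid (rep i)) v.
have xiC K : \sum_(i < K) `|xi i| `^ q <= C `^ q.
  set A := \sum_(i < K) _; have A0 : 0 <= A by apply: sumr_ge0 => i _; exact: powR_ge0.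
  have [->|An0] := eqVneq A 0; first exact: powR_ge0.
  have Agt0 : 0 < A by rewrite lt_def An0.
  (* Testing [f] on the extremal vector of the first [K] rows gives [A <= C A^(1/p)], that is,
     [A^(1/q) <= C]. *)
  pose v i : F i := (`|xi i| `^ (q - 1)) *: g i (xi i).
  pose y := \sum_(i <- index_iota 0 K) lpinj p1 (v i).
  have yA : `|y| `^ p <= A.
    rewrite lpsum_sum_inj ?iota_uniq// big_mkord; apply: ler_sum => i _.
    rewrite -pwp normrZ (ger0_norm (powR_ge0 _ _)).
    apply: powR_le; [exact: ltW|by rewrite mulr_ge0 ?powR_ge0|].
    by rewrite ler_piMr ?(gE _ _).1 ?powR_ge0.
  have fy : (f y : R) = A.
    have -> : f y = \sum_(i <- index_iota 0 K) f (lpinj p1 (v i)) by exact: (linear_sum fl).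
    rewrite big_mkord; apply: eq_bigr => i _.
    by rewrite xiE bZ (gE _ _).2 pw1.
  have yAp : `|y| <= A `^ p^-1.
    by apply: (@powR_le_inv _ p) => //; rewrite ?powR_ge0// powRVK.
  have AC : A <= C * A `^ p^-1.
    by rewrite -{1}fy (le_trans (ler_norm _))// (le_trans (fC _))// ler_wpM2l.
  have AE : A = A `^ q^-1 * A `^ p^-1.
    by rewrite -powRD ?An0 ?implybT// pq powRr1.
  have : A `^ q^-1 <= C.
    by move: AC; rewrite {1}AE ler_pM2r// powR_gt0.
  by move/(powR_le (ltW q0) (powR_ge0 _ _)); rewrite powRVK.
have [x [xE _]] := @lpsum_exists R q q1 E xi C C0 xiC.
(* Partial sums of the pairing are values of [f] at truncations of [y], which converge to [y]. *)
exists x => y; apply: (uni _ _ _ _ _ (HB x y)).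
have -> : (fun K => \sum_(i < K) @b i (coord i x) (coord i y) : R) =
    (fun K => f (trunc (below K) y) : R).
  apply/funext => K; rewrite trunc_inj.
  have -> : f (\sum_(i < K) lpinj p1 (coord i y)) = \sum_(i < K) f (lpinj p1 (coord i y)).
    exact: (linear_sum fl).
  by apply: eq_bigr => i _; rewrite xiE xE.
apply/cvgrPdist_le => e e0.
have C1 : 0 < C + 1 by rewrite ltr_wpDl.
have [K0 HK] := trunc_tail y (divr_gt0 e0 C1).
near=> K.
have -> : (f y : R) - f (trunc (below K) y) = f (trunc (predC (below K)) y).
  by rewrite -{1}(truncC (below K) y) [f (_ + _)](linearD fl) addrAC subrr add0r.
rewrite (le_trans (fC _))// (@le_trans _ _ ((C + 1) * (e / (C + 1))))//; last first.
  by rewrite mulrC divfK ?gt_eqF.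
apply: ler_pM => //; first by rewrite lerDl.
by apply: HK; near: K; exact: nbhs_infty_ge.
Unshelve. all: by end_near. Qed.

End LpSumPairing.

Lemma lpsum_dual_pair (R : realType) (p q : R) (p1 : 1 <= p) (q1 : 1 <= q)
    (E F : nat -> normedModType R) (b : forall i, E i -> F i -> R^o) :
  q^-1 + p^-1 = 1 -> (forall i, dual_pair (@b i)) ->
  exists B : lpsum q1 E -> lpsum p1 F -> R^o, dual_pair B.
Proof.
move=> pq hb; have [|B HB] := @lpsum_pairing R p q p1 q1 pq E F b.
  by move=> i x y; have [[_ _ h _ _] _] := hb i; exact: h.
exists B; split; first by apply: lpsum_half_pair HB => // i; have [] := hb i.
apply: (@lpsum_half_pair R q p q1 p1 _ F E (fun i y x => b i x y)) => //.
- by rewrite addrC.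
- by move=> i; have [] := hb i.
Qed.

(** * The statements for exponents between 1 and 2 *)

Section Duality.
Context (R : realType).

Lemma ell2_dual_pair : exists b : ell2 R -> ell2 R -> R^o, dual_pair b.
Proof.
apply: (@lpsum_dual_pair R 2 2 (ler1n R 2) (ler1n R 2) (fun=> R) (fun=> R)
  (fun _ x y => (x * y : R^o))); last by move=> _; exact: real_pair.
by lra.
Qed.

Lemma sum_ell2_dual_pair (p q : R) (p1 : 1 <= p) (q1 : 1 <= q) :
  q^-1 + p^-1 = 1 ->
  exists B : lpsum_ell2 q1 -> lpsum_ell2 p1 -> R^o, dual_pair B.
Proof.
move=> pq; have [b hb] := ell2_dual_pair.
by apply: (@lpsum_dual_pair R p q p1 q1 _ _ (fun=> b)).
Qed.

Context (q : R) (q12 : 1 < q < 2).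
Let q1 := ge1_lt2 q12.
Let p2 := conj_exp_gt2 q12.
Let p1 := ge1_gt2 p2.

Let pair : exists B : lpsum_ell2 q1 -> lpsum_ell2 p1 -> R^o, dual_pair B.
Proof.
apply: sum_ell2_dual_pair; apply: conj_expP.
by case/andP: q12.
Qed.

Let reflexive_sum_ell2 : reflexive_space (lpsum_ell2 p1).
Proof. by have [B /dual_pair_reflexive] := pair. Qed.

Let reflexive_Bp : reflexive_space (Bp p2).
Proof. exact: reflexive_embeds (embeds_Bp_sum_ell2 p2) reflexive_sum_ell2. Qed.

Let reflexive_Xp w : reflexive_space (Xp p2 w).
Proof. exact: reflexive_embeds (embeds_Xp_Bp p2 w) reflexive_Bp. Qed.

Let dual_sum_ell2 : retract (lpsum_ell2 q1) (dual (lpsum_ell2 p1)) /\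
  retract (dual (lpsum_ell2 p1)) (lpsum_ell2 q1).
Proof. by have [B [/half_pair_retract]] := pair. Qed.

Lemma retract_sum_ell2_Bq : retract (lpsum_ell2 q1) (Bq q12).
Proof.
exact: retract_trans dual_sum_ell2.1 (retract_dual (retract_sum_ell2_Bp p2)).
Qed.

(** The [l^q]-sum is exchanged for the dual of the [l^p]-sum, and reflexivity leads back to a
    retraction excluded for [p > 2]. *)
Lemma not_retract_Bq_sum_ell2 : ~ retract (Bq q12) (lpsum_ell2 q1).
Proof.
move=> h; apply: (@not_retract_Bp_sum_ell2 R _ p2).
apply: retract_predual => //; exact: retract_trans h dual_sum_ell2.1.
Qed.

Lemma not_retract_Xq_Bq (w : nat -> R) : (forall n, 0 < w n) ->
  condition_star (conj_exp q) w -> ~ retract (Xq q12 w) (Bq q12).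
Proof.
move=> w0 star h; apply: (@not_retract_Xp_Bp R _ p2 w w0 star).
exact: retract_predual h.
Qed.

End Duality.

(** * Haar systems and [L^p] *)

Section HaarSystem.
Context (R : realType) (X : normedModType R).
Implicit Types (p w : R) (chi : nat -> nat -> X) (a : nat -> nat -> R).

(* [chi L k] behaves in norm like the indicator of the [k]-th dyadic interval
   of level [L] inside an interval of measure [w]. *)
Definition dyadic p w chi : Prop :=
  (forall L k, chi L k = chi L.+1 k.*2 + chi L.+1 k.*2.+1) /\
  (forall L (c : nat -> R), `|\sum_(k < 2 ^ L) c k *: chi L k| `^ p =
    w / (2 ^ L)%:R * \sum_(k < 2 ^ L) `|c k| `^ p).

Definition haar chi (M k : nat) : X := chi M.+1 k.*2 - chi M.+1 k.*2.+1.

(** Value on the k-th interval of level [L] of the Haar expansion over the levels below [L]: [k./2]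
    is the parent interval, and odd [k] is its right half, where the Haar function is -1. *)
Fixpoint haar_coef a (L k : nat) : R :=
  if L is L'.+1 then haar_coef a L' k./2 + (-1) ^+ odd k * a L' k./2 else 0.

Definition subsystem (m k0 : nat) chi : nat -> nat -> X :=
  fun L k => chi (m + L)%N (k0 * 2 ^ L + k)%N.

Lemma sum_pairs (V : nmodType) L (f : nat -> V) :
  \sum_(j < 2 ^ L.+1) f j = \sum_(k < 2 ^ L) (f k.*2 + f k.*2.+1).
Proof.
rewrite expnSr sum_blocks; apply: eq_bigr => k _.
by rewrite !big_ord_recr big_ord0/= add0r muln2 addn0 addn1.
Qed.

Lemma haar_sum p w chi a L : dyadic p w chi ->
  \sum_(M < L) \sum_(k < 2 ^ M) a M k *: haar chi M k =
  \sum_(k < 2 ^ L) haar_coef a L k *: chi L k.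
Proof.
move=> [h2 _]; elim: L => [|L IH].
  by rewrite big_ord0 big1// => k _; rewrite scale0r.
rewrite big_ord_recr/= IH (sum_pairs _ (fun k => haar_coef a L.+1 k *: chi L.+1 k)).
rewrite -big_split/=; apply: eq_bigr => k _.
rewrite /haar h2 odd_double uphalf_double doubleK expr0 expr1 mul1r mulN1r.
by rewrite scalerBr !scalerDl scalerDr scaleNr addrACA.
Qed.

(** Parseval: on the two halves of an interval the cross terms are opposite. *)
Lemma haar_coef_sqr a L : \sum_(k < 2 ^ L) haar_coef a L k ^+ 2 =
  (2 ^ L)%:R * \sum_(M < L) (\sum_(k < 2 ^ M) a M k ^+ 2) / (2 ^ M)%:R.
Proof.
elim: L => [|L IH].
  by rewrite big_ord0 mulr0 big1// => k _; rewrite expr0n.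
rewrite (sum_pairs _ (fun k => haar_coef a L.+1 k ^+ 2)) big_ord_recr/= mulrDr.
have -> : (2 ^ L.+1)%:R = 2 * (2 ^ L)%:R :> R by rewrite expnS natrM.
rewrite -mulrA -IH -mulrA [(2 ^ L)%:R * _]mulrC divfK ?pnatr_eq0 ?expn_eq0//.
rewrite !mulr_sumr.
rewrite -big_split/=; apply: eq_bigr => k _.
rewrite odd_double uphalf_double doubleK expr0 expr1; ring.
Qed.

Lemma haar_level p w chi M (e : nat -> bool) : dyadic p w chi ->
  `|\sum_(k < 2 ^ M) (-1) ^+ e k *: haar chi M k| `^ p = w.
Proof.
move=> [_ hc].
rewrite (_ : \sum_(k < 2 ^ M) (-1) ^+ e k *: haar chi M k =
    \sum_(j < 2 ^ M.+1) ((-1) ^+ odd j * (-1) ^+ e j./2) *: chi M.+1 j).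
  rewrite (hc _ (fun j => (-1) ^+ odd j * (-1) ^+ e j./2)).
  rewrite (eq_bigr (fun=> 1)) => [|j _].
    by rewrite sumr_const card_ord divfK// pnatr_eq0 expn_eq0.
  by rewrite normrM !normrX normrN1 !expr1n mulr1 powR1.
rewrite (sum_pairs _ (fun j => ((-1) ^+ odd j * (-1) ^+ e j./2) *: chi M.+1 j)).
apply: eq_bigr => k _; rewrite /= odd_double uphalf_double doubleK expr0 expr1.
by rewrite mul1r mulN1r scaleNr scalerBr.
Qed.

Lemma sum_uniq_ord (V : nmodType) (S : seq nat) L (f : nat -> V) : uniq S ->
  (forall M, M \in S -> (M < L)%N) ->
  \sum_(M <- S) f M = \sum_(M < L) (if (M : nat) \in S then f M else 0).
Proof.
move=> uS SL; rewrite -(big_mkord xpredT (fun M => if M \in S then f M else 0)).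
rewrite -big_mkcond -big_filter; apply: perm_big; apply: uniq_perm => //.
  by rewrite filter_uniq// iota_uniq.
move=> M; rewrite mem_filter mem_index_iota /=.
by case: (boolP (M \in S)) => // /SL ->.
Qed.

(** The normalized p-norm dominates the normalized 2-norm ([power_mean] over the intervals of level
    [L]), and each level of [S] adds 1 to the mean square. *)
Lemma haar_lower p w chi (S : seq nat) (e : nat -> nat -> bool) : 2 <= p -> 0 <= w ->
  dyadic p w chi -> uniq S ->
  w * (size S)%:R `^ (p / 2) <=
  `|\sum_(M <- S) \sum_(k < 2 ^ M) (-1) ^+ e M k *: haar chi M k| `^ p.
Proof.
move=> p2 w0 hchi uS; have p0 : 0 < p by rewrite (lt_le_trans _ p2).
have s1 : 1 <= p / 2 by rewrite ler_pdivlMr// mul1r.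
pose L := (\max_(M <- S) M).+1.
have SL M : M \in S -> (M < L)%N by move=> MS; rewrite ltnS leq_bigmax_seq.
pose a M k : R := if M \in S then (-1) ^+ e M k else 0.
rewrite (sum_uniq_ord _ uS SL).
rewrite (eq_bigr (fun M : 'I_L => \sum_(k < 2 ^ M) a M k *: haar chi M k)); last first.
  move=> M _; rewrite /a; case: ifP => // _.
  by rewrite big1// => k _; rewrite scale0r.
rewrite (haar_sum _ _ hchi); have [_ ->] := hchi.
have n0 : 0 < (2 ^ L)%:R :> R by rewrite ltr0n expn_gt0.
rewrite -mulrA ler_wpM2l// ler_pdivlMl//.
have := @power_mean R nat (index_iota 0 (2 ^ L)) (fun k => haar_coef a L k ^+ 2) (p / 2) s1
  (fun=> sqr_ge0 _).
rewrite !big_mkord size_iota subn0 haar_coef_sqr.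
rewrite [(2 ^ L)%:R * _ / _]mulrAC mulfV ?gt_eqF// mul1r.
rewrite (_ : \sum_(M < L) _ = (size S)%:R) => [h|].
  apply: le_trans h _; apply: ler_sum => k _.
  rewrite -real_normK ?num_real// -powR_mulrn// -powRrM mulrC divfK//.
rewrite -sum1_size natr_sum (sum_uniq_ord _ uS SL); apply: eq_bigr => M _.
rewrite /a; case: ifP => _; last by rewrite big1 ?mul0r// => k _; rewrite expr0n.
rewrite (eq_bigr (fun=> 1)) => [|k _]; last by rewrite sqrr_sign.
by rewrite sumr_const card_ord mulfV// pnatr_eq0 expn_eq0.
Qed.

Lemma haar_subsystem m k0 chi M k :
  haar (subsystem m k0 chi) M k = haar chi (m + M) (k0 * 2 ^ M + k).
Proof.
rewrite /haar /subsystem addnS expnS.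
by rewrite mulnCA mul2n addnS doubleD.
Qed.

Lemma subsystem_dyadic p w m k0 chi : p != 0 -> (k0 < 2 ^ m)%N -> dyadic p w chi ->
  dyadic p (w / (2 ^ m)%:R) (subsystem m k0 chi).
Proof.
move=> p0 k0m [h2 hc]; split => [L k|L c].
  rewrite /subsystem h2 addnS expnS mulnCA mul2n.
  by rewrite doubleD addnS.
pose c' j := if (j %/ 2 ^ L == k0)%N then c (j %% 2 ^ L)%N else 0.
have cE k1 (r : 'I_(2 ^ L)) : c' (k1 * 2 ^ L + r)%N = if k1 == k0 then c r else 0.
  rewrite /c' divnMDl ?expn_gt0// divn_small// addn0.
  by rewrite modnMDl modn_small.
have := hc (m + L)%N c'; rewrite expnD.
rewrite (sum_blocks _ _ (fun k => c' k *: chi (m + L)%N k)).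
rewrite (sum_blocks _ _ (fun k => `|c' k| `^ p)).
have sel (V : nmodType) (f : nat -> V) : (forall k1, k1 != k0 -> f k1 = 0) ->
    \sum_(k1 < 2 ^ m) f k1 = f k0.
  by move=> f0; rewrite (bigD1 (Ordinal k0m))//= big1 ?addr0// => k1 kk; exact: f0.
rewrite (sel _ (fun k1 => \sum_(r < 2 ^ L)
    c' (k1 * 2 ^ L + r)%N *: chi (m + L)%N (k1 * 2 ^ L + r)%N)); last first.
  by move=> k1 kk; rewrite big1// => r _; rewrite cE (negPf kk) scale0r.
rewrite (sel _ (fun k1 => \sum_(r < 2 ^ L) `|c' (k1 * 2 ^ L + r)%N| `^ p)); last first.
  by move=> k1 kk; rewrite big1// => r _; rewrite cE (negPf kk) normr0 powR0.
rewrite natrM invfM mulrA.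
rewrite (eq_bigr (fun r : 'I_(2 ^ L) => c r *: subsystem m k0 chi L r)) => [->|r _].
  2: by rewrite cE eqxx.
by congr (_ * _); apply: eq_bigr => r _; rewrite cE eqxx.
Qed.

End HaarSystem.

Lemma uniform_threshold (P : nat -> nat -> Prop) (N : nat) :
  (forall I, (I < N)%N -> exists K0, forall K, (K0 <= K)%N -> P I K) ->
  exists K0, forall K, (K0 <= K)%N -> forall I, (I < N)%N -> P I K.
Proof.
elim: N => [_|N IH H]; first by exists 0%N.
have [|K1 H1] := IH; first by move=> I IN; apply: H; rewrite ltnS ltnW.
have [K2 H2] := H N (ltnSn N).
exists (maxn K1 K2) => K; rewrite geq_max => /andP[K1K K2K] I.
by rewrite ltnS leq_eqVlt => /predU1P[->|IN]; [exact: H2|exact: H1].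
Qed.

(** * Haar systems do not embed into [l^p]-sums of Hilbertian rows *)

Section HaarEmbedding.
Context (R : realType) (p : R) (p2 : 2 < p) (p1 : 1 <= p).
Context (E : nat -> normedModType R) (parE : forall i, parallelogram (E i)).
Context (X : normedModType R) (T : {linear X -> lpsum p1 E}) (c C : R).
Context (c0 : 0 < c) (C0 : 0 < C) (TC : bounded_by C T).
Context (Tc : forall x, c * `|x| <= `|T x|).
Implicit Types chi : nat -> nat -> X.
Local Notation s := (p / 2).

Let p0 : 0 < p. Proof. by rewrite (lt_trans _ p2). Qed.
Let s_gt1 : 1 < s. Proof. by rewrite ltr_pdivlMr// mul1r. Qed.
Let s1 : 1 <= s. Proof. exact: ltW. Qed.
Let s0 : 0 < s. Proof. exact: lt_le_trans s1. Qed.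

Let powR_half (V : normedModType R) (v : V) : (`|v| ^+ 2) `^ s = `|v| `^ p.
Proof. by rewrite -powR_mulrn// -powRrM mulrC divfK. Qed.

(** This is [nu_M(i, I)] for the whole interval; smaller [I] are reached through [subsystem]. *)
Definition level_sqr chi (M i : nat) : R :=
  \sum_(k < 2 ^ M) `|coord i (T (haar chi M k))| ^+ 2.

Lemma level_sqr_ge0 chi M i : 0 <= level_sqr chi M i.
Proof. by apply: sumr_ge0 => k _; exact: sqr_ge0. Qed.

Lemma level_sqr_upper w chi M K : dyadic p w chi ->
  \sum_(i < K) level_sqr chi M i `^ s <= C `^ p * w.
Proof.
move=> hchi; pose z k : seqspace E := fun i => coord i (T (haar chi M k)).
have [e] := @signs_lower R E parE nat s s1 z K (index_iota 0 (2 ^ M)) (iota_uniq _ _).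
rewrite (eq_bigr (fun i : 'I_K => level_sqr chi M i `^ s)) => [|i _]; last by rewrite big_mkord.
move=> /le_trans; apply; pose f := \sum_(k < 2 ^ M) (-1) ^+ e k *: haar chi M k.
apply: (@le_trans _ _ (`|T f| `^ p)).
  apply: le_trans (lpsum_psum_le (T f) K); apply: ler_sum => i _.
  rewrite powR_half /f !linear_sum/= big_mkord le_eqVlt; apply/orP; left; apply/eqP.
  by congr (`|_| `^ _); apply: eq_bigr => k _; rewrite !linearZ.
rewrite -(haar_level M e hchi) -powRM ?(ltW C0)//.
exact: powR_le (ltW p0) _ (TC _).
Qed.

Lemma tails_list (l : seq (lpsum p1 E)) d : 0 < d ->
  exists K0, forall K, (K0 <= K)%N ->
  forall x, x \in l -> `|trunc (predC (below K)) x| <= d.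
Proof.
move=> d0; elim: l => [|a l [K1 H1]]; first by exists 0%N.
have [K2 H2] := trunc_tail a d0.
exists (maxn K1 K2) => K; rewrite geq_max => /andP[K1K K2K] x.
by rewrite in_cons => /predU1P[->|xl]; [exact: H2|exact: H1].
Qed.

(** [signs_upper] covers finitely many rows, hence the threshold [K0] and the error [d] for the
    tails. The constant [k] must serve all [2^m] subsystems at once. *)
Lemma level_sqr_lower : exists2 k : R, 0 <= k &
  forall w chi (S : seq nat) d, 0 <= w -> dyadic p w chi -> uniq S -> 0 < d ->
  exists K0, forall K, (K0 <= K)%N ->
    c `^ p * (w * (size S)%:R `^ s) <=
    \sum_(i < K) (k * \sum_(M <- S) level_sqr chi M i) `^ s + d.
Proof.
have [k k0 Hk] := @signs_upper R E parE (nat * nat)%type s s1.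
exists k => // w chi S d w0 hchi uS d0.
pose l := [seq (M, j) | M <- S, j <- index_iota 0 (2 ^ M)].
have ul : uniq l.
  by apply: allpairs_uniq_dep => // [M _|[M j] [M' j'] _ _ [-> ->]//]; exact: iota_uniq.
pose h (a : nat * nat) := haar chi a.1 a.2.
pose d1 := d `^ p^-1 / (size l).+1%:R.
have d10 : 0 < d1 by rewrite divr_gt0// powR_gt0.
have [K0 HK0] := tails_list [seq T (h a) | a <- l] d10.
exists K0 => K KK.
have [e He] := Hk (fun a i => coord i (T (h a))) K l ul.
pose f := \sum_(a <- l) (-1) ^+ e a *: h a.
have TfE : T f = \sum_(a <- l) (-1) ^+ e a *: T (h a).
  by rewrite /f linear_sum/=; apply: eq_bigr => a _; rewrite linearZ.
apply: (@le_trans _ _ (`|T f| `^ p)).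
  have hl := @haar_lower R X p w chi S (fun M j => e (M, j)) (ltW p2) w0 hchi uS.
  apply: (@le_trans _ _ ((c * `|f|) `^ p)); last first.
    by apply: powR_le (ltW p0) _ (Tc f); rewrite mulr_ge0// ltW.
  rewrite powRM ?(ltW c0)// ler_wpM2l ?powR_ge0// (le_trans hl)//.
  rewrite /f /l big_allpairs_dep/= le_eqVlt; apply/orP; left; apply/eqP.
  by congr (`|_| `^ _); apply: eq_bigr => M _; rewrite big_mkord.
rewrite (truncC_norm (below K)) trunc_lt_norm lerD//.
  apply: le_trans (le_trans _ He) _; last first.
    apply: ler_sum => i _; rewrite /l big_allpairs_dep/= le_eqVlt.
    apply/orP; left; apply/eqP; congr ((_ * _) `^ _).
    by apply: eq_bigr => M _; rewrite /level_sqr big_mkord.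
  apply: ler_sum => i _; rewrite powR_half TfE linear_sum/= le_eqVlt.
  by apply/orP; left; apply/eqP; congr (`|_| `^ _).
rewrite -[leRHS](@powRVK _ p) ?gt_eqF ?(ltW d0)//; apply: powR_le => //; first exact: ltW.
rewrite TfE linear_sum/= (le_trans (ler_norm_sum _ _ _))//.
apply: (@le_trans _ _ (\sum_(a <- l) d1)).
  rewrite big_seq [leRHS]big_seq; apply: ler_sum => a al.
  by rewrite linearZ/= norm_signZ; apply: HK0 => //; exact: map_f.
rewrite big_const_seq count_predT iter_addr_0 -mulr_natl /d1 mulrCA.
by rewrite ler_piMr ?powR_ge0// ler_pdivrMr ?ltr0n// mul1r ler_nat.
Qed.

Lemma level_sqr_blocks chi m M i :
  level_sqr chi (m + M) i = \sum_(I < 2 ^ m) level_sqr (subsystem m I chi) M i.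
Proof.
rewrite /level_sqr expnD.
rewrite (sum_blocks _ _ (fun k => `|coord i (T (haar chi (m + M) k))| ^+ 2)).
apply: eq_bigr => I _; apply: eq_bigr => k _; by rewrite haar_subsystem.
Qed.

Local Notation S := (lpsum s1 (fun=> (R : normedModType R))).

Let C2_powR : (C ^+ 2) `^ s = C `^ p.
Proof. by rewrite -powR_mulrn ?(ltW C0)// -powRrM mulrC divfK. Qed.

(** [nu] is a coordinatewise cluster point of a bounded sequence in [l^{p/2}]; it obeys the same
    bound because each of its heads is approximated by heads of the [N j]. *)
Lemma level_limit chi : dyadic p 1 chi -> exists (N : nat -> S) (nu : S),
  [/\ forall M i, coord i (N M) = level_sqr chi M i,
      forall M, `|N M| <= C ^+ 2, `|nu| <= C ^+ 2 &
      forall K m d, 0 < d ->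
        exists2 j, (m <= j)%N & `|trunc (below K) (N j - nu)| <= d].
Proof.
move=> hchi; have B0 : 0 <= C ^+ 2 by rewrite sqr_ge0.
have /choice[N HN] : forall M, exists y : S,
    (forall i, coord i y = level_sqr chi M i) /\ `|y| <= C ^+ 2.
  move=> M; apply: lpsum_exists => // K.
  rewrite C2_powR -[leRHS]mulr1; apply: le_trans (level_sqr_upper M K hchi).
  by apply: ler_sum => i _; rewrite ger0_norm// level_sqr_ge0.
have NE M i : coord i (N M) = level_sqr chi M i := (HN M).1 i.
have aB j i : `|level_sqr chi j i| <= C ^+ 2.
  by rewrite -NE (le_trans (coord_le _ _))// (HN j).2.
have [l Hl] := cluster_seq aB.
pose inj i (v : R) : S := @lpinj R s s1 (fun=> (R : normedModType R)) i v.
have close (K m : nat) (d : R) : 0 < d -> exists2 j, (m <= j)%N &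
    `|\sum_(i < K) inj i (coord i (N j) - l i : R)| <= d.
  move=> d0; have d10 : 0 < d / K.+1%:R by rewrite divr_gt0.
  have [j mj Hj] := Hl K m _ d10; exists j => //.
  apply: (le_trans (ler_norm_sum _ _ _)).
  apply: (@le_trans _ _ (\sum_(i < K) d / K.+1%:R)).
    by apply: ler_sum => i _; rewrite /inj lpinj_norm NE; exact: Hj.
  rewrite sumr_const card_ord -[_ *+ K]mulr_natl mulrCA ler_piMr ?(ltW d0)//.
  by rewrite ler_pdivrMr// mul1r ler_nat.
have lB K : \sum_(i < K) `|l i| `^ s <= (C ^+ 2) `^ s.
  pose t : S := \sum_(i <- index_iota 0 K) inj i (l i).
  have tE : `|t| `^ s = \sum_(i < K) `|l i| `^ s.
    by rewrite /t (@lpsum_sum_inj _ _ s1 (fun=> R) _ l) ?iota_uniq// big_mkord.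
  rewrite -tE; apply: powR_le; [exact: ltW|by []|].
  apply/ler_addgt0Pr => d d0; have [j _ Hj] := close K 0%N d d0.
  have -> : t = trunc (below K) (N j) - \sum_(i < K) inj i (coord i (N j) - l i : R).
    rewrite trunc_inj -sumrB /t big_mkord; apply: eq_bigr => i _.
    by rewrite /inj -linearB/= subKr.
  rewrite (le_trans (ler_normB _ _))// lerD// (le_trans (trunc_le _ _))//.
  exact: (HN j).2.
have [nu [nuE nuB]] := @lpsum_exists R s s1 (fun=> R) l _ B0 lB.
exists N, nu; split => // [M|K m d d0]; first exact: (HN M).2.
have [j mj Hj] := close K m d d0; exists j => //.
rewrite trunc_inj; apply: le_trans Hj; rewrite le_eqVlt; apply/orP; left; apply/eqP.
by congr (`|_|); apply: eq_bigr => i _; rewrite /inj -nuE.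
Qed.


Let nat_small_power (r A M : R) : 0 < r -> 0 < A -> 0 <= M ->
  exists m : nat, M / (2 ^ m)%:R `^ r <= A.
Proof.
move=> r0 A0 M0; have [n Hn] := @pow_unbounded R r (M / A) r0; exists n.+1.
have h : n.+1%:R `^ r <= (2 ^ n.+1)%:R `^ r :> R.
  by apply: powR_le; rewrite ?(ltW r0)// ler_nat ltnW// ltn_expl.
rewrite ler_pdivrMr ?powR_gt0 ?ltr0n ?expn_gt0//.
move: Hn; rewrite ltr_pdivrMr// => /ltW/le_trans; apply.
by rewrite [leRHS]mulrC ler_wpM2r// ltW.
Qed.

(** The order of choices is [A], [eta], [K1], [m], [n]: [K1] cuts off the tail of [nu], [m] makes
    the intervals short enough for the first [K1] rows, and [n] is the number of levels needed for
    their average to be within [eta] of [nu]. *)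
Lemma no_dyadic_system chi : ~ dyadic p 1 chi.
Proof.
move=> hchi; have [N [nu [NE NB nuB weak]]] := level_limit hchi.
have [k k0 low] := level_sqr_lower.
pose B := C ^+ 2; have B0 : 0 <= B by exact: sqr_ge0.
have cp0 : 0 < c `^ p by exact: powR_gt0.
have ks0 : 0 <= k `^ s by exact: powR_ge0.
(* The final inequality is [c^p <= 4 k^s A], whose right side is below [c^p / 2] for this [A]. *)
pose A := c `^ p / (8 * (k `^ s + 1)).
have den0 : 0 < 8 * (k `^ s + 1) by rewrite mulr_gt0// ltr_wpDl.
have A0 : 0 < A by rewrite divr_gt0.
pose eta := A `^ s^-1 / 2; have eta0 : 0 < eta by rewrite divr_gt0// powR_gt0.
have etaA : (2 * eta) `^ s = A.
  by rewrite /eta mulrC divfK// powRVK ?gt_eqF// ltW.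
have [K1 HK1] := trunc_tail nu eta0; have {}HK1 := HK1 K1 (leqnn K1).
have sr0 : 0 < s^-1 * (s - 1) by rewrite mulr_gt0 ?invr_gt0 ?subr_gt0.
have [m Hm] := @nat_small_power _ A (K1%:R * B * (C `^ p) `^ (s^-1 * (s - 1))) sr0 A0
  (mulr_ge0 (mulr_ge0 (ler0n _ _) B0) (powR_ge0 _ _)).
have tm0 : 0 < (2 ^ m)%:R :> R by rewrite ltr0n expn_gt0.
pose rho := (C `^ p / (2 ^ m)%:R) `^ s^-1.
have rho0 : 0 <= rho by exact: powR_ge0.
have {}Hm : K1%:R * (rho `^ (s - 1) * B) <= A.
  apply: le_trans Hm; rewrite /rho -powRrM.
  rewrite powRM ?powR_ge0 ?invr_ge0 ?(ltW tm0)//.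
  have -> : ((2 ^ m)%:R^-1 : R) `^ (s^-1 * (s - 1)) = ((2 ^ m)%:R `^ (s^-1 * (s - 1)))^-1.
    by rewrite -(powR_inv1 (ltW tm0)) -powRrM mulN1r powRN.
  by rewrite le_eqVlt; apply/orP; left; apply/eqP; ring.
pose D := (B + B) `^ s + 1.
have D0 : 0 < D by rewrite ltr_wpDl// powR_ge0.
have s10 : 0 < s - 1 by rewrite subr_gt0.
have [n' Hn'] := @pow_unbounded R (s - 1) (D / eta `^ s) s10.
set n := n'.+1 in Hn'; have n0 : 0 < n%:R :> R by rewrite ltr0n.
have yB M : `|N (M + m)%N - nu| <= B + B by rewrite (le_trans (ler_normB _ _))// lerD.
(* Levels are shifted by [m] because a level splits over the intervals of level [m] only from there
   on. *)
have [|l [ul sl _ lD]] := @null_selection R s s1 (fun=> R) (fun M => N (M + m)%N - nu) _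
    (addr_ge0 B0 B0) yB _ n 0%N.
  move=> K m' d d0; have [j mj Hj] := weak K (m' + m)%N d d0.
  exists (j - m)%N; first by rewrite leq_subRL ?(leq_trans (leq_addl m' m) mj)// addnC.
  by rewrite subnK// (leq_trans (leq_addl m' m) mj).
pose V := \sum_(M <- l) N (M + m)%N; pose W := \sum_(M <- l) (N (M + m)%N - nu).
have VE : V = W + n%:R *: nu.
  rewrite /W sumrB -/V big_const_seq count_predT iter_addr_0 sl scaler_nat.
  by rewrite subrK.
have Weta : `|W| <= n%:R * eta.
  apply: (@powR_le_inv _ s) => //; first by rewrite mulr_ge0// ltW.
  apply: (le_trans lD); rewrite powRM ?(ltW eta0)// -(@powR_pred _ s n%:R) ?gt_eqF//.
  rewrite [_ * n%:R]mulrC -mulrA ler_pM2l//.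
  by move: Hn'; rewrite ltr_pdivrMr ?powR_gt0// => /ltW.
have Vtail : `|trunc (predC (below K1)) V| `^ s <= n%:R `^ s * A.
  have e20 : 0 <= 2 * eta by rewrite mulr_ge0// ltW.
  rewrite -etaA -(powRM _ (ltW n0) e20); apply: powR_le; [exact: ltW|exact: normr_ge0|].
  have -> : n%:R * (2 * eta) = n%:R * eta + n%:R * eta by ring.
  rewrite VE linearD/= linearZ/=.
  rewrite (le_trans (ler_normD _ _))// lerD//.
    by rewrite (le_trans (trunc_le _ _)).
  by rewrite normrZ ger0_norm ?ler0n// ler_wpM2l.
have VB : `|V| <= n%:R * B.
  rewrite (le_trans (ler_norm_sum _ _ _))// -sl -sum1_size natr_sum mulr_suml.
  by apply: ler_sum => M _; rewrite mul1r.
pose v I i := \sum_(M <- l) level_sqr (subsystem m I chi) M i.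
have v0 I i : 0 <= v I i by apply: sumr_ge0 => M _; exact: level_sqr_ge0.
have vV i : \sum_(I < 2 ^ m) v I i = coord i V.
  rewrite /v exchange_big/= /V linear_sum/=; apply: eq_bigr => M _.
  by rewrite NE addnC level_sqr_blocks.
have V0 i : 0 <= (coord i V : R) by rewrite -vV sumr_ge0// => I _; exact: v0.
have sub I : (I < 2 ^ m)%N -> dyadic p ((2 ^ m)%:R^-1) (subsystem m I chi).
  by move=> Im; have := subsystem_dyadic (lt0r_neq0 p0) Im hchi; rewrite mul1r.
have vrho I i : (I < 2 ^ m)%N -> v I i <= n%:R * rho.
  move=> Im; rewrite /v -sl -sum1_size natr_sum mulr_suml; apply: ler_sum => M _.
  rewrite mul1r; apply: (@powR_le_inv _ s) => //.
  rewrite powRVK ?gt_eqF// ?divr_ge0 ?powR_ge0 ?(ltW tm0)//.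
  apply: le_trans (level_sqr_upper M i.+1 (sub I Im)).
  by rewrite big_ord_recr/= lerDr sumr_ge0// => j _; exact: powR_ge0.
have vle I i : (I < 2 ^ m)%N -> v I i <= coord i V.
  move=> Im; rewrite -vV (bigD1 (Ordinal Im))//= lerDl sumr_ge0// => J _; exact: v0.
(* Half of the lower bound on one interval, so that all errors together take half of the total. *)
pose d := c `^ p * ((2 ^ m)%:R^-1 * n%:R `^ s) / 2.
have d0 : 0 < d by rewrite divr_gt0// !mulr_gt0 ?invr_gt0 ?powR_gt0.
have [K2 HK2] : exists K2, forall K, (K2 <= K)%N -> forall I, (I < 2 ^ m)%N ->
    c `^ p * ((2 ^ m)%:R^-1 * n%:R `^ s) <= \sum_(i < K) (k * v I i) `^ s + d.
  apply: uniform_threshold => I Im.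
  have w0 : 0 <= (2 ^ m)%:R^-1 :> R by rewrite invr_ge0 ltW.
  by have := low _ _ l d w0 (sub I Im) ul d0; rewrite sl.
pose K := maxn K1 K2; have K1K : (K1 <= K)%N by exact: leq_maxl.
pose VT := trunc (predC (below K1)) V.
(* In the first [K1] rows [v <= n rho] gives [v^s <= (n rho)^(s-1) v], and the [v I i] sum over [I]
   to the i-th entry of [V]. In later rows the sum of s-th powers is at most the s-th power of the
   sum, which belongs to the small tail of [V]. *)
have row i : \sum_(I < 2 ^ m) v I i `^ s <=
    (if (i < K1)%N then n%:R `^ s * (rho `^ (s - 1) * B) else 0) + `|coord i VT| `^ s.
  rewrite /VT coord_trunc /predC /below /=; case: ltnP => iK /=.
    rewrite normr0 powR0 ?gt_eqF// addr0.
    apply: (@le_trans _ _ ((n%:R * rho) `^ (s - 1) * (n%:R * B))); last first.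
      rewrite powRM ?(ltW n0)// -(@powR_pred _ s n%:R) ?gt_eqF ?(ltW n0)//.
      by rewrite le_eqVlt; apply/orP; left; apply/eqP; ring.
    apply: (@le_trans _ _ ((n%:R * rho) `^ (s - 1) * coord i V)).
      rewrite -vV mulr_sumr; apply: ler_sum => I _.
      rewrite -(@powR_pred _ s (v I i)) ?gt_eqF// ler_wpM2r//.
      by apply: powR_le => //; [exact: ltW|exact: vrho].
    rewrite ler_wpM2l ?powR_ge0//; apply: le_trans VB.
    by apply: le_trans (coord_le V i); exact: ler_norm.
  rewrite add0r ger0_norm// -(@powR_pred _ s (coord i V)) ?gt_eqF//.
  rewrite -{2}vV mulr_sumr; apply: ler_sum => I _.
  rewrite -(@powR_pred _ s (v I i)) ?gt_eqF// ler_wpM2r//.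
  by apply: powR_le => //; [exact: ltW|exact: vle].
have total : \sum_(i < K) \sum_(I < 2 ^ m) v I i `^ s <= n%:R `^ s * (A + A).
  apply: (@le_trans _ _ (\sum_(i < K)
      ((if (i < K1)%N then n%:R `^ s * (rho `^ (s - 1) * B) else 0) + `|coord i VT| `^ s))).
    by apply: ler_sum => i _; exact: row.
  rewrite big_split/= mulrDr lerD//.
    rewrite -big_mkcond/= -(big_ord_widen K (fun=> n%:R `^ s * (rho `^ (s - 1) * B)) K1K).
    by rewrite sumr_const card_ord -[_ *+ K1]mulr_natl mulrCA ler_wpM2l ?powR_ge0.
  by apply: le_trans Vtail; exact: lpsum_psum_le.
have : \sum_(I < 2 ^ m) (c `^ p * ((2 ^ m)%:R^-1 * n%:R `^ s)) <=
    \sum_(I < 2 ^ m) (\sum_(i < K) (k * v I i) `^ s + d).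
  by apply: ler_sum => I _; apply: HK2 => //; exact: leq_maxr.
rewrite big_split/= !sumr_const card_ord.
rewrite -[_ *+ 2 ^ m]mulr_natl -[d *+ 2 ^ m]mulr_natl exchange_big/=.
rewrite (eq_bigr (fun i : 'I_K => k `^ s * \sum_(I < 2 ^ m) v I i `^ s)) => [|i _].
  2: by rewrite mulr_sumr; apply: eq_bigr => I _; rewrite powRM.
rewrite -mulr_sumr => h.
have {}h : c `^ p * n%:R `^ s <= k `^ s * (n%:R `^ s * (A + A)) + c `^ p * n%:R `^ s / 2.
  move: h; rewrite /d (_ : (2 ^ m)%:R * _ = c `^ p * n%:R `^ s); last by field; rewrite gt_eqF.
  rewrite (_ : (2 ^ m)%:R * _ = c `^ p * n%:R `^ s / 2); last by field; rewrite gt_eqF.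
  by move/le_trans; apply; rewrite lerD2r ler_wpM2l.
have ns0 : 0 < n%:R `^ s :> R by exact: powR_gt0.
have {}h : c `^ p <= 4 * (k `^ s * A).
  rewrite -(ler_pM2l ns0); move: h; lra.
have AE : A * (8 * (k `^ s + 1)) = c `^ p by rewrite /A divfK// gt_eqF.
by move: h; rewrite -AE; have := mulr_ge0 ks0 (ltW A0); nra.
Qed.

End HaarEmbedding.

(** * Dyadic indicators in [L^p] *)

Section StepFunctions.
Context d (T : measurableType d) (R : realType) (mu : {measure set T -> \bar R}).
Context (p : R) (p1 : 1 <= p) (A : nat -> set T).
Context (mA : forall k, measurable (A k)) (tA : forall i j x, A i x -> A j x -> i = j).
Let p0 : 0 < p. Proof. exact: lt_le_trans p1. Qed.

Let indicE k x : (\1_(A k) x : R) = (`[< A k x >])%:R.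
Proof. by rewrite indicE. Qed.

Lemma step_powR n (c : nat -> R) x :
  `|\sum_(k < n) c k * \1_(A k) x| `^ p = \sum_(k < n) `|c k| `^ p * \1_(A k) x :> R.
Proof.
have [[k Akx]|nA] := pselect (exists k : 'I_n, A k x).
  have E j : j != k -> (\1_(A j) x : R) = 0.
    move=> jk; rewrite indicE asboolF// => Ajx; move/eqP: jk; apply.
    by apply/val_inj; exact: tA Akx.
  rewrite (bigD1 k)//= [in RHS](bigD1 k)//= !big1 => [|j /E ->|j /E ->]; rewrite ?mulr0//.
  by rewrite !addr0 indicE asboolT// !mulr1.
have E (j : 'I_n) : (\1_(A j) x : R) = 0.
  by rewrite indicE asboolF// => Ajx; apply: nA; exists j.
by rewrite !big1 ?normr0 ?powR0 ?gt_eqF// => j _; rewrite E mulr0.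
Qed.

Lemma integral_step n (c : nat -> R) :
  (\int[mu]_x (`|(\sum_(k < n) c k * \1_(A k) x)%:E| `^ p) =
   \sum_(k < n) (`|c k| `^ p)%:E * mu (A k))%E.
Proof.
under eq_integral => x _.
  rewrite abse_EFin poweR_EFin step_powR -sumEFin.
  under eq_bigr => k _ do rewrite EFinM.
  over.
rewrite ge0_integral_sum//=.
- apply: eq_bigr => k _; rewrite ge0_integralZl_EFin ?powR_ge0//.
  + by rewrite integral_indic// setIT.
  + by apply/measurable_EFinP; exact: measurable_indic.
- move=> k; apply/measurable_EFinP; exact: measurable_funM.
Qed.

End StepFunctions.

Section DyadicIndicators.
Context (R : realType) (p : R) (p1 : 1 <= p).
Let p0 : 0 < p. Proof. exact: lt_le_trans p1. Qed.
Local Notation mu := (mrestr lebesgue_measure (measurable_itv `]0 : R, 1[)).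
Local Notation F := (LfunType mu (le1_EFin p1)).
Local Open Scope quotient_scope.

(** Half-open, so that intervals of one level are disjoint and the two halves add up at every
    point. *)
Definition dyadic_interval (L k : nat) : set R :=
  `[k%:R / (2 ^ L)%:R, k.+1%:R / (2 ^ L)%:R[%classic.

Lemma measurable_dyadic_interval L k : measurable (dyadic_interval L k).
Proof. exact: measurable_itv. Qed.

Lemma dyadic_intervalP L k x : dyadic_interval L k x <->
  k%:R <= x * (2 ^ L)%:R < k.+1%:R.
Proof.
have t0 : 0 < (2 ^ L)%:R :> R by rewrite ltr0n expn_gt0.
by rewrite /dyadic_interval /= in_itv/= ler_pdivrMr// ltr_pdivlMr.
Qed.

Lemma dyadic_interval_inj L i j x :
  dyadic_interval L i x -> dyadic_interval L j x -> i = j.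
Proof.
move=> /dyadic_intervalP/andP[h1 h2] /dyadic_intervalP/andP[h3 h4].
have := le_lt_trans h1 h4; have := le_lt_trans h3 h2.
by rewrite !ltr_nat !ltnS => ji ij; apply/eqP; rewrite eqn_leq ij ji.
Qed.

Let lebesgue_dyadic (b1 b2 : bool) L k : lebesgue_measure
    ([set` Interval (BSide b1 (k%:R / (2 ^ L)%:R)) (BSide b2 (k.+1%:R / (2 ^ L)%:R))] : set R) =
  ((2 ^ L)%:R^-1)%:E.
Proof.
have t0 : 0 < (2 ^ L)%:R :> R by rewrite ltr0n expn_gt0.
rewrite lebesgue_measure_itv/= lte_fin ltr_pM2r ?invr_gt0// ltr_nat ltnS leqnn -EFinB.
by rewrite -mulrBl -natrB// subSnn mul1r.
Qed.

Lemma dyadic_interval_measure_le L k :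
  (mu (dyadic_interval L k) <= ((2 ^ L)%:R^-1)%:E)%E.
Proof.
rewrite -(lebesgue_dyadic true true L k); apply: le_measure; rewrite ?inE.
- by apply: measurableI; [exact: measurable_dyadic_interval|exact: measurable_itv].
- exact: measurable_itv.
- exact: subIsetl.
Qed.

Lemma dyadic_interval_measure L k : (k < 2 ^ L)%N ->
  mu (dyadic_interval L k) = ((2 ^ L)%:R^-1)%:E.
Proof.
(* For the lower bound, the open dyadic interval lies inside the open unit interval and has the same
   length. *)
move=> kL; have t0 : 0 < (2 ^ L)%:R :> R by rewrite ltr0n expn_gt0.
apply/eqP; rewrite eq_le dyadic_interval_measure_le/=.
rewrite -(lebesgue_dyadic false true L k); apply: le_measure; rewrite ?inE.
- exact: measurable_itv.
- by apply: measurableI; [exact: measurable_dyadic_interval|exact: measurable_itv].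
move=> x /=; rewrite in_itv/= => /andP[h1 h2]; split.
  by rewrite /dyadic_interval/= in_itv/= (ltW h1).
rewrite in_itv/= (le_lt_trans _ h1) ?divr_ge0 ?ler0n//=.
by rewrite (lt_le_trans h2)// ler_pdivrMr// mul1r ler_nat.
Qed.

Let norm_step L (c : nat -> R) :
  ('N[mu]_p%:E [(fun x => (\sum_(k < 2 ^ L) c k * \1_(dyadic_interval L k) x)%:E)] =
   (((2 ^ L)%:R^-1 * \sum_(k < 2 ^ L) `|c k| `^ p) `^ p^-1)%:E)%E.
Proof.
rewrite unlock (integral_step mu p1 (measurable_dyadic_interval L) (@dyadic_interval_inj L)).
rewrite -poweR_EFin mulr_sumr -sumEFin; congr (_ `^ _)%E.
apply: eq_bigr => k _; rewrite mulrC EFinM; congr (_ * _)%E.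
exact: dyadic_interval_measure.
Qed.

Let dyadic_indic_Lfun L k : (\1_(dyadic_interval L k) : R -> R) \in Lfun mu p%:E.
Proof.
apply/andP; rewrite ?inE; split.
  exact: measurable_indic (measurable_dyadic_interval L k).
rewrite /= /finite_norm unlock; apply: poweR_lty.
rewrite (_ : (\int[mu]_x _)%E = mu (dyadic_interval L k)).
  by apply: le_lt_trans (dyadic_interval_measure_le L k) _; rewrite ltry.
rewrite -[dyadic_interval L k in RHS]setIT -integral_indic//; last exact: measurable_dyadic_interval.
apply: eq_integral => x _ /=; rewrite indicE.
by case: (x \in _); rewrite /= ?normr1 ?normr0 ?powR1// powR0// gt_eqF.
Qed.

Definition dyadic_indic L k : F := Lfun_Sub (le1_EFin p1) (dyadic_indic_Lfun L k).

Definition dyadic_unit L k : Lp01 p1 := \pi_(Lp_type mu p1) (dyadic_indic L k).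

Let pi_sum (n : nat) (c : nat -> R) (f : nat -> F) :
  \sum_(k < n) c k *: (\pi_(Lp_type mu p1) (f k) : Lp01 p1) =
  \pi_(Lp_type mu p1) (\sum_(k < n) c k *: f k).
Proof.
elim: n => [|n IH]; first by rewrite !big_ord0 piE.
have E : c n *: (\pi_(Lp_type mu p1) (f n) : Lp01 p1) = \pi_(Lp_type mu p1) (c n *: f n).
  exact: pi_Lp_scale.
by rewrite !big_ord_recr/= IH E; exact: Lp_piD.
Qed.

Let sum_apply n (c : nat -> R) (f : nat -> F) x :
  (\sum_(k < n) c k *: f k) x = \sum_(k < n) c k * f k x.
Proof.
elim: n => [|n IH]; first by rewrite !big_ord0.
by rewrite !big_ord_recr/= -IH.
Qed.

Let indic_bool L k x : (\1_(dyadic_interval L k) x : R) =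
  (k%:R <= x * (2 ^ L)%:R < k.+1%:R)%R%:R.
Proof.
rewrite indicE; congr (_%:R); congr nat_of_bool.
by apply/idP/idP => [/set_mem/dyadic_intervalP//|h]; apply/mem_set/dyadic_intervalP.
Qed.

Lemma dyadic_indicD L k x : (\1_(dyadic_interval L k) x : R) =
  \1_(dyadic_interval L.+1 k.*2) x + \1_(dyadic_interval L.+1 k.*2.+1) x.
Proof.
rewrite !indic_bool expnS natrM mulrCA; move: (x * _) => y.
have -> : k.*2.+2%:R = 2 * k%:R + 2 :> R by rewrite -muln2 -!natr1 natrM; ring.
have -> : k.*2.+1%:R = 2 * k%:R + 1 :> R by rewrite -muln2 -natr1 natrM; ring.
have -> : k.*2%:R = 2 * k%:R :> R by rewrite -muln2 natrM mulrC.
rewrite -natr1; move: (k%:R : R) => a.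
case: (lerP a y) => h1; case: (ltrP y (a + 1)) => h2;
  case: (lerP (2 * a) (2 * y)) => h3; case: (ltrP (2 * y) (2 * a + 1)) => h4;
  case: (ltrP (2 * y) (2 * a + 2)) => h5;
  rewrite /= ?addr0 ?add0r//; exfalso; lra.
Qed.

Lemma dyadic_unit_dyadic : dyadic p 1 dyadic_unit.
Proof.
split=> [L k|L c].
  rewrite /dyadic_unit [RHS]Lp_piD; congr (\pi_(Lp_type mu p1) _).
  by apply/LfuneqP => x; exact: dyadic_indicD.
have nE (f : F) : `|\pi_(Lp_type mu p1) f : Lp01 p1| = fine ('N[mu]_p%:E [EFin \o f]).
  exact: Lp_norm_pi.
rewrite /dyadic_unit pi_sum nE.
rewrite (_ : EFin \o _ =
    (fun x => (\sum_(k < 2 ^ L) c k * \1_(dyadic_interval L k) x)%:E)); last first.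
  by apply/funext => x /=; rewrite sum_apply.
rewrite norm_step/= powRVK ?gt_eqF// ?div1r//.
by rewrite mulr_ge0 ?invr_ge0 ?sumr_ge0// => k _; exact: powR_ge0.
Qed.

End DyadicIndicators.

Lemma not_embeds_Lp01_Bp (R : realType) (p : R) (p2 : 2 < p) :
  ~ embeds (Lp01 (ge1_gt2 p2)) (Bp p2).
Proof.
move=> /embeds_below[T [c [C [c0 C0 TC Tc]]]].
have /embeds_below[S [c' [C' [c'0 C'0 SC Sc]]]] := embeds_Bp_sum_ell2 p2.
apply: (@no_dyadic_system R p p2 (ge1_gt2 p2) (fun=> ell2 R) (fun=> @ell2_parallelogram R)
  (Lp01 (ge1_gt2 p2)) (S \o T) (c' * c) (C' * C) _ _ _ _
  (@dyadic_unit R p (ge1_gt2 p2))).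
- exact: mulr_gt0.
- exact: mulr_gt0.
- by move=> x; rewrite -mulrA (le_trans (SC _))// ler_pM2l.
- by move=> x; rewrite -mulrA (le_trans _ (Sc _))// ler_pM2l.
- exact: dyadic_unit_dyadic.
Qed.

Theorem proposition2p37 (R : realType) :
  (forall (p : R) (p2 : 2 < p),
    (* (a) *) embeds (Bp p2) (lpsum_ell2 (ge1_gt2 p2)) /\
    (* (b) *) cembeds (lpsum_ell2 (ge1_gt2 p2)) (Bp p2) /\
    (* (c) *) mutually_embed (Bp p2) (lpsum_ell2 (ge1_gt2 p2)) /\
    (* (d) *) ~ cembeds (Bp p2) (lpsum_ell2 (ge1_gt2 p2)) /\
    (forall w : nat -> R, (forall n, 0 < w n) -> condition_star p w ->
      (* (e) *) embeds (Xp p2 w) (Bp p2) /\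
      (* (f) *) ~ embeds (Bp p2) (Xp p2 w) /\
      (* (g) *) ~ cembeds (Xp p2 w) (Bp p2)) /\
    (* (h) *) ~ embeds (Lp01 (ge1_gt2 p2)) (Bp p2)) /\
  (* (i) *)
  (forall (q : R) (q12 : 1 < q < 2),
    (* (b) *) cembeds (lpsum_ell2 (ge1_lt2 q12)) (Bq q12) /\
    (* (d) *) ~ cembeds (Bq q12) (lpsum_ell2 (ge1_lt2 q12)) /\
    (* (g) *) (forall w : nat -> R, (forall n, 0 < w n) ->
                 condition_star (conj_exp q) w ->
                 ~ cembeds (Xq q12 w) (Bq q12))).
Proof.
split=> [p p2|q q12].
  split; first exact: embeds_Bp_sum_ell2.
  split; first exact/retract_cembeds/retract_sum_ell2_Bp.
  split.
    split; first exact: embeds_Bp_sum_ell2.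
    exact/retract_embeds/retract_sum_ell2_Bp.
  split; first by move=> /cembeds_retract; exact: not_retract_Bp_sum_ell2.
  split=> [w w0 star|]; last exact: not_embeds_Lp01_Bp.
  split; first exact: embeds_Xp_Bp.
  split; first exact: not_embeds_Bp_Xp.
  by move=> /cembeds_retract; exact: not_retract_Xp_Bp.
split; first exact/retract_cembeds/retract_sum_ell2_Bq.
split; first by move=> /cembeds_retract; exact: not_retract_Bq_sum_ell2.
by move=> w w0 star /cembeds_retract; exact: not_retract_Xq_Bq.
Qed.
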